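(* If a convex polytope $P\subset\mathbb{R}^4$ is dual to (i.e. its face lattice is anti-isomorphic to that of) a neighborly $4$-polytope on $8$ vertices, then $P$ is not inscribed.
   Context: A $4$-polytope is neighborly if every two of its vertices are joined by an edge. A $4$-polytope in $\mathbb{R}^4$ is inscribed if all its vertices lie on a common $3$-sphere. Duality is meant combinatorially: two polytopes are dual if their face lattices are anti-isomorphic. *)

(* Defs.v *)
From HB Require Import structures.
From mathcomp Require Import all_boot all_order all_algebra.
From mathcomp Require Import boolp classical_sets functions cardinality.
From mathcomp Require Import reals convex.

Set Implicit Arguments.
Unset Strict Implicit.
Unset Printing Implicit Defensive.

Import Order.TTheory GRing.Theory Num.Theory.

Local Open Scope classical_set_scope.
Local Open Scope ring_scope.

Section Polytopes.
Variables (R : realType) (d : nat).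
Implicit Types (x v w c : 'rV[R]_d) (A P F : set 'rV[R]_d).

Definition dotv x v : R := \sum_(i < d) x 0 i * v 0 i.

Definition conv_hull A : set 'rV[R]_d := smallest (@convex_set R 'rV[R]_d) A.

Definition polytope P := exists2 V, finite_set V & P = conv_hull V.

Definition affine_set A :=
  forall x v (t : R), A x -> A v -> A ((1 - t) *: x + t *: v).

Definition aff_hull A : set 'rV[R]_d := smallest affine_set A.

Definition has_dim A (k : nat) :=
  exists x (U : {vspace 'rV[R]_d}),
    aff_hull A = [set y | y - x \in U] /\ \dim U = k.

(* [c = 0] is allowed: it yields the improper faces [P] ([b = 0]) and the empty
   set ([b = 1]). *)
Definition is_face P F :=
  exists c (b : R), (forall x, P x -> dotv c x <= b) /\
    F = P `&` [set x | dotv c x = b].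

Definition faces P : set (set 'rV[R]_d) := [set F | is_face P F].

Definition vertices P : set 'rV[R]_d := [set v | is_face P [set v]].

Definition is_edge P F := is_face P F /\ has_dim F 1.

Definition neighborly P :=
  forall v w, vertices P v -> vertices P w -> v <> w ->
    exists F, [/\ is_edge P F, F v & F w].

(* The Euclidean sphere; the library norm on matrices is the max norm. *)
Definition euclidean_sphere c (r : R) : set 'rV[R]_d :=
  [set x | dotv (x - c) (x - c) = r ^+ 2].

Definition inscribed P :=
  exists c (r : R), 0 < r /\ vertices P `<=` euclidean_sphere c r.

End Polytopes.

(* The face lattices, ordered by inclusion, are anti-isomorphic. *)
Definition dual_polytopes (R : realType) (m n : nat)
    (P : set 'rV[R]_m) (Q : set 'rV[R]_n) :=
  exists phi : set 'rV[R]_m -> set 'rV[R]_n,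
    set_bij (faces P) (faces Q) phi /\
    forall F G, faces P F -> faces P G -> (F `<=` G <-> phi G `<=` phi F).

(* Main.v *)
(* A Radon partition of five or fewer vertices of a neighborly 4-polytope would have a
   part of at most two vertices, which is a face: so these vertices are affinely
   independent, and the facets are tetrahedra. Hence P is a simple polytope with 8
   facets, any two of which share a 2-face, and a vertex of P is coded by the set of the
   4 facets through it.

   If P is inscribed, the vertices of each 2-face lie on a circle, and the inversion at
   one of them, p, maps the others to a line. For facets i, j, k write s_k(x) for the
   slack at x of the inequality of the facet k. When p, q are the ends of the edge ijk,
   comparing both sides on that line shows that s_k(x) is proportional to |xp| |xq| over
   the vertices x of the 2-face ij. When p and its neighbours x, z and any other vertex
   y lie on a 2-face, y is mapped between x and z, which is the strict Ptolemy
   inequality |xy| |pz| < |xz| |py|.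

   Every possible vertex set contains, up to relabelling the facets, one of finitely many
   patterns in which some product of these equalities and strict inequalities cancels to
   1 < 1. This is a finite search over partial vertex sets: the second end of an edge of
   a known vertex, or a vertex on a 2-face without a known one, has to be somewhere. *)
Require Import Defs.
From HB Require Import structures.
From mathcomp Require Import all_boot all_order all_algebra.
From mathcomp Require Import zify ring lra.

Set Implicit Arguments.
Unset Strict Implicit.
Unset Printing Implicit Defensive.

Import Order.TTheory GRing.Theory Num.Theory.

(** * Search over vertex-facet incidences *)

(** In the logarithms of slacks and distances the equalities are linear equations and the Ptolemy
    inequalities strict linear inequalities. By Farkas' lemma a pattern whose relations contradict
    each other linearly has a cancelling product with integer exponents, which linear programming
    finds; a negative exponent of an equality becomes positive when [x] and [y] are exchanged. The
    search is pruned by the number of vertices of the 2-faces. It is split by the largest such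
    number: at most 3, exactly 4, exactly 5, at least 6. The labels 0 and 1 go to a 2-face that
    reaches it (in the first case, to any), so that this 2-face is bounded below and, except in the
    last case, all are bounded above. Pruning also uses that a 2-face is one cycle. This, like the
    bound of two vertices on an edge, is read off from the inversion: the vertices of a 2-face other
    than [p] go to a line, and their order on it replaces plane geometry. *)

Section Labels.
Local Open Scope nat_scope.

(* The checker is run by call-by-value evaluation, where [&&] and [||] do not
   short-circuit: hence [if] and the variants of [has] and [all] below. *)
Fixpoint memn (i : nat) (x : seq nat) :=
  if x is j :: x' then if eqn i j then true else memn i x' else false.

Fixpoint subn_seq (x y : seq nat) :=
  if x is i :: x' then if memn i y then subn_seq x' y else false else true.

Fixpoint covers (x : seq nat) (K : seq (seq nat)) :=
  if K is y :: K' then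
    if subn_seq x y then y :: covers x K' else covers x K'
  else [::].

Fixpoint hasb (T : Type) (p : T -> bool) (s : seq T) :=
  if s is x :: s' then if p x then true else hasb p s' else false.

Fixpoint allb (T : Type) (p : T -> bool) (s : seq T) :=
  if s is x :: s' then if p x then allb p s' else false else true.

Lemma memnE i x : memn i x = (i \in x).
Proof. by elim: x => //= j x ->; rewrite inE -[eqn i j]/(i == j); case: eqP. Qed.

Lemma subn_seqE x y : subn_seq x y = all (fun i => i \in y) x.
Proof. by elim: x => //= i x ->; rewrite memnE; case: (i \in y). Qed.

Lemma coversE x K : covers x K = [seq y <- K | subn_seq x y].
Proof. by elim: K => //= y K ->. Qed.

Lemma hasbE (T : Type) (p : T -> bool) s : hasb p s = has p s.
Proof. by elim: s => //= x s ->; case: (p x). Qed.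

Lemma allbE (T : Type) (p : T -> bool) s : allb p s = all p s.
Proof. by elim: s => //= x s ->; case: (p x). Qed.

(* Every edge at a vertex of [L] in the 2-face [e] has both its ends in [L]. *)
Definition closed_at (e : seq nat) (L : seq (seq nat)) :=
  allb (fun x => allb (fun k =>
    if memn k e then true else 1 < size (covers [:: k] L)) x) L.

(** In a simple polytope the ends of an edge share three facets. A vertex is adjacent to itself, so
    iteration keeps the vertices already reached. *)
Definition adjacent (x y : seq nat) := 2 < size [seq i <- x | memn i y].

(** Each edge of a 2-face lies on one of the six other facets, so a 2-face is at most a hexagon and
    three rounds from [y] reach all of its cycle. Soundness uses only that the result is a sublist
    of [L]. *)
Definition component (L : seq (seq nat)) (y : seq nat) :=
  iter 3 (fun C => [seq x <- L | hasb (adjacent x) C]) [:: y].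

(* The vertex [y] is inconsistent with the known vertices [K] when the 2-face [e] gets
   more than [hi] vertices, when its known vertices form a cycle without [y] or a cycle
   through [y] missing one of them, or when the 2-face of [0] and [1], which is to have
   at least [lo] vertices, closes up too early. *)
Definition bad_pair lo hi (K : seq (seq nat)) (y e : seq nat) :=
  let L := covers e K in
  if hi <= size L then true else
  if (if L is [::] then false else closed_at e L) then true else
  let C := component (y :: L) y in
  if (if C is [::] then false else closed_at e C) then
    if size C <= size L then true else
    if memn 0 e then if memn 1 e then size C < lo else false else false
  else false.

Definition bad_triple (K : seq (seq nat)) (t : seq nat) := 1 < size (covers t K).

Definition bad lo hi K (y : seq nat) :=
  if y is [:: a; b; c; d] then
    if hasb (bad_triple K) [:: [:: a; b; c]; [:: a; b; d]; [:: a; c; d]; [:: b; c; d]]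
    then true else
    hasb (bad_pair lo hi K y)
      [:: [:: a; b]; [:: a; c]; [:: a; d]; [:: b; c]; [:: b; d]; [:: c; d]]
  else true.

(** A string of labels is written as one numeral; unlike a number in [nat], it keeps its leading
    zeros. *)
Fixpoint decimal_digits (c : Decimal.uint) : seq nat :=
  match c with
  | Decimal.Nil => [::]
  | Decimal.D0 c => 0 :: decimal_digits c
  | Decimal.D1 c => 1 :: decimal_digits c
  | Decimal.D2 c => 2 :: decimal_digits c
  | Decimal.D3 c => 3 :: decimal_digits c
  | Decimal.D4 c => 4 :: decimal_digits c
  | Decimal.D5 c => 5 :: decimal_digits c
  | Decimal.D6 c => 6 :: decimal_digits c
  | Decimal.D7 c => 7 :: decimal_digits c
  | Decimal.D8 c => 8 :: decimal_digits c
  | Decimal.D9 c => 9 :: decimal_digits c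
  end.

Definition digits (c : Number.uint) : seq nat :=
  if c is Number.UIntDecimal c then decimal_digits c else [::].

(* [Branch abc] distinguishes the second vertex on the edge of the facets [a], [b],
   [c]; [Pair ab] a vertex on the 2-face of [a] and [b]; [Pattern n f] refers to the
   obstruction number [n], relabelled by the digits of [f]. The subtrees follow the
   candidates that are not [bad]. *)
Inductive tree :=
  | Branch of Number.uint & seq tree
  | Pair of Number.uint & seq tree
  | Pattern of nat & Number.uint.

(** The automatic induction principle gives no hypothesis for the subtrees inside a list. *)
Lemma tree_nested_ind (P : tree -> Prop) :
  (forall c ts, (forall t, List.In t ts -> P t) -> P (Branch c ts)) ->
  (forall c ts, (forall t, List.In t ts -> P t) -> P (Pair c ts)) ->
  (forall n c, P (Pattern n c)) -> forall t, P t.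
Proof.
move=> HB HP HL; fix IH 1 => -[c|c|n c]; last exact: HL.
  move=> ts; apply: HB; elim: ts => [t []|t ts IHts t' [<-|/IHts h]].
    exact: IH.
  exact: h.
move=> ts; apply: HP; elim: ts => [t []|t ts IHts t' [<-|/IHts h]].
  exact: IH.
exact: h.
Qed.

Definition branch_candidates u (t : seq nat) :=
  [seq v :: t | v <- iota 0 (minn u.+1 8) & ~~ memn v t].

Definition pair_candidates (e : seq nat) :=
  [seq y <- [seq [:: c, d & e] | c <- iota 0 8, d <- iota c.+1 (7 - c)] | uniq y].

(* The labels below [u] are those of the facets met so far; the others are
   interchangeable, so that a new facet may be assumed to get the label [u]. *)
Section Check.
Variables (lo hi : nat) (patterns : seq (seq (seq nat))).

Fixpoint check u K (t : tree) {struct t} : bool :=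
  let go (u' : seq nat -> nat) := fix go ys ts {struct ts} :=
    match ts, ys with
    | t :: ts', y :: ys' => if check (u' y) (y :: K) t then go ys' ts' else false
    (* The subtrees match the surviving candidates one by one; an empty list closes a case in which
       no candidate survives. *)
    | [::], [::] => true
    | _, _ => false
    end in
  match t with
  | Branch c ts =>
      let t := digits c in
      if [&& size t == 3, uniq t & all (fun i => i < u) t] then
        if covers t K is [:: x0] then
          (* The head of a candidate is its added label, the only one that can be new. *)
          go (fun y => maxn u (head 0 y).+1)
            [seq y <- branch_candidates u t |
              if subn_seq y x0 then false else ~~ bad lo hi K y] ts
        else false
      else false
  | Pair c ts =>
      let e := digits c in
      if [&& size e == 2, uniq e & all (fun i => i < 8) e] then
        if covers e K is [::] then
          (* The two added labels range over all eight, so from here on no labels are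
             interchangeable. *)
          go (fun=> 8) [seq y <- pair_candidates e | ~~ bad lo hi K y] ts
        else false
      else false
  | Pattern n c =>
      let f := digits c in
      if [&& size f == 8, uniq f & all (fun i => i < 8) f] then
        if n < size patterns then
          allb (fun q => hasb (subn_seq (map (nth 0 f) q)) K) (nth [::] patterns n)
        else false
      else false
  end.

(** The inner fixpoint of [check] is anonymous, hence spelled out again; [P] stands for the
    recursive call. *)
Lemma check_forest (P : seq nat -> tree -> bool) ys ts :
  (fix go ys ts {struct ts} :=
    match ts, ys with
    | t :: ts', y :: ys' => if P y t then go ys' ts' else false
    | [::], [::] => true
    | _, _ => false
    end) ys ts -> forall y, y \in ys -> exists2 t, List.In t ts & P y t.
Proof.
elim: ts ys => [|t ts IH] [|z ys] //=; case: ifP => // Pzt /IH{}IH y.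
rewrite inE => /predU1P[->|/IH[t' ts' Py]]; first by exists t => //; left.
by exists t' => //; right.
Qed.

End Check.

Definition wf u (x : seq nat) := [&& size x == 4, uniq x & all (fun i => i < u) x].

End Labels.

(* [V] is the set of the vertices of a simple polytope, coded by their facets. *)
Section Soundness.
Variable V : {set {set 'I_8}}.
Implicit Types (s : nat -> 'I_8) (x y e : seq nat) (K L : seq (seq nat)).

Definition at_face (A : {set 'I_8}) := [set t in V | A \subset t].

Hypothesis V_card : forall t, t \in V -> #|t| = 4.
Hypothesis V_triple : forall T : {set 'I_8}, #|T| = 3 -> #|at_face T| <= 2.
Hypothesis V_edge : forall t (T : {set 'I_8}), t \in V -> T \subset t -> #|T| = 3 ->
  exists t', [/\ t' \in V, t' != t & T \subset t'].
Hypothesis V_pair : forall i j, i != j -> exists2 t, t \in V & [set i; j] \subset t.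
Hypothesis V_connected : forall i j (C : {set {set 'I_8}}), i != j ->
  C \subset at_face [set i; j] -> C != set0 ->
  (forall t k, t \in C -> k \in t -> k \notin [set i; j] ->
    exists t', [/\ t' \in C, t' != t & k \in t']) ->
  at_face [set i; j] \subset C.

(** Labels are plain numbers for the sake of evaluation; below 8 they correspond bijectively to the
    facets. *)
Definition labelling s := forall i j, i < 8 -> j < 8 -> s i = s j -> i = j.

Definition img s x : {set 'I_8} := [set k in map s x].

Definition small x := all (fun i => i < 8) x.

Lemma labelling_surj s k : labelling s -> exists2 i, i < 8 & k = s i.
Proof.
move=> s_inj; have us : uniq (map s (iota 0 8)).
  rewrite map_inj_in_uniq ?iota_uniq // => i j.
  by rewrite !mem_iota !add0n => /= i8 j8; apply: s_inj.
have : k \in map s (iota 0 8).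
  have sub : {subset map s (iota 0 8) <= enum 'I_8} by move=> j _; rewrite mem_enum.
  have le8 : size (enum 'I_8) <= size (map s (iota 0 8)).
    by rewrite size_map size_iota size_enum_ord.
  by have [_ ->] := uniq_min_size us sub le8; rewrite mem_enum.
by case/mapP => i; rewrite mem_iota add0n => /= i8 ->; exists i.
Qed.

Lemma mem_img s x i : labelling s -> small x -> i < 8 -> (s i \in img s x) = (i \in x).
Proof.
move=> s_inj /allP x8 i8; rewrite inE; apply/mapP/idP => [[j jx /s_inj->]|ix] //.
  exact: x8.
by exists i.
Qed.

Lemma img_sub s x y : labelling s -> small x -> small y ->
  (img s x \subset img s y) = subn_seq x y.
Proof.
move=> s_inj x8 y8; rewrite subn_seqE; apply/subsetP/allP => xy i.
  move=> ix; have i8 : i < 8 := allP x8 i ix.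
  by rewrite -(mem_img s_inj) // xy // mem_img.
have [j j8 ->] := labelling_surj i s_inj.
by rewrite !mem_img // => /xy.
Qed.

Lemma card_img s x : labelling s -> small x -> uniq x -> #|img s x| = size x.
Proof.
move=> s_inj /allP x8 ux; rewrite cardsE -(size_map s); apply/card_uniqP.
by rewrite map_inj_in_uniq // => i j /x8 i8 /x8 j8; apply: s_inj.
Qed.

Lemma wf_small u x : u <= 8 -> wf u x -> small x.
Proof.
by move=> u8 /and3P[_ _ /allP xu]; apply/allP => i /xu iu; apply: leq_trans u8.
Qed.

Lemma size_le_card (T : finType) (A : {set T}) (r : seq T) :
  uniq r -> {subset r <= A} -> size r <= #|A|.
Proof. by move=> ur rA; rewrite cardE; apply: uniq_leq_size => // t; rewrite mem_enum => /rA. Qed.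

(** Two entries of [L] contain [k], and they have different images, so one of them is not the image
    of [x]. *)
Lemma exists_other s L k x : uniq (map (img s) L) ->
  1 < size (covers [:: k] L) -> exists2 x', x' \in L & k \in x' /\ img s x' != img s x.
Proof.
move=> uL; rewrite coversE => c2.
have /hasP[x' x'L h] : has (fun x' => (k \in x') && (img s x' != img s x)) L.
  apply: contraLR c2 => /hasPn no; rewrite -leqNgt.
  rewrite -(size_map (img s)); apply: (@uniq_leq_size _ _ [:: img s x]).
    by apply: subseq_uniq uL; apply: map_subseq; apply: filter_subseq.
  move=> t /mapP[x']; rewrite mem_filter /= memnE => /andP[kx' x'L] ->.
  by rewrite inE; have := no x' x'L; move: kx'; case: (k \in x') => //=; rewrite negbK.
by exists x' => //; apply/andP.
Qed.

(** * Soundness of rejecting a candidate vertex *)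

Section Config.
Variables (s : nat -> 'I_8) (lo hi : nat).
Hypothesis s_inj : labelling s.
Hypothesis lo_le : lo <= #|at_face (img s [:: 0; 1])|.
Hypothesis le_hi : forall i j, i != j -> #|at_face [set i; j]| <= hi.

(** Distinctness is asked of the images, since one vertex can be listed with its labels in several
    orders. *)
Definition config u K := [/\ u <= 8, all (wf u) K, all (fun x => img s x \in V) K
  & uniq (map (img s) K)].

Lemma img2 a b : img s [:: a; b] = [set s a; s b].
Proof. by apply/setP => k; rewrite !inE. Qed.

Lemma config_covers u K e x : config u K -> small e -> x \in covers e K ->
  [/\ x \in K, wf 8 x, subn_seq e x, img s x \in V & img s x \in at_face (img s e)].
Proof.
move=> [u8 /allP Ku /allP KV _] e8; rewrite coversE mem_filter => /andP[ex xK].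
have x8 : wf 8 x.
  have /and3P[x4 xu xlt] := Ku x xK; apply/and3P; split=> //.
  by apply: sub_all xlt => i iu; apply: leq_trans u8.
split=> //; first exact: KV.
by rewrite inE KV // img_sub // (wf_small _ x8).
Qed.

(** The images of [L] have no loose end, which is the closure hypothesis of [V_connected]: a closed
    partial 2-face is complete. *)
Lemma closed_sound (L : seq (seq nat)) a b : a < 8 -> b < 8 -> a != b ->
  (forall x, x \in L -> wf 8 x /\ img s x \in at_face (img s [:: a; b])) ->
  uniq (map (img s) L) -> L != [::] -> closed_at [:: a; b] L ->
  {subset at_face (img s [:: a; b]) <= map (img s) L}.
Proof.
move=> a8 b8 ab LP uL Ln0 cl.
have sab : s a != s b by apply: contra_neq ab; apply: s_inj.
pose C := [set t in map (img s) L].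
have /subsetP sub : at_face (img s [:: a; b]) \subset C.
  rewrite img2; apply: V_connected => //.
  - by apply/subsetP => t; rewrite inE => /mapP[x /LP[_ xV] ->]; rewrite -img2.
  - apply/set0Pn; case: L Ln0 {LP uL cl} @C => // x L _.
    by exists (img s x); rewrite inE inE eqxx.
  move=> t k; rewrite inE => /mapP[x xL ->] kx kab.
  have [x8 _] := LP x xL; have [i i8 ki] := labelling_surj k s_inj.
  have ix : i \in x by rewrite -(mem_img s_inj) ?(wf_small _ x8) // -ki.
  have iab : i \notin [:: a; b].
    by apply: contra kab; rewrite ki !inE => /orP[] /eqP->; rewrite eqxx ?orbT.
  move: cl; rewrite /closed_at allbE => /allP/(_ x xL); rewrite allbE => /allP/(_ i ix).
  rewrite memnE (negPf iab) => /(exists_other x uL)[x' x'L [ix' x'x]].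
  exists (img s x'); rewrite inE map_f // x'x ki; split=> //.
  by have [x'8 _] := LP x' x'L; rewrite mem_img ?(wf_small _ x'8).
by move=> t /sub; rewrite inE.
Qed.

(** Every test is compared with the true 2-face, which has at most [hi] vertices. By [closed_sound]
    a closed [L] would already contain [y], and a closed component of [y] contains all of [y :: L]
    and has the size of the 2-face. *)
Lemma bad_pair_sound u K y a b : config u K -> wf 8 y -> img s y \in V ->
  img s y \notin map (img s) K -> a \in y -> b \in y -> a != b ->
  bad_pair lo hi K y [:: a; b] = false.
Proof.
move=> cK y8 yV yK ay by_ ab; have ys := wf_small (leqnn 8) y8.
have [a8 b8] := (allP ys a ay, allP ys b by_).
have e8 : small [:: a; b] by rewrite /small /= a8 b8.
have sab : s a != s b by apply: contra_neq ab; apply: s_inj.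
have yE : img s y \in at_face (img s [:: a; b]).
  by rewrite inE yV img_sub // subn_seqE /= ay by_.
rewrite /bad_pair; set L := covers _ K.
have uL : uniq (map (img s) (y :: L)).
  rewrite /= (subseq_uniq _ (let: And4 _ _ _ h := cK in h)) ?andbT; last first.
    by rewrite /L coversE; apply: map_subseq; apply: filter_subseq.
  apply: contra yK; apply: mem_subseq; rewrite /L coversE.
  by apply: map_subseq; apply: filter_subseq.
have LP x : x \in y :: L -> wf 8 x /\ img s x \in at_face (img s [:: a; b]).
  by rewrite inE => /predU1P[->//|/(config_covers cK e8)[]].
have szL : (size L).+1 <= #|at_face (img s [:: a; b])|.
  rewrite -[(size L).+1](size_map (img s) (y :: L)); apply: size_le_card => // t.
  by case/mapP => x /LP[_ xE] ->.
have -> : (hi <= size L) = false.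
  by apply/negbTE; rewrite -ltnNge (leq_trans szL) // img2 le_hi.
have -> : (if L is [::] then false else closed_at [:: a; b] L) = false.
  apply/negP => cl; have Ln0 : L != [::] by case: L cl {uL LP szL}.
  have : img s y \in map (img s) L.
    apply: closed_sound yE => //.
    + by move=> x xL; apply: LP; rewrite inE xL orbT.
    + by case/andP: uL.
    + by case: L cl {uL LP szL Ln0}.
  by case/andP: uL => /negP.
case: ifP => // clC.
have {clC} [Cn0 clC] : component (y :: L) y != [::] /\ closed_at [:: a; b] (component (y :: L) y).
  by move: clC; case: (component _ _).
have CL : subseq (component (y :: L) y) (y :: L) by exact: filter_subseq.
have szC : #|at_face (img s [:: a; b])| <= size (component (y :: L) y).
  rewrite cardE -(size_map (img s) (component _ _)).
  apply: uniq_leq_size; first exact: enum_uniq.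
  move=> t; rewrite mem_enum; apply: closed_sound => //.
  - by move=> x /(mem_subseq CL)/LP.
  - by apply: subseq_uniq uL; apply: map_subseq.
have -> : (size (component (y :: L) y) <= size L) = false.
  by apply/negbTE; rewrite -ltnNge (leq_trans szL).
rewrite !memnE; case: ifP => // m0; case: ifP => // m1.
apply/negbTE; rewrite -leqNgt (leq_trans _ szC) // (leq_trans lo_le) //.
suff -> : img s [:: a; b] = img s [:: 0; 1] by [].
have [[-> ->]|[-> ->]] // : (a = 0 /\ b = 1) \/ (a = 1 /\ b = 0).
  move: m0 m1; rewrite !inE => /orP[] /eqP e0 /orP[] /eqP e1.
  - by rewrite -e0 in e1.
  - by left.
  - by right.
  - by rewrite -e0 in e1.
by rewrite !img2 setUC.
Qed.

Lemma bad_sound u K y : config u K -> wf 8 y -> img s y \in V ->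
  img s y \notin map (img s) K -> bad lo hi K y = false.
Proof.
move=> cK y8 yV yK; have ys := wf_small (leqnn 8) y8.
have y4 : size y = 4 by case/and3P: y8 => /eqP.
have yu : uniq y by case/and3P: y8.
case: y y4 y8 yV yK ys yu => [|a [|b [|c [|d [|]]]]] // _ y8 yV yK ys yu.
have bad_triple_sound t : subseq t [:: a; b; c; d] -> size t = 3 -> bad_triple K t = false.
  move=> ty t3; apply/negbTE; rewrite -leqNgt.
  have t8 : small t by apply/allP => i /(mem_subseq ty)/(allP ys).
  have tT : #|img s t| = 3 by rewrite card_img // (subseq_uniq ty).
  rewrite -ltnS; apply: leq_trans (V_triple tT).
  rewrite -[(size _).+1](size_map (img s) ([:: a; b; c; d] :: covers t K)).
  apply: size_le_card => [|T].
    rewrite /= (subseq_uniq _ (let: And4 _ _ _ h := cK in h)) ?andbT; last first.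
      by rewrite coversE; apply: map_subseq; apply: filter_subseq.
    apply: contra yK; apply: mem_subseq; rewrite coversE.
    by apply: map_subseq; apply: filter_subseq.
  case/mapP => x; rewrite inE => /predU1P[->|/(config_covers cK t8)[_ _ _ _ xE]] -> //.
  by rewrite inE yV img_sub // subn_seqE; apply/allP => i; apply: mem_subseq.
have bp i j : i \in [:: a; b; c; d] -> j \in [:: a; b; c; d] -> i != j ->
    bad_pair lo hi K [:: a; b; c; d] [:: i; j] = false.
  by move=> iy jy ij; apply: (bad_pair_sound cK).
move: yu; rewrite /= !inE !negb_or => /and4P[/and3P[ab ac ad] /andP[bc bd] cd _].
have s1 : subseq [:: a; b; c] [:: a; b; c; d].
  exact: (mask_subseq [:: true; true; true; false] [:: a; b; c; d]).
have s2 : subseq [:: a; b; d] [:: a; b; c; d].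
  exact: (mask_subseq [:: true; true; false; true] [:: a; b; c; d]).
have s3 : subseq [:: a; c; d] [:: a; b; c; d].
  exact: (mask_subseq [:: true; false; true; true] [:: a; b; c; d]).
have s4 : subseq [:: b; c; d] [:: a; b; c; d].
  exact: (mask_subseq [:: false; true; true; true] [:: a; b; c; d]).
lazy beta iota delta [bad]; rewrite !bad_triple_sound //.
by rewrite !bp // !inE eqxx ?orbT.
Qed.

End Config.

(** * Relabelling and soundness of the search tree *)

Lemma img_cons s v x : img s (v :: x) = s v |: img s x.
Proof. by apply/setP => k; rewrite !inE. Qed.

Lemma eq_img s s' x : {in x, s =1 s'} -> img s x = img s' x.
Proof. by move=> /eq_in_map e; rewrite /img e. Qed.

Definition swap (a b i : nat) := if i == a then b else if i == b then a else i.

Lemma swapK a b : involutive (swap a b).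
Proof.
move=> i; rewrite /swap; have [->|ia] := eqVneq i a.
  by rewrite eqxx; have [->|] := eqVneq b a.
have [->|ib] := eqVneq i b; first by rewrite eqxx.
by rewrite (negPf ia) (negPf ib).
Qed.

Lemma swap_labelling s a b : a < 8 -> b < 8 -> labelling s -> labelling (s \o swap a b).
Proof.
move=> a8 b8 s_inj i j i8 j8 /= e; apply: (inv_inj (swapK a b)).
by apply: s_inj e; rewrite /swap; case: ifP => // _; case: ifP.
Qed.

(* Given the tetrahedra of [K], any further one can be given labels that exceed the
   used ones as little as possible. *)
Lemma relabel s u K T t : labelling s -> config s u K -> small T ->
  all (fun i => i < u) T -> uniq T -> size T = 3 -> t \in V -> img s T \subset t ->
  exists s' v, [/\ labelling s', {in gtn u, s =1 s'}, v < minn u.+1 8,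
    v \notin T & img s' (v :: T) = t].
Proof.
move=> s_inj [u8 _ _ _] T8 Tu uT T3 tV Tt.
have cT : #|img s T| = 3 by rewrite card_img.
have [z zT tE] : exists2 z, z \notin img s T & t = z |: img s T.
  have : img s T \proper t by rewrite properEcard Tt cT V_card.
  case/properP=> _ [z zt zT]; exists z => //; apply/eqP.
  rewrite eq_sym eqEcard subUset sub1set zt Tt cardsU1 zT cT.
  by rewrite V_card.
have [v v8 zE] := labelling_surj z s_inj.
have vT : v \notin T by rewrite -(mem_img s_inj) // -zE.
have [vu|uv] := ltnP v u.
  exists s, v; split=> //; first by rewrite leq_min ltnS ltnW.
  by rewrite img_cons -zE tE.
have u_lt8 : u < 8 := leq_ltn_trans uv v8.
(* The new facet has a label [v] not met so far. Exchanging it with [u] leaves the labels below [u]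
   alone. *)
have s'E : {in gtn u, s =1 s \o swap u v}.
  move=> i; rewrite inE /= /swap => iu.
  by rewrite (ltn_eqF iu) (ltn_eqF (leq_trans iu uv)).
exists (s \o swap u v), u; split=> //.
- exact: swap_labelling.
- by rewrite leq_min ltnSn.
- by apply/negP => /(allP Tu); rewrite ltnn.
rewrite img_cons /= /swap eqxx -zE tE; congr (_ |: _); apply: eq_img => i iT.
by rewrite s'E // inE; apply: (allP Tu).
Qed.

Lemma config_eq s s' u K : {in gtn u, s =1 s'} -> config s u K -> config s' u K.
Proof.
move=> ss' [u8 Ku KV uK].
have e x : x \in K -> img s x = img s' x.
  move=> xK; apply: eq_img => i ix; apply: ss'; rewrite inE.
  by have /and3P[_ _ /allP] := allP Ku x xK; apply.
split=> //; first by apply/allP => x xK; rewrite -e // (allP KV).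
suff <- : map (img s) K = map (img s') K by [].
by apply/eq_in_map => x /e.
Qed.

Lemma config_cons s u u' K y : config s u K -> u <= u' -> u' <= 8 -> wf u' y ->
  img s y \in V -> img s y \notin map (img s) K -> config s u' (y :: K).
Proof.
move=> [u8 Ku KV uK] uu' u'8 yu' yV yK; split=> //=; rewrite ?yV ?yK ?yu' //=.
apply: sub_all Ku => x /and3P[x4 xu /allP xlt]; apply/and3P; split=> //.
by apply/allP => i /xlt iu; apply: leq_trans uu'.
Qed.

Variables (lo hi : nat) (patterns : seq (seq (seq nat))).
Hypothesis le_hi : forall i j, i != j -> #|at_face [set i; j]| <= hi.
Hypothesis patterns_wf : all (all (wf 8)) patterns.
Hypothesis no_pattern : forall p s, p \in patterns -> labelling s ->
  (forall q, q \in p -> img s q \in V) -> False.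

(** The labelling is quantified under the induction because a [Branch] node may exchange two labels
    not met so far. The condition [1 < u] keeps 0 and 1 out of such exchanges, so that [lo] goes on
    bounding the same 2-face. *)
Lemma check_sound t : forall s u K, labelling s -> config s u K -> 1 < u ->
  lo <= #|at_face (img s [:: 0; 1])| -> check lo hi patterns u K t -> False.
Proof.
elim/tree_nested_ind: t => [c ts IH|c ts IH|n c] s u K s_inj cK u1 lo_le /=.
- set T := digits c; case: ifP => // /and3P[/eqP T3 uT Tu].
  have u8 : u <= 8 by case: cK.
  have T8 : small T by apply: sub_all Tu => i iu; apply: leq_trans u8.
  case E: (covers T K) => [//|x0 [|//]] ok.
  have x0T : x0 \in covers T K by rewrite E inE.
  have [x0K x0wf Tx0 x0V _] := config_covers s_inj cK T8 x0T.
  have Tx0' : img s T \subset img s x0 by rewrite img_sub // (wf_small _ x0wf).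
  have cT : #|img s T| = 3 by rewrite card_img.
  have [t [tV tx0 Tt]] := V_edge x0V Tx0' cT.
  have [s' [v [s'_inj ss' vu vT tE]]] := relabel s_inj cK T8 Tu uT T3 tV Tt.
  have cK' := config_eq ss' cK.
  have eT : img s T = img s' T.
    by apply: eq_img => i iT; rewrite ss' // inE; apply: (allP Tu).
  have ex x : x \in K -> img s x = img s' x.
    move=> xK; apply: eq_img => i ix; rewrite ss' // inE.
    by case: cK => _ /allP/(_ x xK)/and3P[_ _ /allP] /(_ i ix).
  have lo_le' : lo <= #|at_face (img s' [:: 0; 1])|.
    rewrite -(eq_img (s := s)) // => i; rewrite !inE => /orP[] /eqP-> //.
      by rewrite ss' // inE ltnW.
    by rewrite ss' // inE.
  move: vu; rewrite leq_min => /andP[vu v8].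
  have ywf u' : u <= u' -> v < u' -> wf u' (v :: T).
    move=> uu' vu'; rewrite /wf /= T3 uT vT vu' /=.
    by apply: sub_all Tu => i iu; apply: leq_trans uu'.
  have yV : img s' (v :: T) \in V by rewrite tE.
  have yK : img s' (v :: T) \notin map (img s') K.
    rewrite tE; apply/mapP => -[x xK tx].
    have : x \in covers T K.
      rewrite coversE mem_filter xK andbT -(img_sub s'_inj) //.
        by rewrite -eT -tx.
      by apply: wf_small u8 _; case: cK => _ /allP/(_ x xK).
    rewrite E inE => /eqP xx0; move: tx0; rewrite tx xx0 ex ?eqxx //.
  have y_good : v :: T \in [seq y <- branch_candidates u T |
      if subn_seq y x0 then false else ~~ bad lo hi K y].
    rewrite mem_filter (bad_sound s'_inj lo_le' le_hi cK' (ywf 8 _ _)) //.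
    have -> : subn_seq (v :: T) x0 = false.
      apply/negbTE; rewrite -(img_sub s'_inj) //; last 2 first.
      + by rewrite /small /= v8; exact: T8.
      + by rewrite (wf_small _ x0wf).
      apply: contra tx0 => sub; rewrite eqEcard -tE ex // sub.
      by rewrite !V_card // -?ex // tE.
    apply/mapP; exists v => //; rewrite mem_filter memnE vT mem_iota add0n leq_min.
    by rewrite vu v8.
  have [t' t'ts ok'] := check_forest (P := fun y t =>
    check lo hi patterns (maxn u (head 0 y).+1) (y :: K) t) ok y_good.
  apply: (IH t' t'ts s' _ _ s'_inj _ _ lo_le' ok'); last by rewrite leq_max u1.
  apply: config_cons cK' _ _ _ yV yK; rewrite ?leq_maxl //=.
    by rewrite geq_max u8.
  by apply: ywf; rewrite ?leq_maxl // leq_max leqnn orbT.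
- set e := digits c; case: ifP => // /and3P[/eqP e2 ue e8].
  case E: (covers e K) => [|//] ok.
  have u8 : u <= 8 by case: cK.
  case: e e2 ue e8 E ok => [|a [|b [|]]] // _; rewrite /= !inE andbT => ab /and3P[a8 b8 _] E ok.
  have sab : s a != s b by apply: contra_neq ab; apply: s_inj.
  have [t tV abt] := V_pair sab.
  have [c' [d' [cd' tE]]] : exists c' d', c' != d' /\ t :\: [set s a; s b] = [set c'; d'].
    by apply/cards2P; rewrite cardsDS // V_card // cards2 sab.
  have [c1 c8 c'E] := labelling_surj c' s_inj.
  have [d1 d8 d'E] := labelling_surj d' s_inj.
  (* [pair_candidates] lists the two added labels in increasing order only. *)
  have [c2 [d2 [c2d2 d28 tE2]]] : exists c2 d2, [/\ c2 < d2, d2 < 8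
      & t :\: [set s a; s b] = [set s c2; s d2]].
    have cd1 : c1 != d1 by apply: contra_neq cd' => e1; rewrite c'E d'E e1.
    have [cd|dc|cd] := ltngtP c1 d1.
    + by exists c1, d1; rewrite tE c'E d'E.
    + by exists d1, c1; rewrite tE c'E d'E setUC.
    + by rewrite cd eqxx in cd1.
  have c28 : c2 < 8 := ltn_trans c2d2 d28.
  have yE : img s [:: c2; d2; a; b] = t.
    by rewrite 2!img_cons img2 setUA -tE2 [t :\: _ :|: _]setUC
      -[RHS](setID t [set s a; s b]) (setIidPr abt).
  have nab i : i \in [:: c2; d2] -> i \notin [:: a; b].
    move=> icd; have : s i \in t :\: [set s a; s b].
      by rewrite tE2; move: icd; rewrite !inE => /orP[] /eqP->; rewrite eqxx ?orbT.
    rewrite inE => /andP[+ _]; apply: contra; rewrite !inE.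
    by move=> /orP[] /eqP->; rewrite eqxx ?orbT.
  have ywf : wf 8 [:: c2; d2; a; b].
    rewrite /wf /= a8 b8 c28 d28 !inE; have := nab c2; have := nab d2.
    rewrite !inE !eqxx orbT !negb_or => /(_ isT)/andP[-> ->] /(_ isT)/andP[-> ->].
    by rewrite (ltn_eqF c2d2) ab.
  have yV : img s [:: c2; d2; a; b] \in V by rewrite yE.
  have yK : img s [:: c2; d2; a; b] \notin map (img s) K.
    apply/mapP => -[x xK yx]; have : x \in covers [:: a; b] K.
      rewrite coversE mem_filter xK andbT -(img_sub s_inj).
      + by rewrite -yx yE img2.
      + by rewrite /small /= a8 b8.
      + by apply: wf_small u8 _; case: cK => _ /allP/(_ x xK).
    by rewrite E.
  have y_good : [:: c2; d2; a; b] \in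
      [seq y <- pair_candidates [:: a; b] | ~~ bad lo hi K y].
    rewrite mem_filter (bad_sound s_inj lo_le le_hi cK ywf) //= mem_filter.
    have -> : uniq [:: c2; d2; a; b] by case/and3P: ywf.
    apply/allpairsPdep; exists c2, d2; rewrite !mem_iota; split=> //.
    by rewrite c2d2 addSn subnKC.
  have [t' t'ts ok'] := check_forest (P := fun y t => check lo hi patterns 8 (y :: K) t) ok y_good.
  by apply: (IH t' t'ts s _ _ s_inj _ _ lo_le ok'); first exact: config_cons cK _ _ _ _ _.
set f := digits c; case: ifP => // /and3P[/eqP f8 uf fs]; case: ifP => // n_lt.
rewrite allbE => /allP ok.
have pP : nth [::] patterns n \in patterns by rewrite mem_nth.
have f_lt i : i < 8 -> nth 0 f i < 8.
  by move=> i8; apply: (allP fs); rewrite mem_nth // f8.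
have sf : labelling (s \o nth 0 f).
  move=> i j i8 j8 /= /s_inj h; apply/eqP; rewrite -(nth_uniq 0 _ _ uf) ?f8 //.
  by apply/eqP; apply: h; apply: f_lt.
apply: (no_pattern pP sf) => q qp.
have := ok q qp; rewrite hasbE => /hasP[x xK fx].
have qwf : wf 8 q by apply: (allP (allP patterns_wf _ pP)).
have [u8 /allP Ku /allP KV _] := cK.
have xwf := Ku x xK; have xs := wf_small u8 xwf.
have qs := wf_small (leqnn 8) qwf.
have qf8 : small (map (nth 0 f) q).
  by apply/allP => i /mapP[j jq ->]; apply/f_lt/(allP qs).
suff -> : img (s \o nth 0 f) q = img s x by apply: KV.
have -> : img (s \o nth 0 f) q = img s (map (nth 0 f) q) by rewrite /img map_comp.
(* The checker tests inclusion only, but both sides have four elements. *)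
apply/eqP; rewrite eqEcard img_sub // fx /=.
have /and3P[/eqP x4 xu _] := xwf; have /and3P[/eqP q4 qu _] := qwf.
rewrite !card_img // ?x4 ?size_map ?q4 //.
rewrite map_inj_in_uniq // => i j /(allP qs) i8 /(allP qs) j8 /eqP.
by rewrite nth_uniq ?f8 // => /eqP.
Qed.

End Soundness.

(** * Cancelling products of slacks and distances *)

Declare Scope digits_scope.
Number Notation Number.uint Number.uint_of_uint Number.uint_of_uint : digits_scope.
Delimit Scope digits_scope with digits.
Bind Scope digits_scope with Number.uint.

Section Obstructions.
Local Open Scope nat_scope.

(* [Rel ijkl p x y z] stands for the Ptolemy inequality [D x y * D p z < D x z * D p y]
   on the 2-face [ij] with edges [ijk] from [p] to [x] and [ijl] from [p] to [z], and
   [Rel ijk p q x y] for [s k x * (D y p * D y q) = s k y * (D x p * D x q)], where [p]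
   and [q] are the ends of the edge [ijk]. The vertices are given by their positions in
   an obstruction. *)
Inductive relation := Rel of Number.uint & nat & nat & nat & nat.

(* [tetrahedra] lists the vertices, four labels each. The relations, repeated according
   to their exponents in the cancelling product, come from linear programming. *)
Record obstruction := Obstruction {
  tetrahedra : Number.uint;
  ptolemies : seq relation;
  ratios : seq relation }.

Fixpoint quadruples (x : seq nat) :=
  if x is [:: a, b, c, d & x'] then [:: a; b; c; d] :: quadruples x' else [::].

Definition tets o := quadruples (digits (tetrahedra o)).

(** The first entry is 0 for a distance and [k.+1] for a slack of facet [k]. Sorting the two
    positions builds the symmetry of the distance into the comparison of monomials. *)
Definition dist_var x y : nat * nat * nat := (0, minn x y, maxn x y).
Definition slack_var k x : nat * nat * nat := (k.+1, x, 0).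

Definition ptolemy_sides (e : relation) :=
  let: Rel _ p x y z := e in
  ([:: dist_var x y; dist_var p z], [:: dist_var x z; dist_var p y]).

Definition ptolemy_ok (T : seq (seq nat)) (e : relation) :=
  let: Rel c p x y z := e in
  let P := nth [::] T p in let X := nth [::] T x in
  let Y := nth [::] T y in let Z := nth [::] T z in
  if digits c is [:: i; j; k; l] then
    [&& i != j, subn_seq [:: i; j; k; l] P, subn_seq [:: i; j; k] X,
      subn_seq [:: i; j] Y, subn_seq [:: i; j; l] Z, ~~ memn l X,
      ~~ memn k Y, ~~ memn l Y & ~~ memn k Z]
  else false.

Definition ratio_sides (e : relation) :=
  let: Rel c p q x y := e in
  if digits c is [:: i; j; k] then
    ([:: slack_var k x; dist_var y p; dist_var y q],
     [:: slack_var k y; dist_var x p; dist_var x q])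
  else ([::], [::]).

Definition ratio_ok (T : seq (seq nat)) (e : relation) :=
  let: Rel c p q x y := e in
  let P := nth [::] T p in let Q := nth [::] T q in
  let X := nth [::] T x in let Y := nth [::] T y in
  if digits c is [:: i; j; k] then
    [&& i != j, k < 8, ~~ subn_seq P Q, subn_seq [:: i; j; k] P,
      subn_seq [:: i; j; k] Q, subn_seq [:: i; j] X, subn_seq [:: i; j] Y,
      ~~ memn k X & ~~ memn k Y]
  else false.

(** [perm_eq] says that multiplying all relations yields the same monomial on both sides; a single
    Ptolemy relation makes the product strict. *)
Definition obstruction_ok o :=
  [&& all (wf 8) (tets o), 0 < size (ptolemies o), all (ptolemy_ok (tets o)) (ptolemies o),
    all (ratio_ok (tets o)) (ratios o) &
    perm_eq
      (flatten [seq (ptolemy_sides e).1 | e <- ptolemies o] ++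
       flatten [seq (ratio_sides e).1 | e <- ratios o])
      (flatten [seq (ptolemy_sides e).2 | e <- ptolemies o] ++
       flatten [seq (ratio_sides e).2 | e <- ratios o])].

End Obstructions.

Section ObstructionSound.
Local Open Scope ring_scope.
Variables (R : numDomainType) (V : {set {set 'I_8}}).
Variables (D : {set 'I_8} -> {set 'I_8} -> R) (slk : 'I_8 -> {set 'I_8} -> R).

Hypothesis D_sym : forall x y, D x y = D y x.
Hypothesis D_gt0 : forall x y, x \in V -> y \in V -> x != y -> 0 < D x y.
Hypothesis slk_gt0 : forall k x, x \in V -> k \notin x -> 0 < slk k x.
Hypothesis ptolemy : forall p x y z i j k l,
  p \in V -> x \in V -> y \in V -> z \in V -> i != j -> k \in p -> l \in p ->
  [set i; j] \subset p -> [set i; j] \subset x -> [set i; j] \subset y ->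
  [set i; j] \subset z -> k \in x -> k \notin y -> k \notin z ->
  l \in z -> l \notin x -> l \notin y -> D x y * D p z < D x z * D p y.
Hypothesis ratio : forall p q x y i j k,
  p \in V -> q \in V -> x \in V -> y \in V -> i != j -> p != q ->
  k \in p -> k \in q -> [set i; j] \subset p -> [set i; j] \subset q ->
  [set i; j] \subset x -> [set i; j] \subset y -> k \notin x -> k \notin y ->
  slk k x * (D y p * D y q) = slk k y * (D x p * D x q).

Lemma prod_lt (T : Type) (r : seq T) (f g : T -> R) : r <> [::] ->
  (forall t, List.In t r -> 0 <= f t < g t) ->
  \prod_(t <- r) f t < \prod_(t <- r) g t.
Proof.
elim: r => [//|t r IH] _ fg; rewrite !big_cons.
have /andP[f0 flt] : 0 <= f t < g t by apply: fg; left.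
case: r IH fg => [|u r] IH fg; first by rewrite !big_nil !mulr1.
have lt : \prod_(t <- u :: r) f t < \prod_(t <- u :: r) g t.
  by apply: IH => // v vr; apply: fg; right.
apply: ltr_pM => //; elim: (u :: r) fg => [|v s IHs] fg; first by rewrite big_nil.
rewrite big_cons mulr_ge0 //; first by have /andP[] := fg v (or_intror (or_introl erefl)).
by apply: IHs => w [<-|ws]; apply: fg; [left|right; right].
Qed.

Lemma all_In (T : Type) (p : pred T) (r : seq T) t : all p r -> List.In t r -> p t.
Proof. by elim: r => //= u r IH /andP[pu /IH{}IH] [<-|/IH]. Qed.

(** All factors are positive, so the relations may be multiplied; the result is a strict inequality
    between equal monomials. *)
Lemma obstruction_sound o s : obstruction_ok o -> labelling s ->
  (forall t, t \in tets o -> img s t \in V) -> False.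
Proof.
case/and5P=> /allP Twf I0 Iok Eok pe s_inj TV.
pose S x := img s (nth [::] (tets o) x).
(* A position outside the list is read as the empty vertex, which fails every positive membership
   test. *)
have mem_nth x i : i \in nth [::] (tets o) x -> nth [::] (tets o) x \in tets o.
  have [xs|xs] := ltnP x (size (tets o)); first by rewrite mem_nth.
  by rewrite nth_default.
have SV x i : i \in nth [::] (tets o) x -> S x \in V.
  by move/mem_nth/TV.
have smallT x : small (nth [::] (tets o) x).
  have [xs|xs] := ltnP x (size (tets o)); last by rewrite nth_default.
  by apply: (wf_small (leqnn 8)); apply/Twf/seq.mem_nth.
have lt8 x i : i \in nth [::] (tets o) x -> (i < 8)%N by move: i; apply/allP/smallT.
have SE x i : (i < 8)%N -> (s i \in S x) = (i \in nth [::] (tets o) x).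
  by move=> i8; rewrite mem_img.
have S2 x i j : i \in nth [::] (tets o) x -> j \in nth [::] (tets o) x ->
    [set s i; s j] \subset S x.
  by move=> ix jx; rewrite subUset !sub1set !SE ?ix ?jx // (lt8 x).
have neqS x y k : (k < 8)%N -> k \in nth [::] (tets o) x ->
    k \notin nth [::] (tets o) y -> S x != S y.
  by move=> k8 kx; apply: contra => /eqP e; rewrite -SE // -e SE.
pose val (v : nat * nat * nat) : R :=
  if v is (k.+1, x, _) then slk (s k) (S x) else D (S v.1.2) (S v.2).
have valD x y : val (dist_var x y) = D (S x) (S y).
  by rewrite /val /= /minn /maxn; case: ltnP => // _; rewrite D_sym.
pose pr r := \prod_(v <- r) val v.
have It e : List.In e (ptolemies o) -> 0 <= pr (ptolemy_sides e).1 < pr (ptolemy_sides e).2.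
  move/(all_In Iok); case: e => c p x y z; rewrite /ptolemy_ok /ptolemy_sides.
  case: (digits c) => [|i [|j [|k [|l []]]]] //.
  rewrite !subn_seqE /= !andbT !memnE.
  case/and5P=> ij /and4P[ip jp kp lp] /and3P[ix jx kx] /andP[iy jy].
  case/and5P=> /and3P[iz jz lz] lx ky ly kz.
  rewrite /pr !big_cons !big_nil !mulr1 !valD.
  have [i8 j8 k8 l8] := And4 (lt8 _ _ ip) (lt8 _ _ jp) (lt8 _ _ kp) (lt8 _ _ lp).
  have xy : S x != S y by apply: (neqS x y k).
  have pz : S p != S z by apply: (neqS p z k).
  rewrite mulr_ge0 ?ltW ?D_gt0 //; try by [apply: SV ip|apply: SV ix|apply: SV iy|apply: SV iz].
  have sij : s i != s j by apply: contra_neq ij => /s_inj; apply.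
  by apply: (@ptolemy (S p) (S x) (S y) (S z) (s i) (s j) (s k) (s l));
    rewrite ?SE // ?S2 //; [apply: SV ip|apply: SV ix|apply: SV iy|apply: SV iz].
have Et e : List.In e (ratios o) -> 0 < pr (ratio_sides e).1 /\
    pr (ratio_sides e).1 = pr (ratio_sides e).2.
  move/(all_In Eok); case: e => c p q x y; rewrite /ratio_ok /ratio_sides.
  case: (digits c) => [|i [|j [|k []]]] //.
  case/and5P=> ij k8 pq; rewrite !subn_seqE /= !andbT !memnE => /and3P[ip jp kp].
  case/and5P=> /and3P[iq jq kq] /andP[ix jx] /andP[iy jy] kx ky.
  rewrite /pr !big_cons !big_nil !mulr1 !valD [val (slack_var k x)]/=.
  rewrite [val (slack_var k y)]/=.
  have Spq : S p != S q.
    apply: contra pq => /eqP e; rewrite -(img_sub s_inj (smallT p) (smallT q)).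
    by rewrite -[img s _]/(S p) e.
  have sij : s i != s j by apply: contra_neq ij => /s_inj; apply; apply: lt8; eassumption.
  have yp : S y != S p by rewrite eq_sym; apply: (neqS p y k).
  have yq : S y != S q by rewrite eq_sym; apply: (neqS q y k).
  have [pV qV xV yV] := And4 (SV _ _ ip) (SV _ _ iq) (SV _ _ ix) (SV _ _ iy).
  split; first by rewrite !mulr_gt0 ?slk_gt0 ?D_gt0 ?SE.
  by apply: (@ratio (S p) (S q) (S x) (S y) (s i) (s j) (s k)); rewrite ?SE ?S2.
have prf T (r : seq T) (f : T -> seq (nat * nat * nat)) :
    pr (flatten [seq f e | e <- r]) = \prod_(e <- r) pr (f e).
  elim: r => [|e r IH]; first by rewrite /pr /= !big_nil.
  by rewrite /= big_cons -IH /pr big_cat.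
have prE : \prod_(e <- ratios o) pr (ratio_sides e).1
    = \prod_(e <- ratios o) pr (ratio_sides e).2
    /\ 0 < \prod_(e <- ratios o) pr (ratio_sides e).1.
  elim: (ratios o) Et => [|e r IH] Et; first by rewrite !big_nil.
  have [e0 eE] := Et e (or_introl erefl).
  have [|rE r0] := IH; first by move=> e' e'r; apply: Et; right.
  by split; [rewrite !big_cons eE rE|rewrite big_cons mulr_gt0].
have pe' : pr (flatten [seq (ptolemy_sides e).1 | e <- ptolemies o])
    * pr (flatten [seq (ratio_sides e).1 | e <- ratios o])
  = pr (flatten [seq (ptolemy_sides e).2 | e <- ptolemies o])
    * pr (flatten [seq (ratio_sides e).2 | e <- ratios o]).
  by rewrite /pr -!big_cat; apply: perm_big.
move: pe'; rewrite !prf.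
(* The two products of ratios are equal and nonzero; cancelling them leaves equality of the Ptolemy
   products. *)
have [<- r0] := prE => /(mulIf (lt0r_neq0 r0)) e.
have : \prod_(e <- ptolemies o) pr (ptolemy_sides e).1
    < \prod_(e <- ptolemies o) pr (ptolemy_sides e).2.
  by apply: prod_lt => //; case: (ptolemies o) I0.
by rewrite e ltxx.
Qed.

End ObstructionSound.

Arguments Rel _%_digits_scope (_ _ _ _)%_nat_scope.
Arguments Obstruction _%_digits_scope (_ _)%_seq_scope.
Arguments Branch _%_digits_scope _%_seq_scope.
Arguments Pair _%_digits_scope _%_seq_scope.
Arguments Pattern _%_nat_scope _%_digits_scope.

(** * Certificates: twenty obstructions and four search trees *)

Definition obstructions : seq obstruction := [::
Obstruction 01230124013512450146015612361256 [:: Rel 0124 1 0 5 4; Rel 0153 2 5 1 0; Rel 1204 1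
  0 6 3] [:: Rel 125 3 7 1 0; Rel 016 4 5 1 0; Rel 015 2 5 0 1; Rel 126 6 7 0 1];
Obstruction 012301240135014601561236034703570467056712471267 [:: Rel 1274 10 11 0 1; Rel 1203 0
  1 11 5; Rel 0124 1 0 4 3] [:: Rel 016 3 4 2 0; Rel 016 3 4 2 1; Rel 126 5 11 0 1; Rel 127 10
  11 1 0; Rel 047 6 8 3 1; Rel 015 2 4 0 3; Rel 015 2 4 0 3; Rel 056 4 9 7 2; Rel 056 4 9 7 2;
  Rel 057 7 9 2 4; Rel 031 0 2 7 6; Rel 067 8 9 4 3; Rel 046 3 8 1 6; Rel 046 3 8 1 6; Rel 035
  2 7 6 0; Rel 035 2 7 6 0; Rel 075 7 9 8 6; Rel 075 7 9 8 6; Rel 065 4 9 3 8; Rel 065 4 9 3 8;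
  Rel 076 8 9 6 7; Rel 076 8 9 6 7; Rel 061 3 4 8 9; Rel 051 2 4 9 7; Rel 041 1 3 6 8; Rel 037
  6 7 0 2];
Obstruction 01230124013501460156123613461267 [:: Rel 0124 1 0 4 3; Rel 0165 4 3 0 2; Rel 1604 3
  4 7 6] [:: Rel 162 5 7 4 3; Rel 163 5 6 3 4; Rel 012 0 1 3 4; Rel 013 0 2 4 3];
Obstruction 01230124013503450146034602370247 [:: Rel 0345 3 5 6 2; Rel 0436 5 3 7 4] [:: Rel
  031 0 2 3 5; Rel 032 0 6 5 3; Rel 042 1 7 3 5; Rel 041 1 4 5 3];
Obstruction 012301240135124501460156023702470367046712571357 [:: Rel 1503 2 5 3 11; Rel 0153 2
  5 1 0] [:: Rel 014 1 4 5 0; Rel 014 1 4 5 0; Rel 064 4 9 8 5; Rel 064 4 9 8 5; Rel 072 6 7 8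
  9; Rel 072 6 7 8 9; Rel 042 1 7 9 4; Rel 042 1 7 9 4; Rel 012 0 1 4 2; Rel 037 6 8 0 2; Rel
  021 0 1 6 7; Rel 047 7 9 4 1; Rel 074 7 9 6 8; Rel 074 7 9 6 8; Rel 041 1 4 7 9; Rel 024 1 7
  0 6; Rel 024 1 7 0 6; Rel 027 6 7 1 0; Rel 067 8 9 5 4; Rel 157 10 11 2 5; Rel 061 4 5 9 8;
  Rel 152 3 10 5 2; Rel 012 0 1 4 5; Rel 032 0 6 2 8; Rel 032 0 6 2 8; Rel 031 0 2 8 6];
Obstruction 012301240234013503451235014604561246234623560157016712571267 [:: Rel 2364 9 10 0 2;
  Rel 0423 2 1 7 4] [:: Rel 046 6 7 1 2; Rel 016 6 12 0 1; Rel 042 1 2 6 4; Rel 012 0 1 3 6;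
  Rel 017 11 12 1 0; Rel 127 13 14 0 1; Rel 235 5 10 0 2; Rel 125 5 13 1 0; Rel 230 0 2 10 9;
  Rel 035 3 4 2 0; Rel 015 3 11 0 1; Rel 032 0 2 4 3; Rel 126 8 14 5 0; Rel 230 0 2 5 10; Rel
  240 1 2 9 8; Rel 120 0 1 8 5; Rel 126 8 14 1 5; Rel 246 8 9 2 1];
Obstruction 012301240234013503451235014604561246234601570167125712672357 [:: Rel 2304 2 0 14 9;
  Rel 0423 2 1 7 4] [:: Rel 120 0 1 8 5; Rel 230 0 2 5 9; Rel 235 5 14 0 2; Rel 035 3 4 2 0;
  Rel 032 0 2 4 3; Rel 240 1 2 9 8; Rel 125 5 12 1 0; Rel 246 8 9 2 1; Rel 015 3 10 11 1; Rel
  015 3 10 0 11; Rel 016 6 11 0 1; Rel 046 6 7 1 2; Rel 127 12 13 0 8; Rel 126 8 13 1 0; Rel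
  127 12 13 8 1; Rel 017 10 11 1 6; Rel 017 10 11 6 0; Rel 042 1 2 6 4; Rel 012 0 1 3 6];
Obstruction 01231235125712672356236712462347 [:: Rel 2315 1 0 7 4; Rel 1235 1 0 6 2] [:: Rel
  237 5 7 0 1; Rel 126 3 6 0 1; Rel 127 2 3 1 0; Rel 236 4 5 1 0];
Obstruction 012301351235015712570167126701460456124634563467 [:: Rel 4610 7 9 11 8] [:: Rel 465
  8 10 7 9; Rel 463 10 11 9 7; Rel 015 1 3 5 7; Rel 126 6 9 0 4; Rel 125 2 4 9 6; Rel 175 3 4 6
  5; Rel 176 5 6 4 3; Rel 016 5 7 3 0; Rel 127 4 6 2 0; Rel 157 3 4 1 2; Rel 017 3 5 0 1; Rel
  013 0 1 7 3; Rel 153 1 2 3 4; Rel 123 0 2 4 9];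
Obstruction 012301240135124501461236125601570167 [:: Rel 0124 1 0 7 4; Rel 0123 0 1 8 2; Rel
  1204 1 0 6 3; Rel 1203 0 1 6 5] [:: Rel 126 5 6 0 1; Rel 016 4 8 1 0; Rel 015 2 7 0 1; Rel
  125 3 6 1 0];
Obstruction 0123012401350345234501460456123623560167056713673567 [:: Rel 0123 0 1 9 2; Rel 0123
  0 1 9 2; Rel 3540 3 4 12 2; Rel 3540 3 4 12 2] [:: Rel 350 2 3 8 12; Rel 016 5 9 2 0; Rel 056
  6 10 3 2; Rel 356 8 12 2 3; Rel 014 1 5 9 2; Rel 014 1 5 9 2; Rel 563 8 12 6 10; Rel 567 10
  12 8 6; Rel 567 10 12 8 6; Rel 067 9 10 6 5; Rel 067 9 10 6 5; Rel 352 4 8 12 2; Rel 352 4 8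
  12 2; Rel 064 5 6 10 9; Rel 064 5 6 10 9; Rel 054 3 6 2 10; Rel 054 3 6 2 10; Rel 367 11 12 7
  8; Rel 367 11 12 7 8; Rel 167 9 11 5 7; Rel 167 9 11 5 7; Rel 163 7 11 9 5; Rel 053 2 3 10 6;
  Rel 013 0 2 5 9; Rel 160 5 9 7 11; Rel 130 0 2 11 7; Rel 132 0 7 2 11; Rel 132 0 7 2 11; Rel
  362 7 8 11 12; Rel 362 7 8 11 12; Rel 136 7 11 0 2; Rel 560 6 10 12 8];
Obstruction 012301240135014612361256015701671257 [:: Rel 0124 1 0 6 3; Rel 0123 0 1 7 2; Rel
  1203 0 1 8 4] [:: Rel 016 3 7 1 0; Rel 126 4 5 0 1; Rel 125 5 8 1 0; Rel 015 2 6 0 1];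
Obstruction 012301240234013503452345014604561246235624560157016712371267 [:: Rel 0153 3 11 6 0;
  Rel 2301 0 2 9 13] [:: Rel 124 1 8 14 0; Rel 032 0 2 3 4; Rel 041 1 6 4 7; Rel 461 6 8 7 10;
  Rel 230 0 2 5 13; Rel 046 6 7 1 2; Rel 246 8 10 2 1; Rel 240 1 2 8 5; Rel 017 11 12 6 0; Rel
  120 0 1 8 14; Rel 035 3 4 0 2; Rel 164 6 8 12 14; Rel 241 1 8 10 2; Rel 245 5 10 8 2; Rel 235
  5 9 2 0; Rel 162 8 14 6 12; Rel 041 1 6 2 4; Rel 045 4 7 2 6; Rel 465 7 10 6 8; Rel 043 2 4 6
  1; Rel 013 0 3 1 6; Rel 120 0 1 13 8; Rel 160 6 12 14 8; Rel 167 12 14 8 6; Rel 014 1 6 0 12;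
  Rel 127 13 14 0 8; Rel 042 1 2 4 6; Rel 012 0 1 12 3; Rel 123 0 13 8 1; Rel 243 2 5 1 8];
Obstruction 012301240234013503450146045612462456015701671237126723472457 [:: Rel 0456 6 4 1 5;
  Rel 0423 2 1 6 4; Rel 1273 11 12 7 0] [:: Rel 240 1 2 13 7; Rel 246 7 8 2 1; Rel 245 8 14 7
  2; Rel 237 11 13 0 2; Rel 247 13 14 2 7; Rel 243 2 13 7 1; Rel 043 2 4 1 5; Rel 124 1 7 0 12;
  Rel 013 0 3 9 1; Rel 120 0 1 7 11; Rel 017 9 10 5 0; Rel 465 6 8 5 7; Rel 012 0 1 3 9; Rel
  015 3 9 0 1; Rel 035 3 4 2 0; Rel 042 1 2 6 4; Rel 012 0 1 9 5; Rel 013 0 3 5 9; Rel 042 1 2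
  5 6; Rel 123 0 11 1 7; Rel 046 5 6 1 2; Rel 167 10 12 7 5; Rel 015 3 9 1 5; Rel 126 7 12 1 0;
  Rel 230 0 2 11 13; Rel 241 1 7 8 2; Rel 016 5 10 0 1; Rel 041 1 5 2 6; Rel 014 1 5 9 0; Rel
  032 0 2 4 3; Rel 164 5 7 12 10; Rel 014 1 5 10 9; Rel 461 5 7 6 8];
Obstruction 0123012401350345234501462356016712371247135714673567 [:: Rel 3517 10 2 4 12; Rel
  3510 2 10 6 3] [:: Rel 356 6 12 10 2; Rel 354 3 4 2 10; Rel 176 7 11 9 10; Rel 173 8 10 7 9;
  Rel 123 0 8 9 1; Rel 174 9 11 10 8; Rel 172 8 9 11 7; Rel 146 5 11 1 9; Rel 012 0 1 7 5; Rel
  014 1 5 0 2; Rel 013 0 2 1 7; Rel 016 5 7 2 1; Rel 142 1 9 5 11; Rel 124 1 9 8 0];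
Obstruction 012301350157235701672367014602340345045704672346 [:: Rel 2304 7 0 3 11] [:: Rel 016
  4 6 0 2; Rel 236 5 11 7 0; Rel 015 1 2 6 4; Rel 045 8 9 10 6; Rel 053 1 8 9 2; Rel 013 0 1 2
  6; Rel 076 4 10 2 9; Rel 017 2 4 1 0; Rel 237 3 5 0 7; Rel 046 6 10 9 7; Rel 075 2 9 4 10;
  Rel 047 9 10 7 8; Rel 057 2 9 8 1; Rel 043 7 8 6 9];
Obstruction 012301240234013503451235014612462346015701670467125712672357 [:: Rel 2304 2 0 14 8;
  Rel 0423 2 1 11 4] [:: Rel 230 0 2 5 8; Rel 046 6 11 1 2; Rel 240 1 2 8 7; Rel 246 7 8 2 1;
  Rel 015 3 9 10 1; Rel 015 3 9 0 10; Rel 125 5 12 1 0; Rel 016 6 10 0 1; Rel 042 1 2 6 4; Rel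
  012 0 1 3 6; Rel 017 9 10 1 0; Rel 032 0 2 4 3; Rel 120 0 1 7 5; Rel 035 3 4 2 0; Rel 235 5
  14 0 2; Rel 127 12 13 0 1; Rel 126 7 13 1 0];
Obstruction 012301350157016712362367014602340345045704672347 [:: Rel 2304 7 0 4 11] [:: Rel 236
  4 5 0 7; Rel 046 6 10 7 9; Rel 057 2 9 1 8; Rel 053 1 8 2 9; Rel 013 0 1 6 2; Rel 043 7 8 9
  6; Rel 047 9 10 8 7; Rel 075 2 9 10 3; Rel 045 8 9 6 10; Rel 015 1 2 3 6; Rel 237 5 11 7 0;
  Rel 076 3 10 9 2; Rel 016 3 6 2 0; Rel 017 2 3 0 1];
Obstruction 01230124023401352345014603460356124624563456016705671237126713572357 [:: Rel 0365 7
  6 0 3; Rel 0351 3 7 2 0; Rel 0364 6 7 0 2; Rel 0635 7 6 11 12; Rel 4610 5 8 10 6] [:: Rel 461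
  5 8 6 9; Rel 462 8 9 5 6; Rel 462 8 9 5 6; Rel 032 0 2 6 3; Rel 036 6 7 3 0; Rel 123 0 13 14
  1; Rel 351 3 15 7 16; Rel 354 4 10 3 7; Rel 352 4 16 7 3; Rel 351 3 15 16 10; Rel 032 0 2 6
  7; Rel 350 3 7 4 15; Rel 034 2 6 7 3; Rel 240 1 2 8 4; Rel 460 5 6 9 10; Rel 465 9 10 6 5;
  Rel 461 5 8 10 9; Rel 065 7 12 5 6; Rel 063 6 7 5 12; Rel 120 0 1 13 8; Rel 126 8 14 1 0; Rel
  043 2 6 1 5; Rel 036 6 7 0 2; Rel 124 1 8 0 14; Rel 034 2 6 7 0; Rel 041 1 5 2 6; Rel 240 1 2
  4 9; Rel 356 7 10 16 3; Rel 356 7 10 15 16; Rel 241 1 8 9 2; Rel 241 1 8 9 2; Rel 063 6 7 12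
  11; Rel 357 15 16 10 7; Rel 357 15 16 3 10; Rel 164 5 8 14 11; Rel 162 8 14 11 5; Rel 162 8
  14 11 5; Rel 031 0 3 2 6; Rel 061 5 11 6 7; Rel 350 3 7 10 4; Rel 067 11 12 7 5; Rel 130 0 3
  15 13; Rel 167 11 14 5 8; Rel 127 13 14 8 0; Rel 172 13 14 15 11; Rel 172 13 14 15 11; Rel
  132 0 13 3 15; Rel 132 0 13 3 15; Rel 173 13 15 11 14; Rel 126 8 14 0 13; Rel 064 5 6 11 7;
  Rel 176 11 14 13 15; Rel 246 8 9 2 1; Rel 137 13 15 0 3];
Obstruction 012301240135023502450146045612362346015701670567135713672357 [:: Rel 2305 3 0 8 14;
  Rel 1302 0 2 13 7] [:: Rel 236 7 8 14 3; Rel 016 5 10 2 0; Rel 236 7 8 0 14; Rel 014 1 5 9 2;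
  Rel 054 4 6 11 3; Rel 053 2 3 9 4; Rel 054 4 6 2 11; Rel 057 9 11 2 3; Rel 023 0 3 4 1; Rel
  024 1 4 3 0; Rel 017 9 10 0 2; Rel 056 6 11 3 2; Rel 357 12 14 3 2; Rel 130 0 2 12 7; Rel 230
  0 3 7 14; Rel 013 0 2 1 9; Rel 014 1 5 0 9; Rel 137 12 13 2 0; Rel 350 2 3 14 12]].

Definition tree_le3 : tree :=
Branch 012 [:: Branch 013 [:: Branch 023 [:: Pair 05 [:: Branch 056 [::]]; Branch 024 [::]];
  Branch 014 [::]]].

Definition tree4 : tree :=
Branch 012 [:: Branch 013 [:: Branch 014 [:: Branch 023 [:: Branch 034 [:: Pair 06 [::]; Branch
  035 [::]]; Branch 024 [:: Pair 06 [::]; Branch 025 [::]]; Branch 024 [:: Branch 025 [::];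
  Branch 035 [:: Branch 034 [::]; Branch 045 [:: Pair 07 [::]; Branch 046 [::]]; Branch 036
  [::]]; Branch 026 [::]]]; Branch 015 [::]]]].

Definition tree5 : tree :=
Branch 012 [:: Branch 013 [:: Branch 014 [:: Branch 015 [:: Branch 023 [:: Branch 034 [::
  Branch 045 [:: Pair 07 [::]; Branch 046 [::]]; Branch 035 [:: Pair 07 [::]; Branch 036 [::]];
  Branch 035 [:: Branch 036 [::]; Branch 046 [:: Branch 045 [::]; Branch 056 [:: Branch 123 [::
  Pair 25 [:: Branch 256 [::]]; Branch 124 [:: Branch 145 [:: Pair 17 [::]; Branch 156 [::]];
  Branch 125 [:: Pair 17 [::]; Branch 126 [::]]; Branch 125 [:: Branch 126 [::]; Branch 146 [::
  Branch 145 [::]; Branch 156 [:: Pair 62 [::]]]]]; Branch 124 [:: Branch 125 [:: Pattern 0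
  01243657; Branch 126 [::]]; Branch 135 [:: Pair 17 [::]; Branch 156 [:: Branch 136 [::]]];
  Branch 126 [:: Branch 125 [::]; Pattern 1 01234567]]; Branch 124 [:: Branch 125 [:: Branch
  126 [::]; Pattern 1 01243657]; Branch 126 [:: Branch 125 [::]; Branch 135 [:: Branch 136
  [::]; Branch 156 [:: Pair 52 [::]]]]; Branch 347 [:: Branch 134 [:: Pattern 0 03152746;
  Pattern 0 04126375]; Pair 25 [::]]]]]]]]; Branch 024 [:: Branch 045 [:: Pair 07 [::]; Branch
  056 [::]]; Branch 025 [:: Pair 07 [::]; Branch 026 [::]]; Branch 025 [:: Branch 026 [::];
  Branch 046 [:: Branch 045 [::]; Branch 056 [:: Branch 123 [:: Branch 134 [:: Branch 145 [::
  Pair 17 [::]; Branch 146 [::]]; Branch 135 [:: Pair 17 [::]; Branch 136 [::]]; Branch 135 [::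
  Branch 136 [::]; Branch 146 [:: Branch 145 [::]; Branch 156 [:: Pair 62 [::]]]]]; Pair 34 [::
  Branch 346 [::]]; Branch 124 [:: Branch 125 [:: Pattern 0 01243657; Branch 126 [::]]; Branch
  135 [:: Pair 17 [::]; Branch 136 [:: Pattern 1 01325467]]; Branch 146 [:: Branch 126 [::
  Pattern 0 01654327; Pattern 2 21043765]; Pair 43 [::]]]; Branch 124 [:: Branch 125 [:: Branch
  126 [::]; Pattern 0 02143756]; Branch 247 [:: Branch 127 [:: Pattern 0 02754316; Pattern 2
  12043675]; Pair 43 [::]]; Branch 235 [:: Branch 236 [:: Pattern 1 02315476]; Pair 26
  [::]]]]]]]]; Branch 024 [:: Branch 025 [:: Pattern 0 10234567; Branch 026 [::]]; Branch 035
  [:: Pair 07 [::]; Branch 036 [:: Branch 056 [::]]]; Branch 026 [:: Branch 025 [::]; Branch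
  036 [:: Pattern 2 20143765; Branch 046 [::]]]]; Branch 024 [:: Branch 025 [:: Branch 026
  [::]; Branch 035 [:: Pattern 2 10243657; Branch 045 [::]]]; Branch 026 [:: Branch 025 [::];
  Branch 035 [:: Branch 036 [::]; Branch 056 [:: Branch 124 [:: Branch 134 [:: Branch 145 [::
  Pair 17 [::]; Branch 146 [::]]; Branch 135 [:: Pair 17 [::]; Branch 136 [::]]; Branch 135 [::
  Branch 136 [::]; Branch 156 [:: Branch 145 [::]; Pair 52 [::]]]]; Branch 123 [:: Branch 145
  [:: Pair 17 [::]; Branch 156 [::]]; Branch 125 [:: Pattern 0 01243657; Branch 126 [::]];
  Branch 135 [:: Branch 125 [:: Pattern 0 01563427; Pattern 2 01243657]; Pair 34 [::]]]; Pair
  43 [:: Branch 345 [::]]; Branch 123 [:: Branch 237 [:: Branch 127 [:: Pattern 2 02143675;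
  Pattern 0 02736145]; Pair 34 [::]]; Branch 126 [:: Branch 125 [::]; Pattern 0 02143675];
  Branch 246 [:: Branch 245 [:: Pattern 1 02416375]; Pair 25 [::]]]]]]]; Branch 035 [:: Branch
  034 [:: Pattern 3 01243657; Branch 045 [::]]; Branch 036 [:: Branch 034 [::]; Branch 046 [::
  Branch 135 [:: Branch 124 [:: Branch 145 [:: Pair 17 [::]; Branch 156 [::]]; Branch 125 [::
  Pair 17 [::]; Branch 126 [::]]; Branch 146 [:: Branch 125 [:: Branch 145 [::]]; Pair 43
  [::]]]; Branch 123 [:: Branch 145 [:: Pair 17 [::]; Branch 146 [::]]; Branch 134 [:: Pattern
  0 01352647; Branch 136 [::]]; Branch 124 [:: Branch 125 [:: Pattern 0 01563427; Pattern 2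
  01243657]; Pair 25 [::]]]; Pair 52 [:: Branch 245 [::]]; Branch 123 [:: Branch 237 [:: Pair
  25 [::]; Branch 137 [:: Pattern 2 03152674; Pattern 0 03726154]]; Branch 136 [:: Branch 134
  [::]; Pattern 0 03152674]; Branch 356 [:: Branch 345 [:: Pattern 1 03516274]; Pair 34
  [::]]]]]]; Branch 046 [:: Branch 045 [:: Branch 146 [:: Branch 123 [:: Branch 125 [:: Pair 17
  [::]; Branch 126 [::]]; Branch 135 [:: Pair 17 [::]; Branch 136 [:: Branch 156 [::]]]; Branch
  135 [:: Branch 126 [:: Branch 136 [::]]; Pair 34 [::]]]; Branch 123 [:: Branch 135 [:: Pair
  17 [::]; Branch 136 [::]]; Branch 126 [:: Pattern 0 01654327; Pattern 2 01234567]; Branch 124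
  [:: Branch 135 [:: Pattern 0 01426357]; Pair 25 [::]]]; Pair 62 [:: Branch 236 [::]]; Branch
  124 [:: Branch 247 [:: Pair 25 [::]; Branch 147 [:: Pattern 2 14026375; Pattern 0 04752613]];
  Branch 145 [:: Branch 134 [::]; Pattern 0 04126753]; Branch 456 [:: Branch 346 [:: Pattern 1
  04615273]; Pair 43 [::]]]]]; Branch 056 [:: Branch 123 [:: Branch 234 [:: Branch 135 [::
  Branch 145 [:: Pair 17 [::]; Branch 146 [::]]; Branch 134 [:: Pair 17 [::]; Branch 136
  [::]]]; Branch 146 [:: Branch 135 [:: Pair 17 [::]; Branch 136 [::]]; Branch 134 [:: Pair 17
  [::]; Branch 145 [::]]]; Pair 25 [::]]; Branch 235 [:: Branch 124 [:: Branch 145 [:: Pair 17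
  [::]; Branch 156 [::]]; Branch 125 [:: Pair 17 [::]; Branch 126 [::]]]; Branch 156 [:: Branch
  124 [:: Pair 17 [::]; Branch 126 [::]]; Branch 124 [:: Pair 17 [::]; Branch 456 [:: Pattern 3
  51063427]]]; Pair 34 [::]]; Branch 124 [:: Branch 125 [:: Pattern 0 01243657; Branch 126
  [::]]; Branch 135 [:: Pair 17 [::]; Branch 156 [:: Branch 136 [::]]]; Branch 146 [:: Branch
  126 [:: Pattern 0 01654327; Pattern 2 21043765]; Pair 43 [::]]]; Branch 124 [:: Branch 135
  [:: Branch 125 [:: Pattern 0 01563427; Pattern 2 01243657]; Pair 34 [::]]; Branch 135 [::
  Branch 126 [:: Branch 136 [::]]; Pair 34 [::]]; Pair 25 [::]]]]]]]]; Branch 016 [::]]]]].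

Definition tree_ge6 : tree :=
Branch 012 [:: Branch 013 [:: Branch 014 [:: Branch 015 [:: Branch 016 [:: Branch 023 [::
  Branch 034 [:: Branch 045 [:: Branch 056 [:: Branch 123 [:: Pair 25 [:: Branch 256 [::]];
  Branch 157 [:: Branch 124 [:: Branch 126 [:: Branch 234 [:: Pair 36 [::]; Branch 235 [::
  Pattern 5 21043657; Pattern 6 01234567]; Branch 235 [:: Branch 236 [:: Pattern 7 01234567];
  Branch 246 [:: Branch 345 [:: Branch 346 [:: Pattern 8 01234567]; Pair 36 [::]]]]]]; Branch
  146 [:: Branch 234 [:: Pair 36 [::]; Branch 246 [:: Pattern 3 40126357; Branch 345 [:: Branch
  235 [:: Pair 37 [::]; Branch 236 [:: Branch 356 [:: Pattern 8 46712035]]]]]; Branch 467 [::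
  Pattern 1 40536217; Pair 62 [::]]]]]; Branch 345 [:: Pair 36 [::]; Branch 145 [:: Pattern 2
  05173642; Pattern 0 05463712]]; Pair 72 [:: Branch 237 [::]]]; Branch 167 [:: Branch 127 [::
  Pattern 2 21764305; Pattern 3 16702435]; Branch 126 [:: Branch 135 [:: Branch 234 [:: Branch
  245 [:: Pair 47 [::]; Branch 246 [:: Branch 357 [:: Branch 236 [:: Pattern 8 32405176]]]];
  Pair 25 [::]; Branch 345 [:: Branch 236 [:: Branch 235 [:: Pattern 2 13756024]]; Pattern 1
  31672504]]]; Branch 146 [:: Pattern 11 61074352]]; Pair 72 [:: Branch 237 [::]]]; Branch 124
  [:: Branch 125 [:: Branch 126 [:: Pattern 11 01243657]; Pattern 2 21753406]; Branch 126 [::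
  Branch 125 [:: Pattern 7 40126375]; Branch 135 [:: Branch 234 [:: Branch 235 [:: Branch 246
  [:: Pair 47 [::]]; Pair 36 [::]]; Branch 236 [:: Branch 256 [:: Pattern 4 62147350]; Pair 25
  [::]]; Branch 246 [:: Branch 245 [:: Pattern 13 01234567]; Pair 25 [::]]]]]; Branch 137 [::
  Branch 146 [:: Branch 234 [:: Branch 357 [:: Pair 36 [::]; Pattern 19 10352746]; Branch 456
  [:: Pattern 3 40126357; Pattern 15 17640253]; Pair 25 [::]]]; Pattern 3 13207564]]]]; Branch
  046 [:: Branch 123 [:: Pair 25 [:: Branch 256 [::]]; Branch 146 [:: Branch 125 [:: Branch 156
  [:: Branch 234 [:: Pair 36 [::]; Branch 235 [:: Pair 27 [::]; Branch 236 [:: Pattern 15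
  01234567]]; Branch 235 [:: Branch 236 [:: Pattern 8 40162735]; Branch 357 [:: Pair 36 [::];
  Pattern 3 51073624]]]]; Branch 126 [:: Branch 234 [:: Pair 36 [::]; Branch 235 [:: Pattern 6
  21043657; Pattern 16 21043657]; Branch 246 [:: Branch 245 [:: Pattern 7 01243657]; Pair 63
  [::]]]]]; Branch 345 [:: Pair 36 [::]; Branch 145 [:: Pattern 3 46150372; Pattern 2
  54167302]]; Pair 62 [:: Branch 236 [::]]]; Branch 124 [:: Branch 125 [:: Pattern 9 01243657;
  Branch 126 [:: Pattern 3 15702346]]; Branch 135 [:: Branch 156 [:: Branch 234 [:: Branch 467
  [:: Pattern 16 10426375; Pair 72 [::]]; Pair 25 [::]; Branch 236 [:: Branch 235 [:: Pattern
  14 40537261]; Pattern 17 01234567]]]; Branch 136 [:: Branch 234 [:: Branch 246 [:: Branch 456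
  [:: Branch 235 [:: Pair 27 [::]; Branch 236 [:: Pattern 15 76235140]]]; Pattern 6 10426375];
  Pair 25 [::]; Branch 236 [:: Branch 235 [:: Pattern 2 13756024]; Pattern 17 01234567]]]];
  Branch 126 [:: Branch 125 [:: Pattern 11 21043765]; Pattern 2 21764305]]; Branch 167 [::
  Branch 124 [:: Branch 125 [:: Pattern 11 01243657]; Branch 135 [:: Branch 246 [:: Branch 237
  [:: Pattern 19 01325476; Pair 25 [::]]; Branch 234 [:: Branch 456 [:: Branch 235 [:: Branch
  236 [:: Pattern 8 10462735]; Pair 36 [::]]]; Branch 245 [:: Pattern 7 10426375]]; Pair 63
  [::]]]]; Branch 127 [:: Pattern 3 13207564; Pattern 2 71235604]; Pair 62 [:: Branch 236
  [::]]]]]]; Branch 035 [:: Branch 056 [:: Branch 123 [:: Pair 25 [:: Branch 256 [::]]; Branch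
  157 [:: Branch 124 [:: Branch 126 [:: Branch 234 [:: Branch 246 [:: Pattern 5 01243657;
  Pattern 6 01243657]; Pair 45 [::]; Branch 235 [:: Branch 236 [:: Pattern 7 01234567]; Branch
  246 [:: Branch 346 [:: Branch 345 [:: Pattern 8 01243657]; Pair 45 [::]]]]]]; Branch 146 [::
  Branch 234 [:: Branch 245 [:: Branch 256 [:: Pattern 4 52137460]; Pair 26 [::]]; Branch 235
  [:: Pair 37 [::]; Branch 246 [:: Pair 45 [::]]]; Branch 235 [:: Branch 236 [:: Pattern 13
  10352746]; Pair 26 [::]]]]]; Branch 124 [:: Branch 146 [:: Branch 234 [:: Pair 26 [::];
  Branch 235 [:: Pair 37 [::]; Branch 236 [:: Branch 356 [:: Branch 245 [:: Branch 246 [::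
  Pattern 8 42306175]]]]]; Branch 346 [:: Branch 235 [:: Branch 345 [:: Pattern 2 15472036]];
  Pattern 1 41572603]]]; Branch 127 [:: Pattern 2 71246503]]; Pair 72 [:: Branch 237 [::]]];
  Branch 167 [:: Branch 127 [:: Pattern 2 21764305; Pattern 3 16702435]; Branch 236 [:: Branch
  135 [:: Branch 124 [:: Pair 25 [::]]]; Pattern 2 03125467]; Pair 72 [:: Branch 237 [::]]];
  Branch 124 [:: Branch 125 [:: Branch 126 [:: Pattern 11 01243657]; Pattern 2 21753406];
  Branch 126 [:: Branch 125 [:: Pattern 7 40126375]; Branch 135 [:: Branch 234 [:: Branch 235
  [:: Pattern 3 30152647; Branch 345 [:: Branch 245 [:: Pair 47 [::]; Branch 456 [:: Pattern 8
  64217053]]]]; Pair 45 [::]; Branch 357 [:: Pattern 1 30645217; Pair 52 [::]]]]]; Branch 137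
  [:: Branch 146 [:: Branch 234 [:: Branch 356 [:: Pattern 3 30152647; Pattern 15 17530264];
  Branch 467 [:: Pair 45 [::]; Pattern 19 10462735]; Pair 25 [::]]]; Pattern 3 13207564]]]];
  Branch 036 [:: Branch 123 [:: Pair 25 [:: Branch 256 [::]]; Branch 124 [:: Branch 145 [::
  Branch 156 [:: Branch 234 [:: Pair 26 [::]; Branch 357 [:: Pattern 16 30152746; Pair 72
  [::]]; Branch 235 [:: Branch 236 [:: Pattern 7 10325476]; Pattern 6 30152746]]]; Branch 146
  [:: Branch 234 [:: Pair 26 [::]; Branch 235 [:: Branch 356 [:: Branch 245 [:: Pair 27 [::];
  Branch 246 [:: Pattern 15 75246130]]]; Pattern 6 10325476]; Branch 235 [:: Branch 236 [::
  Pattern 7 10325476]; Pattern 5 30152746]]]]; Branch 125 [:: Branch 156 [:: Branch 234 [::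
  Branch 245 [:: Pair 27 [::]; Branch 246 [:: Pattern 15 01243657]]; Pair 45 [::]; Branch 235
  [:: Branch 236 [:: Pattern 7 10325476]; Branch 346 [:: Branch 246 [:: Branch 245 [:: Pattern
  8 30152746]; Pair 45 [::]]]]]]; Branch 126 [:: Branch 234 [:: Branch 246 [:: Pattern 6
  21034567; Pattern 16 01243657]; Pair 45 [::]; Branch 235 [:: Branch 236 [:: Pattern 7
  01234567]; Pair 54 [::]]]]]; Branch 125 [:: Branch 126 [:: Pattern 7 30125476]; Branch 146
  [:: Branch 235 [:: Branch 247 [:: Pair 26 [::]; Pattern 19 01426375]; Branch 234 [:: Branch
  356 [:: Branch 246 [:: Branch 245 [:: Pattern 8 10352746]; Pair 45 [::]]]; Branch 236 [::
  Pattern 7 10325476]]; Pair 54 [::]]]]]; Branch 135 [:: Branch 134 [:: Pattern 2 13642507;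
  Branch 136 [:: Pattern 11 01352746]]; Branch 126 [:: Branch 236 [:: Pair 25 [::]; Pattern 3
  32106475]; Pattern 3 12306475]; Pair 52 [:: Branch 245 [::]]]; Branch 135 [:: Branch 134 [::
  Branch 136 [:: Pair 62 [::]]; Pattern 9 01352746]; Branch 136 [:: Branch 134 [:: Pattern 11
  13052674]; Pattern 2 13675204]; Pair 52 [:: Branch 245 [::]]]]]]; Branch 035 [:: Branch 036
  [:: Pattern 7 21034567]; Branch 046 [:: Branch 123 [:: Pair 25 [:: Branch 256 [::]]; Branch
  146 [:: Branch 125 [:: Branch 156 [:: Branch 234 [:: Branch 245 [:: Pair 27 [::]; Branch 347
  [:: Pair 36 [::]]]; Branch 235 [:: Pair 27 [::]; Branch 256 [:: Pair 54 [::]]]; Branch 235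
  [:: Branch 246 [:: Pair 45 [::]]; Pair 36 [::]]]]; Branch 126 [:: Branch 235 [:: Branch 246
  [:: Branch 256 [:: Branch 345 [:: Branch 346 [:: Pattern 8 21034567]; Pair 36 [::]]]; Pair 63
  [::]]; Branch 234 [:: Branch 256 [:: Branch 346 [:: Branch 345 [:: Pattern 8 21043657]; Pair
  45 [::]]]; Branch 236 [:: Pattern 7 01234567]]; Pair 54 [::]]]]; Branch 124 [:: Branch 156
  [:: Branch 234 [:: Pair 26 [::]; Branch 246 [:: Branch 346 [:: Branch 235 [:: Pair 27 [::];
  Branch 236 [:: Pattern 15 10325476]]]; Pattern 3 40126375]; Branch 235 [:: Branch 236 [::
  Pattern 8 51073624]; Pair 36 [::]]]]; Branch 145 [:: Pattern 2 41576203]]; Pair 62 [:: Branch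
  236 [::]]]; Branch 135 [:: Branch 134 [:: Pattern 2 31642507; Branch 136 [:: Pattern 2
  03745216]]; Branch 126 [:: Branch 156 [:: Branch 234 [:: Branch 235 [:: Branch 345 [:: Branch
  245 [:: Pair 27 [::]; Branch 246 [:: Pattern 15 10426375]]]; Pattern 3 30152746]; Pair 25
  [::]; Branch 246 [:: Branch 245 [:: Pattern 8 61074523]; Pair 45 [::]]]]; Pattern 3
  12306475]; Pair 52 [:: Branch 245 [::]]]; Branch 135 [:: Branch 134 [:: Branch 136 [::
  Pattern 3 17603524]; Pattern 0 03152746]; Branch 136 [:: Branch 134 [:: Pattern 2 03472516];
  Pattern 2 31675204]; Pair 52 [:: Branch 245 [::]]]]]]]; Branch 024 [:: Branch 045 [:: Branch
  056 [:: Branch 123 [:: Branch 157 [:: Branch 134 [:: Branch 136 [:: Branch 234 [:: Pair 26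
  [::]; Branch 357 [:: Pattern 16 31052746; Pair 72 [::]]; Branch 235 [:: Branch 236 [::
  Pattern 7 01325476]; Pattern 6 31052746]]]; Branch 146 [:: Branch 234 [:: Pair 26 [::];
  Branch 246 [:: Branch 346 [:: Branch 235 [:: Pair 27 [::]; Branch 236 [:: Pattern 15
  01325476]]]; Pattern 3 41026375]; Branch 235 [:: Branch 236 [:: Pattern 8 50173624]; Pair 36
  [::]]]]]; Branch 245 [:: Pair 26 [::]; Branch 145 [:: Pattern 3 57104623; Pattern 2
  45176203]]; Pair 72 [:: Branch 237 [::]]]; Pair 34 [:: Branch 346 [::]]; Branch 167 [::
  Branch 127 [:: Pattern 2 21764305; Pattern 3 16702435]; Branch 126 [:: Branch 135 [:: Branch
  245 [:: Branch 234 [:: Pair 27 [::]; Branch 236 [:: Pattern 8 10573624]]; Pair 43 [::];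
  Branch 235 [:: Branch 256 [:: Pattern 2 25764301]; Branch 456 [:: Pattern 6 10573624]]]];
  Branch 146 [:: Pattern 11 61074352]]; Pair 72 [:: Branch 237 [::]]]; Branch 124 [:: Branch
  125 [:: Branch 126 [:: Pattern 11 01243657]; Pattern 2 21753406]; Branch 126 [:: Branch 125
  [:: Pattern 7 40126375]; Branch 135 [:: Branch 235 [:: Branch 357 [:: Branch 456 [:: Branch
  234 [:: Branch 236 [:: Pattern 15 05321476]; Pair 36 [::]]]; Pattern 6 10537264]; Branch 236
  [:: Branch 234 [:: Pattern 2 12647035]; Pattern 17 01325476]; Pair 34 [::]]]]; Branch 137 [::
  Branch 146 [:: Branch 235 [:: Branch 567 [:: Pattern 16 50173624; Pair 62 [::]]; Branch 236
  [:: Branch 234 [:: Pattern 14 50426371]; Pattern 17 01325476]; Pair 34 [::]]]; Pattern 3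
  13207564]]]]; Branch 046 [:: Branch 123 [:: Branch 146 [:: Branch 135 [:: Branch 156 [::
  Branch 234 [:: Pair 26 [::]; Branch 235 [:: Pair 37 [::]; Branch 236 [:: Branch 356 [::
  Branch 245 [:: Branch 246 [:: Pattern 8 42316075]]]]]; Branch 346 [:: Branch 235 [:: Branch
  345 [:: Pattern 2 05472136]]; Pattern 1 40572613]]]; Branch 136 [:: Branch 234 [:: Pair 26
  [::]; Branch 235 [:: Branch 356 [:: Branch 245 [:: Pair 27 [::]; Branch 246 [:: Pattern 15
  13240657]]]; Pattern 6 01325476]; Branch 235 [:: Branch 236 [:: Pattern 7 01325476]; Pattern
  5 31052746]]]]; Branch 245 [:: Pair 26 [::]; Branch 145 [:: Pattern 2 14026357; Pattern 0
  04527163]]; Pair 62 [:: Branch 236 [::]]]; Pair 34 [:: Branch 346 [::]]; Branch 124 [::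
  Branch 125 [:: Pattern 9 01243657; Branch 126 [:: Pattern 3 15702346]]; Branch 135 [:: Branch
  156 [:: Branch 235 [:: Branch 246 [:: Pair 27 [::]; Pattern 19 10243657]; Pair 34 [::];
  Branch 457 [:: Pattern 15 16750342; Pattern 3 50173426]]]; Branch 136 [:: Branch 235 [::
  Branch 234 [:: Pair 27 [::]; Branch 357 [:: Pair 56 [::]]]; Branch 245 [:: Pair 27 [::];
  Branch 246 [:: Pair 43 [::]]]; Branch 236 [:: Branch 245 [:: Pair 56 [::]]; Pair 34 [::]]]]];
  Branch 126 [:: Branch 125 [:: Pattern 11 21043765]; Pattern 2 21764305]]; Branch 167 [::
  Branch 124 [:: Branch 125 [:: Pattern 11 01243657]; Branch 135 [:: Branch 235 [:: Branch 246
  [:: Branch 236 [:: Branch 345 [:: Branch 356 [:: Pattern 8 23504167]; Pair 56 [::]]]; Pair 63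
  [::]]; Branch 245 [:: Pattern 1 21763405; Branch 236 [:: Branch 234 [:: Pattern 2
  12736045]]]; Pair 34 [::]]]]; Branch 127 [:: Pattern 3 13207564; Pattern 2 71235604]; Pair 62
  [:: Branch 236 [::]]]]]]; Branch 025 [:: Branch 056 [:: Branch 123 [:: Branch 157 [:: Branch
  134 [:: Branch 136 [:: Branch 234 [:: Branch 245 [:: Pair 27 [::]; Branch 246 [:: Pattern 15
  10243657]]; Pair 45 [::]; Branch 235 [:: Branch 236 [:: Pattern 7 01325476]; Branch 346 [::
  Branch 246 [:: Branch 245 [:: Pattern 8 31052746]; Pair 45 [::]]]]]]; Branch 146 [:: Branch
  234 [:: Branch 245 [:: Pair 27 [::]; Branch 347 [:: Pair 36 [::]]]; Branch 235 [:: Pair 27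
  [::]; Branch 256 [:: Pair 54 [::]]]; Branch 235 [:: Branch 246 [:: Pair 45 [::]]; Pair 36
  [::]]]]]; Branch 134 [:: Branch 146 [:: Branch 234 [:: Pair 36 [::]; Branch 235 [:: Pair 27
  [::]; Branch 236 [:: Pattern 15 10234567]]; Branch 235 [:: Branch 236 [:: Pattern 8
  41062735]; Branch 357 [:: Pair 36 [::]; Pattern 3 50173624]]]]; Branch 137 [:: Pattern 9
  01756342]]; Pair 72 [:: Branch 237 [::]]]; Pair 34 [:: Branch 346 [::]]; Branch 124 [::
  Branch 125 [:: Pattern 0 02143657; Branch 126 [:: Pattern 3 15702346]]; Pair 43 [:: Branch
  345 [::]]; Branch 126 [:: Branch 125 [:: Pattern 2 02563417]; Pattern 2 21764305]]; Branch
  124 [:: Branch 125 [:: Branch 126 [:: Pattern 2 02654317]; Pattern 2 21753406]; Pair 43 [::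
  Branch 345 [::]]; Branch 137 [:: Branch 146 [:: Branch 235 [:: Branch 234 [:: Pattern 3
  20143657; Branch 245 [:: Branch 345 [:: Branch 346 [:: Pattern 8 71056342]; Pair 36 [::]]]];
  Branch 246 [:: Branch 234 [:: Branch 346 [:: Branch 345 [:: Pattern 8 71065432]; Pair 45
  [::]]]; Pair 43 [::]]; Pair 34 [::]]]; Pattern 3 13207564]]]]; Branch 026 [:: Branch 123 [::
  Branch 134 [:: Branch 145 [:: Branch 156 [:: Branch 234 [:: Pair 36 [::]; Branch 235 [::
  Pattern 5 20143657; Pattern 6 10234567]; Branch 235 [:: Branch 236 [:: Pattern 7 10234567];
  Branch 246 [:: Branch 345 [:: Branch 346 [:: Pattern 8 10234567]; Pair 36 [::]]]]]]; Branch
  146 [:: Branch 234 [:: Pair 36 [::]; Branch 235 [:: Pattern 6 20143657; Pattern 16 20143657];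
  Branch 246 [:: Branch 245 [:: Pattern 7 01426375]; Pair 63 [::]]]]]; Branch 135 [:: Branch
  156 [:: Branch 234 [:: Branch 246 [:: Pattern 5 10243657; Pattern 6 10243657]; Pair 45 [::];
  Branch 235 [:: Branch 236 [:: Pattern 7 10234567]; Branch 246 [:: Branch 346 [:: Branch 345
  [:: Pattern 8 10243657]; Pair 45 [::]]]]]]; Branch 136 [:: Branch 234 [:: Branch 246 [::
  Pattern 6 20134567; Pattern 16 10243657]; Pair 45 [::]; Branch 235 [:: Branch 236 [:: Pattern
  7 01325476]; Pair 54 [::]]]]]; Branch 135 [:: Branch 136 [:: Pattern 7 20134567]; Branch 146
  [:: Branch 235 [:: Branch 246 [:: Branch 256 [:: Branch 345 [:: Branch 346 [:: Pattern 8
  20134567]; Pair 36 [::]]]; Pair 63 [::]]; Branch 234 [:: Branch 256 [:: Branch 346 [:: Branch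
  345 [:: Pattern 8 20143657]; Pair 45 [::]]]; Branch 236 [:: Pattern 7 10234567]]; Pair 54
  [::]]]]]; Pair 34 [:: Branch 346 [::]]; Branch 124 [:: Branch 125 [:: Pattern 9 01243657;
  Branch 126 [:: Pair 73 [::]]]; Pair 43 [:: Branch 345 [::]]; Branch 126 [:: Branch 125 [::
  Pattern 11 12043765]; Pattern 2 12764305]]; Branch 124 [:: Branch 125 [:: Branch 126 [::
  Pattern 11 01243657]; Pattern 2 12753406]; Pair 43 [:: Branch 345 [::]]; Branch 137 [::
  Branch 237 [:: Pair 34 [::]; Pattern 3 23107564]; Pattern 3 13207564]]]]]; Branch 025 [::
  Branch 026 [:: Pattern 7 31025476]; Branch 046 [:: Branch 123 [:: Branch 146 [:: Branch 135
  [:: Branch 156 [:: Branch 234 [:: Branch 245 [:: Branch 256 [:: Pattern 4 52037461]; Pair 26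
  [::]]; Branch 235 [:: Pair 37 [::]; Branch 246 [:: Pair 45 [::]]]; Branch 235 [:: Branch 236
  [:: Pattern 13 32051647]; Pair 26 [::]]]]; Branch 136 [:: Branch 235 [:: Branch 247 [:: Pair
  26 [::]; Pattern 19 10426375]; Branch 234 [:: Branch 356 [:: Branch 246 [:: Branch 245 [::
  Pattern 8 01352746]; Pair 45 [::]]]; Branch 236 [:: Pattern 7 01325476]]; Pair 54 [::]]]];
  Branch 134 [:: Branch 156 [:: Branch 234 [:: Pair 36 [::]; Branch 246 [:: Pattern 3 41026357;
  Branch 345 [:: Branch 235 [:: Pair 37 [::]; Branch 236 [:: Branch 356 [:: Pattern 8
  53207164]]]]]; Branch 467 [:: Pattern 1 41536207; Pair 62 [::]]]]; Branch 145 [:: Pattern 7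
  20143657]]; Pair 62 [:: Branch 236 [::]]]; Pair 34 [:: Branch 346 [::]]; Branch 124 [::
  Branch 125 [:: Pattern 9 01243657; Branch 126 [:: Pattern 2 02754316]]; Branch 135 [:: Branch
  156 [:: Branch 235 [:: Branch 247 [:: Pattern 3 20143756; Pattern 15 16420375]; Pair 34 [::];
  Branch 567 [:: Pair 54 [::]; Pattern 19 10573624]]]; Branch 136 [:: Branch 235 [:: Branch 234
  [:: Branch 245 [:: Branch 345 [:: Branch 456 [:: Pattern 8 24613057]; Pair 56 [::]]]; Pattern
  3 20143756]; Branch 246 [:: Pattern 1 20754316; Pair 43 [::]]; Pair 54 [::]]]]; Branch 126
  [:: Branch 125 [:: Pattern 11 21043765]; Pattern 2 21764305]]; Branch 167 [:: Branch 237 [::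
  Pattern 2 02134576; Branch 124 [:: Branch 135 [:: Pair 34 [::]]]]; Branch 127 [:: Pattern 3
  13207564; Pattern 2 71235604]; Pair 62 [:: Branch 236 [::]]]]]]]; Branch 024 [:: Branch 025
  [:: Pattern 9 10243657; Branch 026 [:: Pattern 3 05712346]]; Branch 035 [:: Branch 056 [::
  Branch 124 [:: Branch 157 [:: Branch 134 [:: Branch 136 [:: Branch 236 [:: Pair 25 [::];
  Pattern 3 67103524]]; Branch 146 [:: Branch 234 [:: Branch 235 [:: Branch 345 [:: Branch 245
  [:: Pair 27 [::]; Branch 246 [:: Pattern 15 01426375]]]; Pattern 3 31052746]; Pair 25 [::];
  Branch 246 [:: Branch 245 [:: Pattern 8 60174523]; Pair 45 [::]]]]]; Branch 134 [:: Branch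
  146 [:: Branch 234 [:: Branch 467 [:: Pattern 16 01426375; Pair 72 [::]]; Pair 25 [::];
  Branch 236 [:: Branch 235 [:: Pattern 14 41537260]; Pattern 17 10234567]]]; Branch 137 [::
  Pattern 9 01756342]]; Pair 72 [:: Branch 237 [::]]]; Branch 157 [:: Branch 127 [:: Pattern 2
  21753406; Pattern 3 15702346]; Branch 125 [:: Branch 146 [:: Branch 235 [:: Branch 246 [::
  Pair 27 [::]; Pattern 19 01243657]; Pair 34 [::]; Branch 457 [:: Pattern 15 06751342; Pattern
  3 51073426]]]; Branch 135 [:: Pattern 11 51073462]]; Pair 72 [:: Branch 237 [::]]]; Pair 43
  [:: Branch 345 [::]]; Branch 123 [:: Branch 125 [:: Branch 126 [:: Pattern 7 30125476];
  Branch 146 [:: Branch 235 [:: Branch 247 [:: Pattern 3 21043756; Pattern 15 06421375]; Pair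
  34 [::]; Branch 567 [:: Pair 54 [::]; Pattern 19 01573624]]]]; Branch 126 [:: Branch 125 [::
  Pattern 11 21043765]; Pattern 2 21764305]; Branch 137 [:: Branch 146 [:: Branch 246 [::
  Branch 567 [:: Pair 52 [::]; Pattern 16 60174523]; Branch 245 [:: Branch 234 [:: Pattern 14
  60325471]; Pattern 17 01426375]; Pair 43 [::]]]; Pattern 3 13207564]]]]; Branch 036 [::
  Branch 124 [:: Branch 135 [:: Branch 145 [:: Branch 156 [:: Branch 234 [:: Branch 245 [::
  Pair 47 [::]; Branch 246 [:: Branch 357 [:: Branch 236 [:: Pattern 8 32415076]]]]; Pair 25
  [::]; Branch 345 [:: Branch 236 [:: Branch 235 [:: Pattern 2 03756124]]; Pattern 1
  30672514]]]; Branch 146 [:: Branch 234 [:: Branch 246 [:: Branch 456 [:: Branch 235 [:: Pair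
  27 [::]; Branch 236 [:: Pattern 15 14230567]]]; Pattern 6 01426375]; Pair 25 [::]; Branch 236
  [:: Branch 235 [:: Pattern 2 03756124]; Pattern 17 10234567]]]]; Branch 236 [:: Pair 25 [::];
  Branch 136 [:: Pattern 2 03152764; Pattern 0 03672514]]; Pair 52 [:: Branch 245 [::]]];
  Branch 123 [:: Branch 145 [:: Branch 156 [:: Branch 245 [:: Branch 234 [:: Pair 27 [::];
  Branch 236 [:: Pattern 8 01573624]]; Pair 43 [::]; Branch 235 [:: Branch 256 [:: Pattern 2
  25764310]; Branch 456 [:: Pattern 6 01573624]]]]; Branch 146 [:: Branch 235 [:: Branch 234
  [:: Pair 27 [::]; Branch 357 [:: Pair 56 [::]]]; Branch 245 [:: Pair 27 [::]; Branch 246 [::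
  Pair 43 [::]]]; Branch 236 [:: Branch 245 [:: Pair 56 [::]]; Pair 34 [::]]]]]; Branch 125 [::
  Pattern 9 01243657; Branch 126 [:: Pattern 3 15702346]]; Branch 125 [:: Branch 126 [::
  Pattern 11 01243657]; Pattern 2 21753406]]; Pair 43 [:: Branch 345 [::]]; Branch 157 [::
  Branch 123 [:: Branch 146 [:: Branch 235 [:: Branch 234 [:: Branch 245 [:: Branch 345 [::
  Branch 456 [:: Pattern 8 75306142]; Pair 56 [::]]]; Pattern 3 21043756]; Branch 246 [::
  Pattern 1 21754306; Pair 43 [::]]; Pair 54 [::]]]; Branch 125 [:: Pattern 11 21043765]]; Pair
  52 [:: Branch 245 [::]]; Branch 127 [:: Pattern 3 14270563; Pattern 2 71246503]]]]]; Branch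
  026 [:: Branch 025 [:: Pattern 11 20143765]; Pattern 2 20764315]]; Branch 024 [:: Branch 025
  [:: Branch 026 [:: Pattern 11 10243657]; Pattern 2 20753416]; Branch 026 [:: Branch 025 [::
  Pattern 7 41026375]; Branch 035 [:: Branch 124 [:: Branch 135 [:: Branch 145 [:: Branch 156
  [:: Branch 234 [:: Branch 235 [:: Branch 246 [:: Pair 47 [::]]; Pair 36 [::]]; Branch 236 [::
  Branch 256 [:: Pattern 4 62047351]; Pair 25 [::]]; Branch 246 [:: Branch 245 [:: Pattern 13
  24130765]; Pair 25 [::]]]]; Branch 146 [:: Branch 246 [:: Branch 237 [:: Pattern 19 10325476;
  Pair 25 [::]]; Branch 234 [:: Branch 456 [:: Branch 235 [:: Branch 236 [:: Pattern 8
  01462735]; Pair 36 [::]]]; Branch 245 [:: Pattern 7 01426375]]; Pair 63 [::]]]]; Branch 134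
  [:: Branch 156 [:: Branch 234 [:: Branch 235 [:: Pattern 3 31052647; Branch 345 [:: Branch
  245 [:: Pair 47 [::]; Branch 456 [:: Pattern 8 35702146]]]]; Pair 45 [::]; Branch 357 [::
  Pattern 1 31645207; Pair 52 [::]]]]; Branch 136 [:: Pattern 7 20134567]]; Pair 52 [:: Branch
  245 [::]]]; Branch 123 [:: Branch 145 [:: Branch 156 [:: Branch 235 [:: Branch 357 [:: Branch
  456 [:: Branch 234 [:: Branch 236 [:: Pattern 15 67324051]; Pair 36 [::]]]; Pattern 6
  01537264]; Branch 236 [:: Branch 234 [:: Pattern 2 02647135]; Pattern 17 10325476]; Pair 34
  [::]]]; Branch 146 [:: Branch 235 [:: Branch 246 [:: Branch 236 [:: Branch 345 [:: Branch 356
  [:: Pattern 8 76415032]; Pair 56 [::]]]; Pair 63 [::]]; Branch 245 [:: Pattern 1 20763415;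
  Branch 236 [:: Branch 234 [:: Pattern 2 02647135]]]; Pair 34 [::]]]]; Branch 125 [:: Pattern
  9 01243657; Branch 126 [:: Pattern 2 02763415]]; Branch 125 [:: Branch 126 [:: Pattern 11
  01243657]; Pattern 2 21753406]]; Pair 43 [:: Branch 345 [::]]; Branch 157 [:: Branch 237 [::
  Pattern 2 02143675; Branch 147 [:: Branch 123 [:: Pair 34 [::]]]]; Pair 52 [:: Branch 245
  [::]]; Branch 127 [:: Pattern 3 14270563; Pattern 2 71246503]]]]]; Branch 037 [:: Branch 046
  [:: Branch 135 [:: Branch 146 [:: Branch 125 [:: Branch 156 [:: Branch 235 [:: Branch 234 [::
  Pattern 3 21043657; Branch 245 [:: Branch 345 [:: Branch 346 [:: Pattern 8 70156342]; Pair 36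
  [::]]]]; Branch 246 [:: Branch 234 [:: Branch 346 [:: Branch 345 [:: Pattern 8 70165432];
  Pair 45 [::]]]; Pair 43 [::]]; Pair 34 [::]]]; Branch 126 [:: Branch 237 [:: Pair 34 [::];
  Pattern 3 76102435]]]; Branch 124 [:: Branch 156 [:: Branch 235 [:: Branch 567 [:: Pattern 16
  51073624; Pair 62 [::]]; Branch 236 [:: Branch 234 [:: Pattern 14 51426370]; Pattern 17
  10325476]; Pair 34 [::]]]; Branch 145 [:: Pattern 2 41576203]]; Pair 62 [:: Branch 236
  [::]]]; Branch 146 [:: Branch 136 [:: Pattern 2 31642507; Pattern 3 14630527]; Branch 124 [::
  Branch 156 [:: Branch 234 [:: Branch 357 [:: Pair 36 [::]; Pattern 19 01352746]; Branch 456
  [:: Pattern 3 41026357; Pattern 15 07641253]; Pair 25 [::]]]; Branch 134 [:: Pattern 11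
  01426375]]; Pair 62 [:: Branch 236 [::]]]; Branch 123 [:: Branch 134 [:: Branch 156 [::
  Branch 234 [:: Branch 356 [:: Pattern 3 31052647; Pattern 15 07531264]; Branch 467 [:: Pair
  45 [::]; Pattern 19 01462735]; Pair 25 [::]]]; Branch 136 [:: Pattern 7 20134567]]; Branch
  126 [:: Branch 156 [:: Branch 246 [:: Branch 567 [:: Pair 52 [::]; Pattern 16 61074523];
  Branch 245 [:: Branch 234 [:: Pattern 14 61325470]; Pattern 17 10426375]; Pair 43 [::]]];
  Pattern 3 12306475]; Branch 136 [:: Branch 134 [:: Pattern 11 31052674]; Pattern 2
  31675204]]; Pair 52 [:: Branch 245 [::]]]]; Pattern 3 03217564]]]]]]]].


Lemma obstructions_ok : all obstruction_ok obstructions.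
Proof. by vm_compute. Qed.

Lemma check_le3 : check 0 3 (map tets obstructions) 4 [:: [:: 0; 1; 2; 3]] tree_le3.
Proof. by vm_compute. Qed.

Lemma check_eq4 : check 4 4 (map tets obstructions) 4 [:: [:: 0; 1; 2; 3]] tree4.
Proof. by vm_compute. Qed.

Lemma check_eq5 : check 5 5 (map tets obstructions) 4 [:: [:: 0; 1; 2; 3]] tree5.
Proof. by vm_compute. Qed.

Lemma check_ge6 : check 6 256 (map tets obstructions) 4 [:: [:: 0; 1; 2; 3]] tree_ge6.
Proof. by vm_compute. Qed.

(** * Nonexistence of a vertex set, by the size of the largest 2-face *)

Section NoConfiguration.
Local Open Scope nat_scope.
Variable V : {set {set 'I_8}}.
Hypothesis V_card : forall t, t \in V -> #|t| = 4.
Hypothesis V_triple : forall T : {set 'I_8}, #|T| = 3 -> #|at_face V T| <= 2.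
Hypothesis V_edge : forall t (T : {set 'I_8}), t \in V -> T \subset t -> #|T| = 3 ->
  exists t', [/\ t' \in V, t' != t & T \subset t'].
Hypothesis V_pair : forall i j, i != j -> exists2 t, t \in V & [set i; j] \subset t.
Hypothesis V_connected : forall i j (C : {set {set 'I_8}}), i != j ->
  C \subset at_face V [set i; j] -> C != set0 ->
  (forall t k, t \in C -> k \in t -> k \notin [set i; j] ->
    exists t', [/\ t' \in C, t' != t & k \in t']) ->
  at_face V [set i; j] \subset C.
Hypothesis no_obstruction : forall o s, obstruction_ok o -> labelling s ->
  (forall t, t \in tets o -> img s t \in V) -> False.

Lemma start_labelling i j t : i != j -> t \in V -> [set i; j] \subset t ->
  exists s, [/\ labelling s, config V s 4 [:: [:: 0; 1; 2; 3]] & img s [:: 0; 1] = [set i; j]].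
Proof.
move=> ij tV ijt.
have [k [l [kl tE]]] : exists k l, k != l /\ t :\: [set i; j] = [set k; l].
  by apply/cards2P; rewrite cardsDS // V_card // cards2 ij.
have nk m : m \in [set k; l] -> m \notin [set i; j] by rewrite -tE inE => /andP[].
(* The four facets through [t] come first, beginning with the chosen pair; the rest follow in any
   order. *)
pose r := [:: i; j; k; l] ++ enum (~: [set m in [:: i; j; k; l]]).
have u4 : uniq [:: i; j; k; l].
  have := nk k (set21 _ _); have := nk l (set22 _ _); rewrite !inE !negb_or.
  move=> /andP[li lj] /andP[ki kj].
  by rewrite /= !inE !negb_or ij kl ![i == _]eq_sym ![j == _]eq_sym ki kj li lj.
have ur : uniq r.
  rewrite cat_uniq u4 enum_uniq andbT; apply/hasPn => m.
  by rewrite mem_enum !inE.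
have r8 : size r = 8.
  have -> : size r = #|'I_8|; last by rewrite card_ord.
  apply/eqP; rewrite eqn_leq -(card_uniqP ur) max_card; apply: subset_leq_card.
  by apply/subsetP => m _; rewrite mem_cat mem_enum !inE orbN.
pose s n := nth i r n.
have s_inj : labelling s.
  by move=> m n m8 n8 /eqP; rewrite nth_uniq ?r8 // => /eqP.
have sE : img s [:: 0; 1; 2; 3] = t.
  rewrite -(setID t [set i; j]) tE (setIidPr ijt).
  by apply/setP => m; rewrite !inE -!orbA.
exists s; split=> //; last by apply/setP => m; rewrite !inE.
by split=> //=; rewrite sE tV.
Qed.

Lemma search lo hi tr i j : i != j -> lo <= #|at_face V [set i; j]| ->
  (forall i j, i != j -> #|at_face V [set i; j]| <= hi) ->
  check lo hi (map tets obstructions) 4 [:: [:: 0; 1; 2; 3]] tr -> False.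
Proof.
move=> ij lo_le le_hi; have [t tV ijt] := V_pair ij.
have [s [s_inj cs s01]] := start_labelling ij tV ijt.
apply: (check_sound V_card V_triple V_edge V_pair V_connected le_hi _ _ s_inj cs) => //.
- move=> p s'; elim: obstructions obstructions_ok => //= o os IH /andP[ok /IH{}IH].
  by rewrite inE => /predU1P[-> s'_inj|/IH//]; apply: no_obstruction.
- by rewrite s01.
Qed.

Lemma no_configuration : False.
Proof.
have step m : (exists i j, i != j /\ m < #|at_face V [set i; j]|) \/
    (forall i j, i != j -> #|at_face V [set i; j]| <= m).
  have [/existsP[i /existsP[j /andP[ij mij]]]|no] :=
    boolP [exists i, exists j, (i != j) && (m < #|at_face V [set i; j]|)].
    by left; exists i, j.
  right=> i j ij; rewrite leqNgt; apply: contra no => mij.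
  by apply/existsP; exists i; apply/existsP; exists j; rewrite ij.
have [[i [j [ij d6]]]|le5] := step 5.
  apply: (search ij d6 _ check_ge6) => k l _.
  (* The upper bound is the number of all subsets of the facets: this case is pruned by [lo] and by
     closed cycles. *)
  have <- : #|powerset [set: 'I_8]| = 256 by rewrite card_powerset cardsT card_ord.
  by apply: subset_leq_card; apply/subsetP => t _; rewrite inE subsetT.
have [[i [j [ij d5]]]|le4] := step 4; first exact: (search ij d5 le5 check_eq5).
have [[i [j [ij d4]]]|le3] := step 3; first exact: (search ij d4 le4 check_eq4).
(* With [lo] equal to 0 any two facets can take the labels 0 and 1. *)
have ij : (ord0 : 'I_8) != ord_max by [].
exact: (search ij (leq0n _) le3 check_le3).
Qed.

End NoConfiguration.

From mathcomp Require Import boolp classical_sets functions cardinality.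
From mathcomp Require Import reals interval_inference convex.

Local Open Scope classical_set_scope.
Local Open Scope card_scope.
Local Open Scope ring_scope.

(** * Faces of polytopes *)

Section DotProduct.
Variables (R : realType) (d : nat).
Implicit Types x y z : 'rV[R]_d.

Lemma dotvC x y : dotv x y = dotv y x.
Proof. by apply: eq_bigr => i _; rewrite mulrC. Qed.

Lemma dotvDr x y z : dotv x (y + z) = dotv x y + dotv x z.
Proof. by rewrite -big_split; apply: eq_bigr => i _; rewrite mxE mulrDr. Qed.

Lemma dotvZr a x y : dotv x (a *: y) = a * dotv x y.
Proof. by rewrite mulr_sumr; apply: eq_bigr => i _; rewrite mxE mulrCA. Qed.

Lemma dotvDl x y z : dotv (x + y) z = dotv x z + dotv y z.
Proof. by rewrite dotvC dotvDr !(dotvC z). Qed.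

Lemma dotvZl a x y : dotv (a *: x) y = a * dotv x y.
Proof. by rewrite dotvC dotvZr dotvC. Qed.

Lemma dotvNr x y : dotv x (- y) = - dotv x y.
Proof. by rewrite -scaleN1r dotvZr mulN1r. Qed.

Lemma dotvNl x y : dotv (- x) y = - dotv x y.
Proof. by rewrite dotvC dotvNr dotvC. Qed.

Lemma dotvBr x y z : dotv x (y - z) = dotv x y - dotv x z.
Proof. by rewrite dotvDr dotvNr. Qed.

Lemma dotvBl x y z : dotv (x - y) z = dotv x z - dotv y z.
Proof. by rewrite dotvDl dotvNl. Qed.

Lemma dot0v x : dotv 0 x = 0.
Proof. by rewrite -(scale0r x) dotvZl mul0r. Qed.

Lemma dotv0 x : dotv x 0 = 0.
Proof. by rewrite dotvC dot0v. Qed.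

Definition dotvE := (dotvBr, dotvBl, dotvDr, dotvDl, dotvNr, dotvNl,
  dotvZr, dotvZl, dotv0, dot0v).

Lemma dotvv_ge0 x : 0 <= dotv x x.
Proof. by apply: sumr_ge0 => i _; rewrite -expr2 sqr_ge0. Qed.

Lemma dotvv_eq0 x : (dotv x x == 0) = (x == 0).
Proof.
apply/eqP/eqP => [|->]; last exact: dotv0.
move=> x0; apply/rowP => i; rewrite mxE; apply/eqP; rewrite -sqrf_eq0 expr2.
apply/eqP; move: i isT.
by apply: psumr_eq0P => // i _; rewrite -expr2 sqr_ge0.
Qed.

Lemma dotvv_gt0 x : (0 < dotv x x) = (x != 0).
Proof. by rewrite lt0r dotvv_ge0 andbT dotvv_eq0. Qed.

Lemma dotv_mx x y : x *m y^T = (dotv x y)%:M.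
Proof.
apply/matrixP => i j; rewrite !ord1 !mxE mulr1n.
by apply: eq_bigr => k _; rewrite mxE.
Qed.

Lemma dotv_delta x i : dotv (delta_mx 0 i) x = x 0 i.
Proof.
rewrite /dotv (bigD1 i) //= big1 => [|j ji]; rewrite !mxE ?eqxx ?mul1r ?addr0 //.
by rewrite (negPf ji) mul0r.
Qed.

End DotProduct.

(** * Supporting hyperplanes, subfaces and vertices *)

Section Faces.
Variables (R : realType) (d : nat).
Implicit Types (x v w c : 'rV[R]_d) (P F G : set 'rV[R]_d) (S : seq 'rV[R]_d).

Lemma conv_hull_le (V : set 'rV[R]_d) c (b : R) :
  (forall v, V v -> dotv c v <= b) -> forall x, conv_hull V x -> dotv c x <= b.
Proof.
move=> Vb; apply: (@smallest_sub _ (@convex_set R 'rV[R]_d) V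
  [set x | dotv c x <= b]) => // x y l; rewrite !inE /= => xb yb.
rewrite -/(l%:num *: x + (1 - l%:num) *: y) dotvDr !dotvZr.
have l0 : 0 <= l%:num by [].
have l1 : 0 <= 1 - l%:num by rewrite subr_ge0.
rewrite [leRHS](_ : b = l%:num * b + (1 - l%:num) * b); last by ring.
by apply: lerD; apply: ler_wpM2l.
Qed.

(** It bounds how far a supporting hyperplane can be tilted: [M] is the sum of the ratios of [|f u|]
    to [g u] over the points with [g u] nonzero. *)
Lemma bounded_ratio S (f g : 'rV[R]_d -> R) :
  (forall v, v \in S -> 0 <= g v) ->
  (forall v, v \in S -> g v = 0 -> f v <= 0) ->
  exists2 M, 0 <= M & forall v, v \in S -> f v <= M * g v.
Proof.
elim: S => [|u S IH] g0 fg; first by exists 0.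
have [||M M0 HM] := IH.
- by move=> v vS; apply: g0; rewrite inE vS orbT.
- by move=> v vS; apply: fg; rewrite inE vS orbT.
have gu : 0 <= g u by apply: g0; rewrite inE eqxx.
have [gu0|gu0] := eqVneq (g u) 0.
  exists M => // v; rewrite inE => /predU1P[->|]; last exact: HM.
  by rewrite gu0 mulr0; apply: fg; rewrite ?inE ?eqxx.
have {}gu0 : 0 < g u by rewrite lt0r gu0.
exists (M + `|f u| / g u); first by rewrite addr_ge0 ?divr_ge0.
move=> v; rewrite mulrDl inE => /predU1P[->|vS].
  rewrite mulfVK ?gt_eqF // (le_trans (ler_norm _)) // lerDr.
  by rewrite mulr_ge0.
by rewrite (le_trans (HM _ vS)) // lerDl mulr_ge0 ?divr_ge0 // g0 // inE vS orbT.
Qed.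

Lemma seq_argmax (T : eqType) (s : seq T) (f : T -> R) (t : T) : t \in s ->
  exists2 y, y \in s & forall z, z \in s -> f z <= f y.
Proof.
elim: s t => [//|u s IH] t _; case: s IH => [_|w s IH].
  by exists u => [|z]; rewrite !inE // => /eqP->.
have [|y ys Hy] := IH w; first by rewrite inE eqxx.
have [uy|yu] := leP (f u) (f y).
  by exists y => [|z]; rewrite inE ?ys ?orbT // => /predU1P[->//|/Hy].
exists u => [|z]; rewrite inE ?eqxx // => /predU1P[->//|/Hy zy].
exact: le_trans (ltW yu).
Qed.

(** The generators enter only through linear inequalities, so convex combinations need not be
    written down. *)
Definition spans S P := (forall v, v \in S -> P v) /\
  forall c b, (forall v, v \in S -> dotv c v <= b) ->
    forall x, P x -> dotv c x <= b.

Lemma polytope_spans P : polytope P -> exists S, spans S P.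
Proof.
case=> V /finite_seqP[S ->] ->; exists S; split.
  by move=> v vS; apply: sub_gen_smallest.
by move=> c b; apply: conv_hull_le.
Qed.

(** A large multiple of the slack [b - dotv c x] absorbs any violation at the generators off the
    face. *)
Lemma spans_le S P c b c' b' : spans S P -> (forall x, P x -> dotv c x <= b) ->
  (forall v, v \in S -> dotv c v = b -> dotv c' v <= b') ->
  exists2 M, 0 <= M & forall x, P x -> dotv c' x - b' <= M * (b - dotv c x).
Proof.
move=> [SP Ssp] cb c'b'.
have [v vS|v vS|M M0 HM] := @bounded_ratio S (fun v => dotv c' v - b')
    (fun v => b - dotv c v).
- by rewrite subr_ge0 cb //; exact: SP.
- by move/eqP; rewrite subr_eq0 => /eqP cv; rewrite subr_le0 c'b'.
exists M => // x Px.
suff : dotv (c' + M *: c) x <= b' + M * b.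
  by rewrite !dotvE mulrBr; lra.
apply: Ssp Px => v /HM; rewrite !dotvE mulrBr; lra.
Qed.

Lemma spans_face_mem S P F x : spans S P -> is_face P F -> F x ->
  exists2 v, v \in S & F v.
Proof.
move=> SP [c [b [cb ->]]] [Px cx]; apply: contrapT => nv.
(* Were there no generator on [F], the false inequality [0 <= -1] would hold on all of them
   vacuously and extend to [x], where the slack is 0. *)
have [v vS cv|M M0 /(_ x Px)] := @spans_le S P c b 0 (-1) SP cb.
  by case: nv; exists v => //; split => //; apply: SP.1.
by rewrite cx subrr mulr0 dot0v; lra.
Qed.

Lemma spans_subface S P F c b : spans S P -> is_face P F ->
  (forall v, v \in S -> F v -> dotv c v <= b) ->
  (forall x, F x -> dotv c x <= b) /\
  is_face P (F `&` [set x | dotv c x = b]).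
Proof.
move=> SP [c0 [b0 [cb ->]]] Fb.
have [v vS cv|M M0 HM] := @spans_le S P c0 b0 c b SP cb.
  by apply: Fb => //; split => //; apply: SP.1.
split=> [x [Px /= cx]|].
  by have := HM x Px; rewrite cx subrr mulr0 subr_le0.
(* The multiple is [M + 1] instead of [M] so that equality forces the slack of [c0] to vanish. *)
exists (c + (M + 1) *: c0), (b + (M + 1) * b0); split=> [x Px|].
  by have := HM x Px; have := cb x Px; rewrite !dotvE; lra.
apply/seteqP; split=> x /=; rewrite !dotvE; first by move=> [[Px ->] ->].
move=> [Px E]; have := HM x Px; have := cb x Px => h1 h2.
have cx : dotv c0 x = b0 by lra.
by split=> //; move: E; rewrite cx; lra.
Qed.

Lemma eq_dotv x y : (forall c, dotv c x <= dotv c y) -> x = y.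
Proof.
move=> xy; apply/rowP => i; apply/le_anti; rewrite -!dotv_delta xy /=.
by rewrite -lerN2 -!dotvNl xy.
Qed.

(* The farthest generator from the origin is a vertex. *)
Lemma face_vertex P F x : polytope P -> is_face P F -> F x ->
  exists2 v, vertices P v & F v.
Proof.
move=> /polytope_spans[S SP] FP Fx.
have [v0 v0S Fv0] := spans_face_mem SP FP Fx.
pose T := [seq v <- S | `[< F v >]].
have TE v : (v \in T) = (v \in S) && `[< F v >] by rewrite mem_filter andbC.
have [|v vT vmax] := @seq_argmax _ T (fun v => dotv v v) v0.
  by rewrite TE v0S; apply/asboolP.
move: (vT); rewrite TE => /andP[vS /asboolP Fv].
(* Expanding the square of [w - v] and using that [v] is farthest; equality forces that square to be
   0. *)
have le_v w : w \in S -> F w -> dotv v w <= dotv v v ?= iff (w == v).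
  move=> wS Fw; have /vmax wv : w \in T by rewrite TE wS; apply/asboolP.
  have := dotvv_ge0 (w - v); rewrite !dotvE [dotv w v]dotvC => h.
  split; first by lra.
  apply/eqP/eqP => [e|->//]; apply/eqP.
  by rewrite -subr_eq0 -dotvv_eq0 eq_le dotvv_ge0 andbT !dotvE [dotv w v]dotvC; lra.
have [_ GP] := spans_subface SP FP (fun w wS Fw => (le_v w wS Fw).1).
exists v => //; rewrite /vertices /=.
suff <- : F `&` [set w | dotv v w = dotv v v] = [set v] by [].
apply/seteqP; split=> y /= => [Gy|->//].
apply: eq_dotv => c; have [w wS [Fw /= /eqP]|+ _] := spans_subface (c := c) (b := dotv c v) SP GP.
  by rewrite (le_v w wS Fw).2 => /eqP->.
by apply.
Qed.

(** The maximum of [dotv c] on [F] is attained on a subface, and that subface contains a vertex. *)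
Lemma face_le P F c b : polytope P -> is_face P F ->
  (forall v, vertices P v -> F v -> dotv c v <= b) ->
  forall x, F x -> dotv c x <= b.
Proof.
move=> Ppol FP Fb; have [S SP] := polytope_spans Ppol.
move=> x Fx; have [v0 v0S Fv0] := spans_face_mem SP FP Fx.
pose T := [seq v <- S | `[< F v >]].
have TE v : (v \in T) = (v \in S) && `[< F v >] by rewrite mem_filter andbC.
have [|v vT vmax] := @seq_argmax _ T (dotv c) v0.
  by rewrite TE v0S; apply/asboolP.
move: (vT); rewrite TE => /andP[vS /asboolP Fv].
have [w wS Fw|Fle GP] := @spans_subface S P F c (dotv c v) SP FP.
  by apply: vmax; rewrite TE wS; apply/asboolP.
have [w wP [Fw cw]] := face_vertex (x := v) Ppol GP (conj Fv erefl).
by apply: le_trans (Fle x Fx) _; rewrite -cw; apply: Fb.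
Qed.

Lemma face_eq P F c b : polytope P -> is_face P F ->
  (forall v, vertices P v -> F v -> dotv c v = b) ->
  forall x, F x -> dotv c x = b.
Proof.
move=> Ppol FP Fb x Fx; apply/le_anti/andP; split.
  by apply: (face_le Ppol FP _ Fx) => v vP /(Fb v vP) <-.
rewrite -lerN2 -dotvNl.
by apply: (face_le Ppol FP _ Fx) => v vP /(Fb v vP) <-; rewrite dotvNl.
Qed.

Lemma subface P F c b : polytope P -> is_face P F ->
  (forall v, vertices P v -> F v -> dotv c v <= b) ->
  is_face P (F `&` [set x | dotv c x = b]).
Proof.
move=> Ppol FP Fb; have [S SP] := polytope_spans Ppol.
have [|//] := spans_subface (c := c) (b := b) SP FP.
by move=> v _; apply: (face_le Ppol FP Fb).
Qed.

Lemma face_subset P F G : polytope P -> is_face P F -> is_face P G ->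
  (forall v, vertices P v -> F v -> G v) -> F `<=` G.
Proof.
move=> Ppol FP [c [b [cb ->]]] FG x Fx.
split; first by case: FP Fx => c' [b' [_ ->]] [].
by apply: (face_eq Ppol FP _ Fx) => v vP /(FG v vP)[].
Qed.

(** Were [x] the only possible vertex on [F], every functional would be maximal at [x], and [F]
    would shrink to this point. *)
Lemma face_vertex_neq P F x : polytope P -> is_face P F -> F x ->
  F <> [set x] -> exists v, [/\ vertices P v, F v & v <> x].
Proof.
move=> Ppol FP Fx FNx; apply: contrapT => nv; apply: FNx.
apply/seteqP; split=> y /= => [Fy|->//]; apply: eq_dotv => c.
apply: (face_le Ppol FP _ Fy) => v vP Fv.
by have [->//|/eqP vx] := eqVneq v x; case: nv; exists v.
Qed.

Lemma is_face_full P : is_face P P.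
Proof.
exists 0, 0; split=> [x _|]; first by rewrite dot0v.
by apply/seteqP; split=> x /= => [|[]//]; rewrite dot0v.
Qed.

Lemma is_face0 P : is_face P set0.
Proof.
exists 0, 1; split=> [x _|]; first by rewrite dot0v ler01.
apply/seteqP; split=> x //= [_]; rewrite dot0v => /eqP.
by rewrite eq_sym oner_eq0.
Qed.

Lemma face_sub P F : is_face P F -> F `<=` P.
Proof. by case=> c [b [_ ->]] x []. Qed.

Lemma vertex_mem P v : vertices P v -> P v.
Proof. by move/face_sub; apply. Qed.

End Faces.

(** * Inscribed simple polytopes *)

Section Inversion.
Variable R : realType.

Lemma kernel_line (a1 a2 a3 v0 v : 'rV[R]_4) :
  (forall t1 t2 t3, t1 *: a1 + t2 *: a2 + t3 *: a3 = 0 ->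
    [/\ t1 = 0, t2 = 0 & t3 = 0]) ->
  dotv a1 v0 = 0 -> dotv a2 v0 = 0 -> dotv a3 v0 = 0 -> v0 != 0 ->
  dotv a1 v = 0 -> dotv a2 v = 0 -> dotv a3 v = 0 ->
  exists t, v = t *: v0.
Proof.
move=> free_a h1 h2 h3 v0N0 k1 k2 k3.
pose A : 'M[R]_(3, 4) := \matrix_(k < 3) tnth [tuple a1; a2; a3] k.
have rowA (u : 'rV[R]_3) :
    u *m A = u 0 0 *: a1 + u 0 1 *: a2 + u 0 (inord 2) *: a3.
  rewrite mulmx_sum_row !big_ord_recr big_ord0 /= add0r.
  congr (_ *: _ + _ *: _ + _ *: _); rewrite ?rowK //;
    congr (u 0 _); apply/val_inj; rewrite /= ?inordK //.
have rA : \rank A = 3%N.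
  apply/eqP; apply/row_freeP; apply/row_freeP; rewrite -kermx_eq0.
  apply/rowV0P => u /sub_kermxP; rewrite rowA => /free_a[u0 u1 u2].
  apply/rowP => k; rewrite mxE; case: k => -[|[|[|//]]] k.
  - by rewrite -[RHS]u0; congr (u 0 _); apply/val_inj.
  - by rewrite -[RHS]u1; congr (u 0 _); apply/val_inj.
  - by rewrite -[RHS]u2; congr (u 0 _); apply/val_inj; rewrite /= inordK.
have kerP u : dotv a1 u = 0 -> dotv a2 u = 0 -> dotv a3 u = 0 ->
    (u <= kermx A^T)%MS.
  move=> u1 u2 u3; apply/sub_kermxP; apply/rowP => k.
  rewrite [RHS]mxE -[LHS]/((u *m A^T) 0 k).
  have -> : (u *m A^T) 0 k = dotv u (row k A).
    by rewrite mxE; apply: eq_bigr => l _; rewrite !mxE.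
  rewrite rowK dotvC; case: k => -[|[|[|//]]] k.
  - exact: u1.
  - exact: u2.
  - exact: u3.
have rk : \rank (kermx A^T) = 1%N by rewrite mxrank_ker mxrank_tr rA.
apply/sub_rVP; apply: submx_trans (kerP v k1 k2 k3) _.
have [_] := mxrank_leqif_sup (kerP v0 h1 h2 h3).
by rewrite rk rank_rV v0N0 eqxx => <-.
Qed.

Lemma dotv_line (c u v : 'rV[R]_4) t :
  dotv c (u + t *: (v - u)) = (1 - t) * dotv c u + t * dotv c v.
Proof. by rewrite !dotvE; ring. Qed.

Definition dist (x y : 'rV[R]_4) : R := Num.sqrt (dotv (x - y) (x - y)).

Lemma distC x y : dist x y = dist y x.
Proof. by rewrite /dist -opprB dotvNl dotvNr opprK. Qed.

Lemma dist_gt0 x y : (0 < dist x y) = (x != y).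
Proof. by rewrite sqrtr_gt0 dotvv_gt0 subr_eq0. Qed.

Lemma dist_sqr x y : dist x y ^+ 2 = dotv (x - y) (x - y).
Proof. by rewrite sqr_sqrtr // dotvv_ge0. Qed.

Lemma sqrt_dotvZ (t : R) (u : 'rV[R]_4) :
  Num.sqrt (dotv (t *: u) (t *: u)) = `|t| * Num.sqrt (dotv u u).
Proof.
by rewrite dotvZl dotvZr mulrA -expr2 sqrtrM ?sqr_ge0 // sqrtr_sqr.
Qed.

(** The inverse of [x] in the unit sphere about [p], translated so that [p] is the origin: a
    hyperplane through [p] then has a linear equation. *)
Definition inversion (p x : 'rV[R]_4) := (dotv (x - p) (x - p))^-1 *: (x - p).

Lemma dotv_inversionE c p x :
  dotv c (inversion p x) = (dotv c x - dotv c p) / dotv (x - p) (x - p).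
Proof. by rewrite dotvZr mulrC (dotvBr c). Qed.

(** This scaling factor is the source of the products of distances in all relations. *)
Lemma inversion_dist p x y : x != p -> y != p ->
  Num.sqrt (dotv (inversion p x - inversion p y) (inversion p x - inversion p y))
  = dist x y / (dist x p * dist y p).
Proof.
move=> xp yp.
have X0 : dotv (x - p) (x - p) != 0 by rewrite dotvv_eq0 subr_eq0.
have Y0 : dotv (y - p) (y - p) != 0 by rewrite dotvv_eq0 subr_eq0.
have dx : 0 < dist x p by rewrite dist_gt0.
have dy : 0 < dist y p by rewrite dist_gt0.
have q0 : 0 <= dist x y / (dist x p * dist y p).
  by rewrite divr_ge0 ?mulr_ge0 ?sqrtr_ge0.
rewrite -[RHS](ger0_norm q0) -sqrtr_sqr; congr Num.sqrt.
rewrite expr_div_n exprMn !dist_sqr.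
have -> : dotv (x - y) (x - y) = dotv (x - p) (x - p) - dotv (x - p) (y - p) *+ 2
    + dotv (y - p) (y - p).
  have -> : x - y = (x - p) - (y - p) by rewrite opprB addrA subrK.
  move: (x - p) (y - p) => u v.
  by rewrite !dotvE (dotvC v u); ring.
rewrite /inversion; move: X0 Y0; move: (x - p) (y - p) => u v X0 Y0.
by rewrite !dotvE (dotvC v u); field; rewrite X0 Y0.
Qed.

Lemma inversion_inj p x y : x != p -> y != p ->
  inversion p x = inversion p y -> x = y.
Proof.
move=> xp yp e; apply/eqP; apply: contraTT isT => xy.
have := inversion_dist xp yp; rewrite e subrr dotv0 sqrtr0 => /esym/eqP.
by rewrite gt_eqF // divr_gt0 ?mulr_gt0 ?dist_gt0.
Qed.

Lemma inversion_norm p x : x != p ->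
  dotv (inversion p x) (inversion p x) = (dotv (x - p) (x - p))^-1.
Proof.
move=> xp; have X0 : dotv (x - p) (x - p) != 0 by rewrite dotvv_eq0 subr_eq0.
by rewrite dotvZl dotvZr mulVf // mulr1.
Qed.

End Inversion.

(* [a i] and [b i] are the normal and the height of the facet hyperplane [i], and
   [W] is the set of vertices. *)
Section InscribedSimple.
Local Open Scope set_scope.
Variables (R : realType) (a : 'I_8 -> 'rV[R]_4) (b : 'I_8 -> R).
Variables (c0 : 'rV[R]_4) (r : R) (W : set 'rV[R]_4).
Implicit Types (i j k l : 'I_8) (p q x y w : 'rV[R]_4).

Definition incident x : {set 'I_8} := [set i | dotv (a i) x == b i].

Definition slack i x := b i - dotv (a i) x.

Hypothesis W_le : forall x i, W x -> dotv (a i) x <= b i.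
Hypothesis W_sphere : forall x, W x -> dotv (x - c0) (x - c0) = r ^+ 2.
Hypothesis W_simple : forall x, W x -> #|incident x| = 4%N.
Hypothesis W_inj : forall x y, W x -> W y -> incident x = incident y -> x = y.
Hypothesis W_edge : forall x (T : {set 'I_8}), W x -> T \subset incident x ->
  #|T| = 3%N -> exists y, [/\ W y, y <> x & T \subset incident y].

Lemma slack_eq0 i x : (slack i x == 0) = (i \in incident x).
Proof. by rewrite subr_eq0 eq_sym inE. Qed.

Lemma slack_gt0 i x : W x -> (0 < slack i x) = (i \notin incident x).
Proof. by move=> Wx; rewrite lt0r slack_eq0 subr_ge0 W_le // andbT. Qed.

Lemma dotv_inversion i p x : i \in incident p ->
  dotv (a i) (inversion p x) = - slack i x / dotv (x - p) (x - p).
Proof.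
rewrite inE => /eqP ip; rewrite dotvZr mulrC /slack dotvBr ip.
by congr (_ / _); ring.
Qed.

Lemma dotv_inversion_eq0 i p x : i \in incident p -> i \in incident x ->
  dotv (a i) (inversion p x) = 0.
Proof.
by move=> ip; rewrite dotv_inversion // -slack_eq0 => /eqP->; rewrite oppr0 mul0r.
Qed.

Lemma dotv_inversion_lt0 i p x : W x -> x != p -> i \in incident p ->
  i \notin incident x -> dotv (a i) (inversion p x) < 0.
Proof.
move=> Wx xp ip ix; rewrite dotv_inversion // mulNr oppr_lt0 divr_gt0 //.
  by rewrite slack_gt0.
by rewrite dotvv_gt0 subr_eq0.
Qed.

(* A sphere through [p] becomes a hyperplane under the inversion at [p]. *)
Lemma dotv_inversion_sphere p x : W p -> W x -> x != p ->
  dotv (c0 - p) (inversion p x) = 2^-1.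
Proof.
move=> Wp Wx xp; have : dotv (x - p) (x - p) != 0 by rewrite dotvv_eq0 subr_eq0.
have := W_sphere Wx; rewrite -(W_sphere Wp) dotvZr.
have -> : x - c0 = (x - p) - (c0 - p) by rewrite opprB addrA subrK.
have -> : p - c0 = - (c0 - p) by rewrite opprB.
move: (x - p) (c0 - p) => u v; rewrite !dotvE (dotvC u v) => e u0.
have {}e : dotv v u = 2^-1 * dotv u u by lra.
by rewrite e mulrCA mulVf // mulr1.
Qed.

(** The far end of the edge on the three facets other than [j]; if it lay on [j] too, it would have
    the same four facets as [x]. *)
Lemma edge_leaving x j : W x -> j \in incident x ->
  exists y, [/\ W y, y != x, j \notin incident y
    & incident x :\ j \subset incident y].
Proof.
move=> Wx jx; have T3 : #|incident x :\ j| = 3%N.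
  by have := cardsD1 j (incident x); rewrite jx W_simple // => -[].
have [y [Wy yx Ty]] := W_edge Wx (subsetDl _ _) T3.
exists y; split=> //; first exact/eqP.
apply/negP => jy; apply: yx; apply: W_inj => //; apply/esym/eqP.
rewrite eqEcard !W_simple // andbT -(finset.setD1K jx) finset.subUset finset.sub1set jy.
exact: Ty.
Qed.

(** The images satisfy three linear equations, from the facets [i] and [j] through [p] and from the
    sphere, so they lie on a line in dimension four if the normals are independent. The normal
    [c0 - p] is independent of the others because it is nonzero at an image where both of them
    vanish. *)
Lemma inversion_collinear p i j x q w : W p -> W x -> W q -> W w -> i != j ->
  [set i; j] \subset incident p -> [set i; j] \subset incident x ->
  [set i; j] \subset incident q -> [set i; j] \subset incident w ->
  x != p -> q != p -> w != p -> q != w ->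
  exists t, inversion p x = inversion p q + t *: (inversion p w - inversion p q).
Proof.
move=> Wp Wx Wq Ww ij; rewrite !finset.subUset !finset.sub1set.
move=> /andP[ip jp] /andP[ix jx] /andP[iq jq] /andP[iw jw] xp qp wp qw.
have [||||||||t e] := @kernel_line R (a i) (a j) (c0 - p)
    (inversion p w - inversion p q) (inversion p x - inversion p q); last first.
- by exists t; rewrite -e addrC subrK.
1,5: by rewrite dotvBr !dotv_inversion_sphere // subrr.
1,2,4,5: by rewrite dotvBr !dotv_inversion_eq0 // subrr.
- rewrite subr_eq0; apply: contraNneq qw => e.
  by rewrite eq_sym (inversion_inj wp qp e).
move=> t1 t2 t3 e.
have t30 : t3 = 0.
  have := congr1 (fun v => dotv v (inversion p x)) e.
  rewrite !dotvDl !dotvZl !dotv_inversion_eq0 // dot0v !mulr0 !add0r.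
  rewrite dotv_inversion_sphere // => /eqP; rewrite mulf_eq0 invr_eq0.
  by rewrite pnatr_eq0 orbF => /eqP.
(* Pair the relation with the image of the neighbour of [p] that stays on facet [k] and leaves facet
   [l]. *)
have step k l s1 s2 : k != l -> k \in incident p -> l \in incident p ->
    s1 *: a k + s2 *: a l = 0 -> s2 = 0.
  move=> kl kp lp es; have [y [Wy yp ly sy]] := edge_leaving Wp lp.
  have ky : k \in incident y by apply: (fintype.subsetP sy); rewrite finset.in_setD1 kl.
  have := congr1 (fun v => dotv v (inversion p y)) es.
  rewrite dotvDl !dotvZl (dotv_inversion_eq0 kp ky) mulr0 add0r dot0v.
  move/eqP; rewrite mulf_eq0 (lt_eqF (dotv_inversion_lt0 Wy yp lp ly)) orbF.
  by move/eqP.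
move: e; rewrite t30 scale0r addr0 => e; split=> //.
  by apply: (step j i t2 t1) => //; rewrite 1?eq_sym // addrC.
exact: (step i j t1 t2).
Qed.

Lemma incident_eq x y : W x -> W y -> incident x \subset incident y -> x = y.
Proof.
move=> Wx Wy xy; apply: W_inj => //; apply/eqP.
by rewrite eqEcard xy !W_simple.
Qed.

(* If three vertices had [i], [j], [k] in common, then the facet [k] would contain
   the whole line onto which the inversion maps the 2-face of [i] and [j]. *)
Lemma edge_two p x y i j k : W p -> W x -> W y -> #|[set i; j; k]| = 3%N ->
  [set i; j; k] \subset incident p -> [set i; j; k] \subset incident x ->
  [set i; j; k] \subset incident y -> x != p -> y != p -> x = y.
Proof.
move=> Wp Wx Wy c3 sp sx sy xp yp; apply/eqP; apply: contraT => xy.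
have ij : i != j.
  apply: contra_eq_neq c3 => ->; rewrite finset.setUid cards2.
  by case: (j == k).
have kij : k \notin [set i; j].
  apply/negP => kk; move: c3; rewrite finset.setUC.
  by rewrite (finset.setUidPr _) ?finset.sub1set // cards2; case: (i == j).
have kp : k \in incident p.
  by apply: (fintype.subsetP sp); rewrite !inE eqxx orbT.
have kx : k \in incident x.
  by apply: (fintype.subsetP sx); rewrite !inE eqxx orbT.
have ky : k \in incident y.
  by apply: (fintype.subsetP sy); rewrite !inE eqxx orbT.
have [w [Ww wp kw sw]] := edge_leaving Wp kp.
have sub2 z : [set i; j; k] \subset incident z -> [set i; j] \subset incident z.
  by apply: fintype.subset_trans; apply: finset.subsetUl.
have ijw : [set i; j] \subset incident w.
  apply: fintype.subset_trans sw; apply/fintype.subsetP => z zij.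
  rewrite finset.in_setD1 (fintype.subsetP (sub2 p sp)) // andbT.
  by apply: contraNneq kij => <-.
have [t e] := inversion_collinear Wp Ww Wx Wy ij (sub2 _ sp) ijw (sub2 _ sx)
  (sub2 _ sy) wp xp yp xy.
have := dotv_inversion_lt0 Ww wp kp kw.
rewrite e dotv_line !dotv_inversion_eq0 // !mulr0 addr0.
by rewrite ltxx.
Qed.

(** On the line let [t] be the coordinate of the image of [x], with that of [q] at 0 and that of [y]
    at 1. As facet [k] passes through [p] and [q], its functional measures [t]; so do the distances
    to the image of [q]. Equate the two. *)
Lemma slack_ratio p q x y i j k : W p -> W q -> W x -> W y ->
  i != j -> p != q ->
  k \in incident p -> k \in incident q ->
  [set i; j] \subset incident p -> [set i; j] \subset incident q ->
  [set i; j] \subset incident x -> [set i; j] \subset incident y ->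
  k \notin incident x -> k \notin incident y ->
  slack k x * (dist y p * dist y q) = slack k y * (dist x p * dist x q).
Proof.
move=> Wp Wq Wx Wy ij pq kp kq sp sq sx sy kx ky.
have neq z u : k \notin incident z -> k \in incident u -> z != u.
  by move=> kz ku; apply: contraNneq kz => ->.
have xp := neq _ _ kx kp; have yp := neq _ _ ky kp.
have xq := neq _ _ kx kq; have yq := neq _ _ ky kq.
have qp : q != p by rewrite eq_sym.
have qy : q != y by rewrite eq_sym.
have [t e] := inversion_collinear Wp Wx Wq Wy ij sp sx sq sy xp qp yp qy.
have Et : dotv (a k) (inversion p x) = t * dotv (a k) (inversion p y).
  by rewrite e dotv_line (dotv_inversion_eq0 kp kq); ring.
have Dt : dist x q / (dist x p * dist q p) = `|t| * (dist y q / (dist y p * dist q p)).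
  rewrite -!inversion_dist // -sqrt_dotvZ e.
  by rewrite [in LHS]addrC addKr.
move: Et; rewrite !dotv_inversion // -!dist_sqr => Et.
have gx : 0 < slack k x by rewrite slack_gt0.
have gy : 0 < slack k y by rewrite slack_gt0.
have dxp : 0 < dist x p by rewrite dist_gt0.
have dyp : 0 < dist y p by rewrite dist_gt0.
have dqp : 0 < dist q p by rewrite dist_gt0.
have Et' : slack k x = t * (slack k y * (dist x p ^+ 2 / dist y p ^+ 2)).
  have -> : slack k x = - (- slack k x / dist x p ^+ 2) * dist x p ^+ 2.
    by field; rewrite gt_eqF.
  by rewrite Et; field; rewrite !gt_eqF.
(* The slacks at [x] and [y] are positive, which fixes the sign and removes the absolute value in
   [Dt]. *)
have t0 : 0 <= t.
  have : 0 <= t * (slack k y * (dist x p ^+ 2 / dist y p ^+ 2)) by rewrite -Et' ltW.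
  by rewrite pmulr_lge0 // mulr_gt0 // divr_gt0 // exprn_gt0.
have Dt' : dist x q = t * (dist y q * dist x p / dist y p).
  have -> : dist x q = dist x q / (dist x p * dist q p) * (dist x p * dist q p).
    by field; rewrite !gt_eqF.
  by rewrite Dt ger0_norm //; field; rewrite !gt_eqF.
by rewrite Et' Dt'; field; rewrite gt_eqF.
Qed.

(** Facet [k] vanishes at the image of [x] and is negative at those of [y] and [z], whence [0 < t];
    facet [l] gives [t < 1] from the other end. *)
Lemma inversion_between p x y z i j k l : W p -> W x -> W y -> W z ->
  i != j -> k \in incident p -> l \in incident p ->
  [set i; j] \subset incident p -> [set i; j] \subset incident x ->
  [set i; j] \subset incident y -> [set i; j] \subset incident z ->
  k \in incident x -> k \notin incident y -> k \notin incident z ->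
  l \in incident z -> l \notin incident x -> l \notin incident y ->
  x != p -> y != p -> z != p ->
  exists t, [/\ 0 < t, t < 1 &
    inversion p y = inversion p x + t *: (inversion p z - inversion p x)].
Proof.
move=> Wp Wx Wy Wz ij kp lp sp sx sy sz kx ky kz lz lx ly xp yp zp.
have xz : x != z by apply: contraNneq kz => <-.
have [t e] := inversion_collinear Wp Wy Wx Wz ij sp sy sx sz yp xp zp xz.
exists t; split=> //.
  have := dotv_inversion_lt0 Wy yp kp ky; rewrite e dotv_line.
  rewrite (dotv_inversion_eq0 kp kx) mulr0 add0r.
  by rewrite nmulr_llt0 // dotv_inversion_lt0.
have := dotv_inversion_lt0 Wy yp lp ly; rewrite e dotv_line.
rewrite (dotv_inversion_eq0 lp lz) mulr0 addr0.
by rewrite nmulr_llt0 ?dotv_inversion_lt0 // subr_gt0.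
Qed.

Lemma ptolemy_lt p x y z i j k l : W p -> W x -> W y -> W z ->
  i != j -> k \in incident p -> l \in incident p ->
  [set i; j] \subset incident p -> [set i; j] \subset incident x ->
  [set i; j] \subset incident y -> [set i; j] \subset incident z ->
  k \in incident x -> k \notin incident y -> k \notin incident z ->
  l \in incident z -> l \notin incident x -> l \notin incident y ->
  x != p -> y != p -> z != p ->
  dist x y * dist p z < dist x z * dist p y.
Proof.
move=> Wp Wx Wy Wz ij kp lp sp sx sy sz kx ky kz lz lx ly xp yp zp.
have [t [t0 t1 e]] := inversion_between Wp Wx Wy Wz ij kp lp sp sx sy sz kx ky kz
  lz lx ly xp yp zp.
have dxp : 0 < dist x p by rewrite dist_gt0.
have dyp : 0 < dist y p by rewrite dist_gt0.
have dzp : 0 < dist z p by rewrite dist_gt0.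
have dxz : 0 < dist z x by rewrite dist_gt0; apply: contraNneq kz => ->.
have D : dist y x / (dist y p * dist x p) = `|t| * (dist z x / (dist z p * dist x p)).
  rewrite -!inversion_dist // -sqrt_dotvZ e.
  by rewrite [in LHS]addrC addKr.
rewrite (distC x y) (distC p z) (distC x z) (distC p y).
have -> : dist y x = t * (dist z x * dist y p / dist z p).
  have -> : dist y x = dist y x / (dist y p * dist x p) * (dist y p * dist x p).
    by field; rewrite !gt_eqF.
  by rewrite D gtr0_norm //; field; rewrite !gt_eqF.
have -> : t * (dist z x * dist y p / dist z p) * dist z p = t * (dist z x * dist y p).
  by field; rewrite gt_eqF.
by rewrite gtr_pMl // mulr_gt0.
Qed.

Lemma edge_two2 p x y i j k : W p -> W x -> W y -> i != j ->
  k \notin [set i; j] ->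
  [set i; j] \subset incident p -> [set i; j] \subset incident x ->
  [set i; j] \subset incident y -> k \in incident p -> k \in incident x ->
  k \in incident y -> x != p -> y != p -> x = y.
Proof.
move=> Wp Wx Wy ij kij sp sx sy kp kx ky.
have c3 : #|[set i; j; k]| = 3%N.
  by rewrite finset.setUC cardsU1 kij cards2 ij.
by apply: (edge_two Wp Wx Wy c3);
  rewrite finset.subUset finset.sub1set ?sp ?sx ?sy.
Qed.

Lemma eq_vertex_of_two x y i j k l : W x -> W y ->
  incident x :\: [set i; j] = [set k; l] -> [set i; j] \subset incident y ->
  k \in incident y -> l \in incident y -> x = y.
Proof.
move=> Wx Wy e sy ky ly; apply: incident_eq => //.
rewrite -(finset.setID (incident x) [set i; j]) finset.subUset e.
rewrite (fintype.subset_trans (finset.subsetIr _ _) sy) finset.subUset.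
by rewrite !finset.sub1set ky ly.
Qed.

Lemma vertex_other_two x i j : W x -> i != j -> [set i; j] \subset incident x ->
  exists k l, k != l /\ incident x :\: [set i; j] = [set k; l].
Proof.
move=> Wx ij sx; apply/cards2P; apply/eqP.
by rewrite cardsDS // W_simple // cards2 ij.
Qed.

(** By Vieta the quadratic is [al * ((t - t1) * (t - t2))]. *)
Lemma quadratic_sign (al be ga t1 t2 t : R) : 0 < al -> t1 != t2 ->
  al * t1 ^+ 2 + be * t1 + ga = 0 -> al * t2 ^+ 2 + be * t2 + ga = 0 ->
  0 < al * t ^+ 2 + be * t + ga -> 0 < (t - t1) * (t - t2).
Proof.
move=> al0 t12 e1 e2.
have eb : be = - al * (t1 + t2).
  apply: (mulfI (x := t1 - t2)); first by rewrite subr_eq0.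
  by apply/eqP; rewrite -subr_eq0; apply/eqP; rewrite -[RHS](subrr 0) -{1}e1 -e2; ring.
have -> : al * t ^+ 2 + be * t + ga = al * ((t - t1) * (t - t2)).
  by rewrite -[LHS]subr0 -e1 eb; ring.
by rewrite pmulr_rgt0.
Qed.

(* The vertices of the 2-face of [i] and [j] form a single cycle: under the
   inversion at [p] the others lie on a segment, which the edges not through [p] cut
   into intervals. *)
Lemma polygon_connected (C : seq 'rV[R]_4) i j p w : i != j -> p \in C ->
  (forall x, x \in C -> W x /\ [set i; j] \subset incident x) ->
  (forall x m, x \in C -> m \in incident x -> m \notin [set i; j] ->
    exists x', [/\ x' \in C, x' != x & m \in incident x']) ->
  W w -> [set i; j] \subset incident w -> w \in C.
Proof.
move=> ij pC CW Cedge Ww sw; apply: contraT => wC.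
have neqw x : x \in C -> w != x by move=> xC; apply: contraNneq wC => ->.
have [Wp sp] := CW p pC.
have [k [l [kl ekl]]] := vertex_other_two Wp ij sp.
have /finset.setDP[kp kij] : k \in incident p :\: [set i; j] by rewrite ekl set21.
have /finset.setDP[lp lij] : l \in incident p :\: [set i; j] by rewrite ekl set22.
have [A [AC Ap kA]] := Cedge p k pC kp kij.
have [Z [ZC Zp lZ]] := Cedge p l pC lp lij.
have [WA sA] := CW A AC; have [WZ sZ] := CW Z ZC.
have lA : l \notin incident A.
  apply: contraNN Ap => lA.
  by rewrite (eq_vertex_of_two Wp WA ekl).
have kZ : k \notin incident Z.
  apply: contraNN Zp => kZ.
  by rewrite (eq_vertex_of_two Wp WZ ekl).
have AZ : A != Z by apply: contraNneq kZ => <-.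
have wp := neqw p pC.
have kw : k \notin incident w.
  apply: contraNN (neqw A AC) => kw.
  by rewrite (edge_two2 Wp Ww WA ij kij).
have lw : l \notin incident w.
  apply: contraNN (neqw Z ZC) => lw.
  by rewrite (edge_two2 Wp Ww WZ ij lij).
(* The coordinate on the line, with the neighbours [A] and [Z] of [p] at 0 and 1, read off by the
   functional of facet [k], which vanishes at [A]. *)
pose T x := dotv (a k) (inversion p x) / dotv (a k) (inversion p Z).
have kZ0 := dotv_inversion_lt0 WZ Zp kp kZ.
have TE x : W x -> [set i; j] \subset incident x -> x != p ->
    inversion p x = inversion p A + T x *: (inversion p Z - inversion p A).
  move=> Wx sx xp.
  have [t e] := inversion_collinear Wp Wx WA WZ ij sp sx sA sZ xp Ap Zp AZ.
  suff -> : T x = t by [].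
  rewrite /T e dotv_line (dotv_inversion_eq0 kp kA) mulr0 add0r mulfK //.
  by rewrite lt_eqF.
have T_inj x y : W x -> [set i; j] \subset incident x -> x != p ->
    W y -> [set i; j] \subset incident y -> y != p -> T x = T y -> x = y.
  move=> Wx sx xp Wy sy yp Txy; apply: (inversion_inj xp yp).
  by rewrite TE // Txy -TE.
have T_ge0 x : W x -> x != p -> 0 <= T x.
  move=> Wx xp; have [kx|kx] := boolP (k \in incident x).
    by rewrite /T (dotv_inversion_eq0 kp kx) mul0r.
  by rewrite ltW // /T ltr_ndivlMr // mul0r dotv_inversion_lt0.
have TA : T A = 0 by rewrite /T (dotv_inversion_eq0 kp kA) mul0r.
have TZ : T Z = 1 by rewrite /T divff // lt_eqF.
have Tw0 : 0 < T w.
  by rewrite /T ltr_ndivlMr // mul0r dotv_inversion_lt0.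
have Tw1 : T w < 1.
  have := dotv_inversion_lt0 Ww wp lp lw; rewrite (TE w) // dotv_line.
  rewrite (dotv_inversion_eq0 lp lZ) mulr0 addr0.
  by rewrite nmulr_llt0 ?dotv_inversion_lt0 // subr_gt0.
(* Facet [m] misses [p]. Its rescaled slack on the line is a quadratic with positive leading
   coefficient and with roots at the two ends of the edge; as it is positive at [y], the point of
   [y] is outside the interval. *)
have T_edge x x' y m : W x -> W x' -> W y -> [set i; j] \subset incident x ->
    [set i; j] \subset incident x' -> [set i; j] \subset incident y ->
    x != p -> x' != p -> y != p -> x != x' -> m \notin [set i; j] ->
    m \in incident x -> m \in incident x' -> m \notin incident y ->
    0 < (T y - T x) * (T y - T x').
  move=> Wx Wx' Wy sx sx' sy xp x'p yp xx' mij mx mx' my.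
  have mp : 0 < slack m p.
    rewrite slack_gt0 //; apply: contraNN xx' => mp.
    by rewrite (edge_two2 Wp Wx Wx' ij mij).
  pose v0 := inversion p Z - inversion p A.
  (* At [T z] its value is the slack of [m] at [z] over the squared distance from [z] to [p], since
     the squared norm of the image is the inverse of that squared distance. *)
  pose f (t : R) := slack m p * dotv v0 v0 * t ^+ 2
    + (slack m p * dotv v0 (inversion p A) *+ 2 - dotv (a m) v0) * t
    + (slack m p * dotv (inversion p A) (inversion p A) - dotv (a m) (inversion p A)).
  have fE z : W z -> [set i; j] \subset incident z -> z != p ->
      f (T z) = slack m z / dotv (z - p) (z - p).
    move=> Wz sz zp.
    have z0 : dotv (z - p) (z - p) != 0 by rewrite dotvv_eq0 subr_eq0.
    have -> : slack m z / dotv (z - p) (z - p) = slack m p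
        * dotv (inversion p z) (inversion p z) - dotv (a m) (inversion p z).
      rewrite inversion_norm // dotv_inversionE /slack.
      by ring.
    rewrite (TE z Wz sz zp) -/v0 /f {f}; move: v0 (inversion p A) => v u.
    by rewrite !dotvE (dotvC u v); ring.
  apply: (@quadratic_sign (slack m p * dotv v0 v0)
    (slack m p * dotv v0 (inversion p A) *+ 2 - dotv (a m) v0)
    (slack m p * dotv (inversion p A) (inversion p A) - dotv (a m) (inversion p A))).
  - rewrite mulr_gt0 // dotvv_gt0 subr_eq0.
    by apply: contraNneq AZ => e; rewrite (inversion_inj Zp Ap e).
  - by apply: contraNneq xx' => /T_inj ->.
  - by move/eqP: mx; rewrite -[LHS]/(f (T x)) fE // -slack_eq0 => /eqP/eqP->; rewrite mul0r.
  - by move/eqP: mx'; rewrite -[LHS]/(f (T x')) fE // -slack_eq0 => /eqP/eqP->; rewrite mul0r.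
  - rewrite -[ltRHS]/(f (T y)) fE // divr_gt0 ?slack_gt0 //.
    by rewrite dotvv_gt0 subr_eq0.
(* Let [x] be the last point of [C] before [w] on the line. *)
pose S := [seq x <- C | (x != p) && (T x < T w)].
have AS : A \in S by rewrite mem_filter Ap TA Tw0.
have [x xS xmax] := seq_argmax T AS.
move: (xS); rewrite mem_filter => /andP[/andP[xp xw] xC].
have [Wx sx] := CW x xC.
have [m1 [m2 [m12 em]]] := vertex_other_two Wx ij sx.
have emC : incident x :\: [set i; j] = [set m2; m1] by rewrite em finset.setUC.
have /finset.setDP[mx1 mij1] : m1 \in incident x :\: [set i; j] by rewrite em set21.
have /finset.setDP[mx2 mij2] : m2 \in incident x :\: [set i; j] by rewrite em set22.
(* No edge straddles [w], so a neighbour of [x] also comes before [w], hence before [x]. *)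
have nbr m x' : m \notin [set i; j] -> m \in incident x -> x' \in C -> x' != x ->
    m \in incident x' -> x' != p -> T x' < T x.
  move=> mij mx x'C x'x mx' x'p; have [Wx' sx'] := CW x' x'C.
  have mw : m \notin incident w.
    apply: contraNN (neqw x' x'C) => mw.
    by rewrite (edge_two2 Wx Ww Wx' ij mij) // neqw.
  have xx' : x != x' by rewrite eq_sym.
  have := T_edge x x' w m Wx Wx' Ww sx sx' sw xp x'p wp xx' mij mx mx' mw.
  rewrite pmulr_rgt0 ?subr_gt0 // => x'w.
  have /xmax : x' \in S by rewrite mem_filter x'p x'w.
  rewrite le_eqVlt => /predU1P[/T_inj e|//].
  by rewrite e ?eqxx in x'x.
(* If [p] is a neighbour of [x], then [x] is [A] or [Z]: at [A] the other neighbour would have a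
   negative coordinate, and [Z], at 1, is not before [w]. *)
have end_case n1 n2 x1 x2 : incident x :\: [set i; j] = [set n1; n2] ->
    n1 \in incident x -> n2 \in incident x -> n1 \notin [set i; j] ->
    n2 \notin [set i; j] -> x1 \in C -> x2 \in C -> x1 != x -> x2 != x ->
    n1 \in incident x1 -> n2 \in incident x2 -> x1 = p -> False.
  move=> en nx1 nx2 nij1 nij2 x1C x2C x1x x2x n1x1 n2x2 x1p.
  have n1p : n1 \in incident p by rewrite -x1p.
  have x2p : x2 != p.
    apply: contraNneq xp => x2p.
    by rewrite (eq_vertex_of_two Wx Wp en) // -x2p.
  have := nbr n2 x2 nij2 nx2 x2C x2x n2x2 x2p.
  have : n1 \in incident p :\: [set i; j] by rewrite finset.in_setD nij1.
  rewrite ekl => /set2P[] e.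
    have -> : x = A by apply: (edge_two2 Wp Wx WA ij nij1); rewrite // e.
    by rewrite TA ltNge T_ge0 //; case: (CW x2 x2C).
  have xZ : x = Z by apply: (edge_two2 Wp Wx WZ ij nij1); rewrite // e.
  by move: xw; rewrite xZ TZ ltNge ltW.
have [x1 [x1C x1x m1x1]] := Cedge x m1 xC mx1 mij1.
have [x2 [x2C x2x m2x2]] := Cedge x m2 xC mx2 mij2.
have [x1p|x1p] := eqVneq x1 p.
  by case: (end_case m1 m2 x1 x2).
have [x2p|x2p] := eqVneq x2 p.
  by case: (end_case m2 m1 x2 x1).
have Tx1 := nbr m1 x1 mij1 mx1 x1C x1x m1x1 x1p.
have Tx2 := nbr m2 x2 mij2 mx2 x2C x2x m2x2 x2p.
have [[Wx1 sx1] [Wx2 sx2]] := (CW x1 x1C, CW x2 x2C).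
have m1x2 : m1 \notin incident x2.
  apply: contraNN x2x => m1x2.
  by rewrite (eq_vertex_of_two Wx Wx2 em).
have m2x1 : m2 \notin incident x1.
  apply: contraNN x1x => m2x1.
  by rewrite (eq_vertex_of_two Wx Wx1 em).
have xx1 : x != x1 by rewrite eq_sym.
have xx2 : x != x2 by rewrite eq_sym.
(* Both edges reach [x] from the left, and neither contains the far end of the other: each far end
   would have to be left of the other. *)
have := T_edge x x1 x2 m1 Wx Wx1 Wx2 sx sx1 sx2 xp x1p x2p xx1 mij1 mx1 m1x1 m1x2.
have := T_edge x x2 x1 m2 Wx Wx2 Wx1 sx sx2 sx1 xp x2p x1p xx2 mij2 mx2 m2x2 m2x1.
rewrite !nmulr_rgt0 ?subr_lt0 // => h1 h2.
by have := lt_trans h1 h2; rewrite ltxx.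
Qed.

End InscribedSimple.

(** * Duals of neighborly polytopes *)

Section Homogenization.
Variables (R : realType) (d : nat).
Implicit Types (p q x y : 'rV[R]_d) (Q F : set 'rV[R]_d).

(** An affine functional becomes a column, an affine dependence a linear one, and the rank is the
    affine dimension plus one. *)
Definition hom p : 'rV[R]_(d + 1) := row_mx p 1%:M.

Lemma hom_mul p (f : 'cV[R]_(d + 1)) :
  (hom p *m f) 0 0 = dotv (usubmx f)^T p + f (rshift d 0) 0.
Proof.
rewrite /hom -[f in LHS]vsubmxK mul_row_col mul1mx dotvC.
rewrite -[usubmx f in LHS]trmxK dotv_mx !mxE mulr1n.
by congr (_ + f _ _); apply/val_inj.
Qed.

Lemma hom_mul_col p c b :
  (hom p *m col_mx c^T (- b)%:M) 0 0 = dotv c p - b.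
Proof. by rewrite hom_mul col_mxKu trmxK col_mxEd mxE eqxx. Qed.

Lemma hom_sum m (l : 'rV[R]_m) (p : 'I_m -> 'rV[R]_d) c b :
  l *m (\matrix_i hom (p i)) = 0 -> \sum_i l 0 i * (dotv c (p i) - b) = 0.
Proof.
move=> e; have := congr1 (fun M => (M *m col_mx c^T (- b)%:M) 0 0) e.
rewrite /= mul0mx (mulmx_sum_row l) mulmx_suml summxE mxE => e0; rewrite -[RHS]e0.
apply: eq_bigr => i _; rewrite -scalemxAl rowK [RHS]mxE.
by rewrite hom_mul_col.
Qed.

(** The rows of [B] are a base point and, with last coordinate 0, a basis of the directions.
    Minimality holds because the points whose rows lie in a given row space form an affine set. *)
Lemma has_dim_hom Q k : has_dim Q k -> exists B : 'M[R]_(k.+1, d + 1),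
  [/\ row_free B, forall q, Q q -> (hom q <= B)%MS &
    forall m (A : 'M[R]_(m, d + 1)),
      (forall q, Q q -> (hom q <= A)%MS) -> (B <= A)%MS].
Proof.
case=> x [U [QU dU]].
have Qx q : Q q -> q - x \in U.
  by move=> Qq; have : aff_hull Q q by [apply: sub_gen_smallest]; rewrite QU.
pose M : 'M[R]_(k, d) := \matrix_(i < k) (vbasis U)`_i.
pose B : 'M[R]_(1 + k, d + 1) := col_mx (hom x) (row_mx M 0).
have MU (v : 'rV[R]_k) : v *m M \in U.
  rewrite mulmx_sum_row memv_suml // => i _; rewrite memvZ //.
  by rewrite rowK vbasis_mem // mem_nth // size_tuple dU.
have UM v : v \in U -> exists l : 'rV[R]_k, v = l *m M.
  move=> /coord_vbasis e; exists (\row_i coord (vbasis U) (cast_ord (esym dU) i) v).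
  rewrite {1}e mulmx_sum_row (reindex (cast_ord (esym dU))) /=.
    by apply: eq_bigr => i _; rewrite rowK mxE.
  by exists (cast_ord dU) => i _; rewrite ?cast_ordK ?cast_ordKV.
have kerB (l : 'rV[R]_(1 + k)) : l *m B = 0 -> l = 0.
  rewrite -[l]hsubmxK /B /hom mul_row_col !mul_mx_row mulmx1 mulmx0 add_row_mx addr0.
  rewrite -[0 in RHS]row_mx0 => /eq_row_mx[]; move: (lsubmx l) (rsubmx l) => l1 l2.
  move=> + l10; rewrite l10 mul0mx add0r mulmx_sum_row => e.
  suff -> : l2 = 0 by rewrite row_mx0.
  apply/rowP => i; rewrite mxE.
  have /freeP/(_ (fun j => l2 0 (cast_ord dU j))) := basis_free (vbasisP U).
  move=> /(_ _ (cast_ord (esym dU) i)); rewrite cast_ordKV; apply.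
  rewrite -[RHS]e (reindex (cast_ord dU)) /=.
    by apply: eq_bigr => j _; rewrite rowK.
  by exists (cast_ord (esym dU)) => j _; rewrite ?cast_ordK ?cast_ordKV.
exists B; split.
- by rewrite -kermx_eq0; apply/rowV0P => l /sub_kermxP/kerB.
- move=> q /Qx /UM[l e].
  have eB : row_mx (1%:M : 'M[R]_1) l *m B = hom q.
    rewrite /B mul_row_col mul1mx mul_mx_row mulmx0 /hom add_row_mx addr0.
    by rewrite -e addrC subrK.
  by rewrite -eB; apply: submxMl.
- move=> m A QA.
  have affA : aff_hull Q `<=` [set y | (hom y <= A)%MS].
    apply: smallest_sub => // y z t /= yA zA.
    have -> : hom ((1 - t) *: y + t *: z) = (1 - t) *: hom y + t *: hom z.
      by rewrite /hom !scale_row_mx add_row_mx -scalerDl subrK scale1r.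
    by rewrite addmx_sub // scalemx_sub.
  rewrite QU in affA.
  have xA : (hom x <= A)%MS by apply: affA; rewrite /= subrr mem0v.
  suff : (B <= A)%MS by [].
  rewrite /B col_mx_sub xA /=; apply/row_subP => i.
  have -> : row i (row_mx M 0) = hom (x + row i M) - hom x.
    rewrite /hom row_row_mx row0 opp_row_mx add_row_mx subrr.
    by rewrite [x + _]addrC addrK.
  rewrite addmx_sub ?eqmx_opp //; apply: affA => /=.
  by rewrite [x + _]addrC addrK rowK vbasis_mem // mem_nth // size_tuple dU.
Qed.

Lemma vertex_between Q v x y s : vertices Q v -> Q x -> Q y -> x != v ->
  v = x + s *: (y - x) -> 0 < s -> s < 1 -> False.
Proof.
case=> c [b [cb vE]] Qx Qy xv e s0 s1.
have [Qv /= cv] : (Q `&` [set x | dotv c x = b]) v by rewrite -vE.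
have cx : dotv c x = b.
  move: cv; rewrite {1}e !dotvE => cv.
  have := cb x Qx; have := cb y Qy => hy hx; apply/le_anti; rewrite hx /=.
  have : 0 <= s * (b - dotv c y) by rewrite mulr_ge0 ?subr_ge0 // ltW.
  have : 0 <= (1 - s) * (b - dotv c x) by rewrite mulr_ge0 ?subr_ge0 // ltW.
  move=> h1 h2; have h3 : (1 - s) * (b - dotv c x) <= 0 by lra.
  by rewrite -subr_le0 -(pmulr_rle0 _ (_ : 0 < 1 - s)) // subr_gt0.
by move/eqP: xv; apply; have : [set v] x by rewrite vE.
Qed.

(** The rows of [x] and [y] span the rank two space of the edge, so [z] is on their line; of three
    distinct points on a line one is strictly between the others and is no vertex. *)
Lemma edge_vertices Q F x y z : is_edge Q F -> vertices Q x -> vertices Q y ->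
  vertices Q z -> F x -> F y -> F z -> x != y -> x != z -> y = z.
Proof.
move=> [FQ /has_dim_hom[B [Bfree FB _]]] Vx Vy Vz Fx Fy Fz xy xz.
apply/eqP; apply: contraT => yz.
pose A := col_mx (hom x) (hom y).
have Afree : row_free A.
  rewrite -kermx_eq0; apply/rowV0P => l /sub_kermxP.
  rewrite -[l]hsubmxK /A mul_row_col [lsubmx l]mx11_scalar [rsubmx l]mx11_scalar.
  rewrite !mul_scalar_mx /hom !scale_row_mx add_row_mx.
  rewrite -[0 in RHS]row_mx0 => /eq_row_mx[e1].
  move: e1; move: (lsubmx l 0 0) (rsubmx l 0 0) => l1 l2 e1.
  rewrite -scalerDl => /matrixP/(_ 0 0); rewrite !mxE eqxx mulr1 => /eqP.
  rewrite addr_eq0 => /eqP l12; move: e1; rewrite l12 scaleNr addrC.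
  move=> /eqP; rewrite subr_eq0 -subr_eq0 -scalerBr scaler_eq0 subr_eq0.
  by rewrite [y == x]eq_sym (negPf xy) orbF => /eqP->; rewrite oppr0 !raddf0 row_mx0.
have AB : (A <= B)%MS by rewrite /A col_mx_sub !FB.
have BA : (B <= A)%MS.
  have [_] := mxrank_leqif_sup AB; rewrite (eqP Afree) (eqP Bfree) eqxx.
  by move=> <-.
have /submxP[l] := submx_trans (FB z Fz) BA.
rewrite -[l]hsubmxK /A mul_row_col [lsubmx l]mx11_scalar [rsubmx l]mx11_scalar.
rewrite !mul_scalar_mx /hom !scale_row_mx add_row_mx => /eq_row_mx[].
move: (lsubmx l 0 0) (rsubmx l 0 0) => l1 t ez.
rewrite -scalerDl => /matrixP/(_ 0 0); rewrite !mxE eqxx mulr1 => l1t.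
have l1E : l1 = 1 - t by rewrite [1]l1t addrK.
have {l1 l1E l1t}ez : z = x + t *: (y - x).
  by rewrite ez l1E scalerBl scale1r scalerBr addrA addrAC.
have Qx := vertex_mem Vx; have Qy := vertex_mem Vy; have Qz := vertex_mem Vz.
have [t0|t0|t0] := ltgtP t 0.
- have d0 : 0 < 1 - t by lra.
  case: (@vertex_between Q x z y (- t / (1 - t)) Vx Qz Qy).
  + by rewrite eq_sym.
  + rewrite ez; have -> : y - (x + t *: (y - x)) = (1 - t) *: (y - x).
      by rewrite scalerBl scale1r opprD addrA.
    by rewrite scalerA mulfVK ?gt_eqF // scaleNr addrK.
  + by rewrite divr_gt0 // oppr_gt0.
  + by rewrite ltr_pdivrMr //; lra.
- have [t1|t1|t1] := ltgtP t 1.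
  + by case: (@vertex_between Q z x y t Vz Qx Qy).
  + case: (@vertex_between Q y x z t^-1 Vy Qx Qz) => //.
    * have -> : z - x = t *: (y - x) by rewrite ez addrC addKr.
      by rewrite scalerA mulVf ?gt_eqF // scale1r addrC subrK.
    * by rewrite invr_gt0.
    * by rewrite invf_lt1.
  + by move/eqP: yz; rewrite ez t1 scale1r addrC subrK.
- by move/eqP: xz; rewrite ez t0 scale0r addr0.
Qed.

End Homogenization.

(** * Affine independence from neighborliness *)

Section Neighborly.
Variables (R : realType) (d : nat) (Q : set 'rV[R]_d) (u : 'I_8 -> 'rV[R]_d).
Hypothesis Qpol : polytope Q.
Hypothesis Qdim : has_dim Q 4.
Hypothesis Qnbly : neighborly Q.
Hypothesis u_inj : injective u.
Hypothesis uQ : forall i, vertices Q (u i).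
Hypothesis Qu : forall v, vertices Q v -> exists i, v = u i.

Lemma u_mem i : Q (u i).
Proof. exact: vertex_mem (uQ i). Qed.

Lemma sum0_gt0 m (l : 'rV[R]_m) : \sum_i l 0 i = 0 -> l != 0 -> exists i, 0 < l 0 i.
Proof.
move=> sl l0; apply: contrapT => nl.
have lle i : l 0 i <= 0 by rewrite leNgt; apply/negP => li; apply: nl; exists i.
move/eqP: l0; apply; apply/rowP => i; rewrite mxE; apply/eqP; rewrite -oppr_eq0.
apply/eqP; move: i (isT : xpredT i); apply: psumr_eq0P => [i _|].
  by rewrite oppr_ge0.
by rewrite sumrN sl oppr0.
Qed.

(* A Radon partition of at most five vertices has a part with at most two elements,
   and by neighborliness that part lies on an edge. *)
Lemma radon_small m (s : 'I_m -> 'I_8) (l : 'rV[R]_m) : injective s ->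
  (forall c b, \sum_i l 0 i * (dotv c (u (s i)) - b) = 0) ->
  (#|[set i | (0 < l 0 i)%R]%SET| <= 2)%N -> l = 0.
Proof.
move=> s_inj l0 small; apply/eqP; apply: contraT => lN0.
have us_inj i j : u (s i) = u (s j) -> i = j by move/u_inj/s_inj.
have sl : \sum_i l 0 i = 0.
  rewrite -[RHS](l0 0 (-1)); apply: eq_bigr => i _.
  by rewrite dot0v sub0r opprK mulr1.
have [i0 li0] := sum0_gt0 sl lN0.
have [||j0] := @sum0_gt0 _ (- l).
- by under eq_bigr do rewrite mxE; rewrite sumrN sl oppr0.
- by rewrite oppr_eq0.
rewrite mxE oppr_gt0 => lj0.
have ij0 : i0 != j0 by apply: contraTneq li0 => ->; rewrite -leNgt ltW.
(* If the positive part is a single index, a negative one completes it to an edge. *)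
have [i1 [i01 i1P i1j]] : exists i1, [/\ i0 != i1,
    forall i, 0 < l 0 i -> i = i0 \/ i = i1 & 0 < l 0 i1 \/ i1 = j0].
  have [/existsP[i1 /andP[i10 li1]]|/existsPn no] :=
    boolP [exists i, (i != i0) && (0 < l 0 i)].
    exists i1; split; [by rewrite eq_sym| |by left].
    move=> i li; have [->|ii0] := eqVneq i i0; [by left|right].
    apply/eqP; apply: contraT => ii1.
    have c3 : #|[set i0; i1; i]%SET| = 3%N.
      rewrite finset.setUC cardsU1 !inE cards2 (negPf ii0) (negPf ii1).
      by rewrite eq_sym i10.
    suff /leq_trans/(_ small) : (#|[set i0; i1; i]%SET| <= #|[set i | (0 < l 0 i)%R]%SET|)%N.
      by rewrite c3.
    apply: subset_leq_card; apply/fintype.subsetP => k.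
    by rewrite !inE => /orP[/orP[]|] /eqP->.
  exists j0; split=> //; last by right.
  by move=> i li; left; have := no i; rewrite li andbT negbK => /eqP.
have u01 : u (s i0) <> u (s i1) by move/us_inj/eqP; rewrite (negPf i01).
have [F [FE Fi0 Fi1]] := Qnbly (uQ (s i0)) (uQ (s i1)) u01.
have [[c [b [cb FcE]]] _] := FE.
(* For the functional of the edge the positive terms vanish and the others are nonnegative; as the
   sum is 0, the points of the negative part lie on the edge too. *)
have Fle i : l 0 i < 0 -> F (u (s i)).
  move=> li; rewrite FcE; split; first exact: u_mem.
  have /psumr_eq0P/(_ (l0 c b)) : forall i, true -> 0 <= l 0 i * (dotv c (u (s i)) - b).
    move=> k _; have [lk|lk] := leP (l 0 k) 0.
      by rewrite mulr_le0 // subr_le0 cb //; exact: u_mem.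
    have : F (u (s k)) by case: (i1P k lk) => ->.
    by rewrite FcE => -[_ /= ->]; rewrite subrr mulr0.
  move=> /(_ i isT)/eqP; rewrite mulf_eq0 lt_eqF //= subr_eq0 => /eqP; exact.
have three j k : F (u (s j)) -> F (u (s k)) -> i0 != j -> i0 != k -> j = k.
  move=> Fj Fk ij ik; apply: us_inj.
  by apply: (edge_vertices FE (uQ (s i0)) (uQ (s j)) (uQ (s k)));
    rewrite // (inj_eq u_inj) (inj_eq s_inj).
have i1j0 : i1 = j0 by apply: three => //; apply: Fle.
have lz k : k != i0 -> k != j0 -> l 0 k = 0.
  move=> ki kj; apply/eqP; apply: contraT; rewrite neq_lt => /orP[lk|lk].
    by move: kj; rewrite (three k j0 (Fle k lk) (Fle j0 lj0)) ?eqxx // eq_sym.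
  by case: (i1P k lk) => e; rewrite ?i1j0 in e; rewrite e ?eqxx in ki kj.
case: u01; rewrite i1j0.
(* With at most two vertices on the edge only [i0] and [j0] remain, with opposite coefficients, so
   their points would coincide. *)
have two (f : 'I_m -> R) : \sum_i l 0 i * f i = l 0 i0 * f i0 + l 0 j0 * f j0.
  rewrite (bigD1 i0) //= (bigD1 j0) /=; last by rewrite eq_sym.
  by rewrite big1 ?addr0 // => k /andP[ki kj]; rewrite lz ?mul0r.
have lij : l 0 i0 + l 0 j0 = 0.
  by have := two (fun=> 1); rewrite !mulr1 => <-; rewrite -[RHS]sl;
    apply: eq_bigr => i _; rewrite mulr1.
apply: eq_dotv => c'; have := two (fun i => dotv c' (u (s i)) - 0).
rewrite l0 !subr0 => /eqP; rewrite eq_sym (_ : l 0 j0 = - l 0 i0); last by lra.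
by rewrite mulNr subr_eq0 => /eqP/mulfI->; rewrite ?gt_eqF.
Qed.

Lemma neighborly_independent m (s : 'I_m -> 'I_8) : (m <= 5)%N -> injective s ->
  row_free (\matrix_(i < m) hom (u (s i))).
Proof.
move=> m5 s_inj; rewrite -kermx_eq0; apply/rowV0P => l /sub_kermxP e.
have {e} l0 c b : \sum_i l 0 i * (dotv c (u (s i)) - b) = 0.
  exact: (hom_sum (p := fun i => u (s i))).
have [|big] := leqP #|[set i | (0 < l 0 i)%R]%SET| 2; first exact: (radon_small s_inj).
(* Otherwise at least three of at most five coefficients are positive, and at most two are negative:
   pass to [- l]. *)
apply/eqP; rewrite -oppr_eq0; apply/eqP; apply: (radon_small s_inj).
  by move=> c b; under eq_bigr do rewrite mxE mulNr; rewrite sumrN l0 oppr0.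
pose A (l : 'rV[R]_m) := [set i | (0 < l 0 i)%R]%SET.
have AI : (A l :&: A (- l))%SET = finset.set0.
  by apply/finset.setP => i; rewrite !inE mxE oppr_gt0; case: ltgtP.
have := leq_trans (max_card (mem (A l :|: A (- l))%SET)) _.
move=> /(_ 5); rewrite card_ord => /(_ m5).
rewrite cardsU AI cards0 subn0.
by have : (2 < #|A l|)%N := big; rewrite /A; move: #|_| #|_| => n1 n2; lia.
Qed.

Lemma hom_matrix_mul m (s : 'I_m -> 'I_8) (f : 'cV[R]_(d + 1)) i :
  ((\matrix_(i < m) hom (u (s i))) *m f) i 0
  = dotv (usubmx f)^T (u (s i)) + f (rshift d 0) 0.
Proof.
rewrite -hom_mul [LHS]mxE [RHS]mxE; apply: eq_bigr => k _; congr (_ * _).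
by rewrite mxE.
Qed.

Lemma affine_interpolation (I : {set 'I_8}) (f : 'I_8 -> R) : (#|I| <= 5)%N ->
  exists c b, forall i, i \in I -> dotv c (u i) - b = f i.
Proof.
move=> I5; have free := neighborly_independent I5 (@enum_val_inj _ (mem I)).
pose v : 'cV[R]_(#|I|) := \col_i f (enum_val i).
pose g := pinvmx (\matrix_(i < #|I|) hom (u (enum_val i))) *m v.
exists (usubmx g)^T, (- g (rshift d 0) 0) => i iI.
rewrite opprK -{1}(enum_rankK_in iI iI) -hom_matrix_mul /g mulmxA mulmxVp //.
by rewrite mul1mx mxE enum_rankK_in.
Qed.

(** * Facets, as maximal proper faces, are tetrahedra *)

Section Coatom.
Variable G : set 'rV[R]_d.
Hypothesis GQ : is_face Q G.
Hypothesis GnQ : G <> Q.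
Hypothesis Gmax : forall H, is_face Q H -> G `<=` H -> H = G \/ H = Q.

Definition face_labels (F : set 'rV[R]_d) : {set 'I_8} := [set i | `[< F (u i) >]]%SET.

Lemma coatom_outside : exists j, ~ G (u j).
Proof.
apply: contrapT => all_in; apply: GnQ; apply/seteqP; split; first exact: face_sub.
apply: (face_subset Qpol) => //; first exact: is_face_full.
move=> v /Qu[i ->] _; apply: contrapT => ni; apply: all_in; by exists i.
Qed.

(** Five vertices on [G] would be independent and span the affine hull of [Q], which would then lie
    in the hyperplane of [G]. *)
Lemma coatom_card_le4 : (#|face_labels G| <= 4)%N.
Proof.
rewrite leqNgt; apply/negP => c5.
pose s (i : 'I_5) := enum_val (widen_ord c5 i).
have s_inj : injective s.
  by move=> i j /enum_val_inj/(congr1 val)/= e; apply/val_inj.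
have sG i : G (u (s i)).
  by have := enum_valP (widen_ord c5 i); rewrite inE => /asboolP.
have free := neighborly_independent (leqnn 5) s_inj.
have [B [Bfree QB _]] := has_dim_hom Qdim.
have [c [b [cb GE]]] := GQ; have [j Gj] := coatom_outside.
set A := \matrix_(i < 5) hom (u (s i)) in free.
have AB : (A <= B)%MS.
  by apply/row_subP => i; rewrite rowK; exact/QB/u_mem.
have BA : (B <= A)%MS.
  by have [_] := mxrank_leqif_sup AB; rewrite (eqP free) (eqP Bfree) eqxx => <-.
have /submxP[l e] := submx_trans (QB _ (u_mem j)) BA.
apply: Gj; rewrite GE; split; first exact: u_mem.
have := congr1 (fun M => (M *m col_mx c^T (- b)%:M) 0 0) e.
rewrite /= hom_mul_col -mulmxA.
have -> : A *m col_mx c^T (- b)%:M = 0.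
  apply/matrixP => i k; rewrite ord1 /A (hom_matrix_mul s) col_mxKu trmxK col_mxEd.
  by have := sG i; rewrite GE !mxE eqxx mulr1n => -[_ /= ->]; rewrite subrr.
by rewrite mulmx0 mxE => /eqP; rewrite subr_eq0 => /eqP.
Qed.

(* Otherwise the supporting hyperplane of [G] can be rotated about [G] and a further
   vertex until it meets the rest of [Q]. *)
Lemma coatom_card_ge4 : (4 <= #|face_labels G|)%N.
Proof.
rewrite leqNgt; apply/negP => c3.
have [j Gj] := coatom_outside; have [c [b [cb GE]]] := GQ.
pose I := (j |: face_labels G)%SET.
have I4 : (#|I| <= 4)%N by rewrite /I cardsU1 inE; case: asboolP.
pose A := \matrix_(i < #|I|) hom (u (enum_val i)).
have [B [Bfree _ minB]] := has_dim_hom Qdim.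
have [q [Qq qA]] : exists q, Q q /\ ~~ (hom q <= A)%MS.
  apply: contrapT => nq; have /minB/mxrankS : forall q, Q q -> (hom q <= A)%MS.
    by move=> q Qq; apply: contrapT => /negP nqA; apply: nq; exists q.
  rewrite (eqP Bfree) => /leq_trans/(_ (rank_leq_row _)).
  by rewrite ltnNge I4.
(* A functional constant on [G] and on the further vertex [u j]: the direction of rotation. *)
have [f [fA fq]] : exists f : 'cV[R]_(d + 1), A *m f = 0 /\ 0 < (hom q *m f) 0 0.
  move: qA; rewrite submxE => /eqP/rowP qA.
  have /existsNP[k] : ~ forall k, (hom q *m cokermx A) 0 k = 0.
    by move=> h; apply: qA => k; rewrite h mxE.
  have col0 : A *m col k (cokermx A) = 0.
    by rewrite colE mulmxA mulmx_coker mul0mx.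
  have -> : (hom q *m cokermx A) 0 k = (hom q *m col k (cokermx A)) 0 0.
    by rewrite [LHS]mxE [RHS]mxE; apply: eq_bigr => l _; rewrite [col _ _ _ _]mxE.
  move=> /eqP; rewrite neq_lt => /orP[h|h]; last by exists (col k (cokermx A)).
  exists (- col k (cokermx A)); rewrite mulmxN col0 oppr0; split=> //.
  by rewrite mulmxN mxE oppr_gt0.
pose e := (usubmx f)^T; pose be := - f (rshift d 0) 0.
have eI i : i \in I -> dotv e (u i) = be.
  move=> iI; have := hom_matrix_mul enum_val f (enum_rank_in iI i).
  rewrite -/A fA mxE enum_rankK_in // => /esym/eqP.
  by rewrite addr_eq0 => /eqP.
have eq : be < dotv e q by move: fq; rewrite hom_mul /be -/e; lra.
have [l0 el0] : exists l, be < dotv e (u l).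
  apply: contrapT => nl; move: eq; rewrite ltNge => /negP; apply.
  apply: (face_le Qpol (@is_face_full _ _ Q)) => // v /Qu[l ->] _.
  by rewrite leNgt; apply/negP => h; apply: nl; exists l.
(* The amount of rotation at which the hyperplane meets [u l]; the least one keeps all of [Q] on one
   side. *)
pose ratio l := (b - dotv c (u l)) / (dotv e (u l) - be).
have [l el lmin] := @Order.TotalTheory.arg_minP _ _ _ l0
  (fun l => be < dotv e (u l)) ratio el0.
pose t := ratio l.
have cle i : dotv c (u i) <= b by exact/cb/u_mem.
have t0 : 0 <= t by rewrite divr_ge0 ?subr_ge0 // ltW.
have Cle i : dotv (c + t *: e) (u i) <= b + t * be.
  rewrite !dotvE; have [h|h] := ltP be (dotv e (u i)).
    have := lmin i h; rewrite -/t /ratio ler_pdivlMr ?subr_gt0 //; lra.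
  have : t * dotv e (u i) <= t * be by rewrite ler_wpM2l.
  have := cle i; lra.
pose H := Q `&` [set x | dotv (c + t *: e) x = b + t * be].
have HQ : is_face Q H.
  apply: (subface Qpol (@is_face_full _ _ Q)) => v /Qu[i ->] _; exact: Cle.
have GH : G `<=` H.
  apply: (face_subset Qpol GQ HQ) => v /Qu[i ->] Gi; split.
    exact: face_sub GQ _ Gi.
  rewrite /= !dotvE eI; last by rewrite !inE asboolT // orbT.
  by move: Gi; rewrite GE => -[_ /= ->].
(* [H] exceeds [G] by [u l], and it is not [Q], since [u j] on [H] would lie on [G]. *)
case: (Gmax HQ GH) => HE.
  have : H (u l).
    split; first exact: u_mem.
    by rewrite /= !dotvE /t /ratio; field; rewrite gt_eqF // subr_gt0.
  rewrite HE => Gl; move: el; rewrite eI ?ltxx //.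
  by rewrite !inE asboolT // orbT.
apply: Gj; rewrite GE; split; first exact: u_mem.
have : H (u j) by rewrite HE; exact: u_mem.
by case=> _ /=; rewrite !dotvE eI ?inE ?eqxx //; lra.
Qed.

Lemma coatom_card : #|face_labels G| = 4%N.
Proof. by apply/eqP; rewrite eqn_leq coatom_card_le4 coatom_card_ge4. Qed.

(** On the independent vertices of [G] a functional can be prescribed as 0 on [T] and -1 elsewhere;
    it exposes [T]. *)
Lemma coatom_subface (T : {set 'I_8}) : (T \subset face_labels G) ->
  exists H, [/\ is_face Q H, H `<=` G & face_labels H = T].
Proof.
move=> TG; have G5 : (#|face_labels G| <= 5)%N by rewrite coatom_card.
have [c [b cE]] := affine_interpolation (fun i => if i \in T then 0 else -1) G5.
have cG i : G (u i) -> dotv c (u i) - b = if i \in T then 0 else -1.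
  by move=> Gi; apply: cE; rewrite inE asboolT.
exists (G `&` [set x | dotv c x = b]); split.
- apply: (subface Qpol GQ) => v /Qu[i ->] /cG; case: ifP => _; lra.
- by move=> x [].
- apply/finset.setP => i; rewrite inE; apply/asboolP/idP => [[/cG + /= cb]|iT].
    by rewrite cb subrr; case: ifP => // _ /eqP; rewrite eq_sym oppr_eq0 oner_eq0.
  have Gi : G (u i) by move/fintype.subsetP: TG => /(_ i iT); rewrite inE => /asboolP.
  by split=> //=; have := cG i Gi; rewrite iT; lra.
Qed.

End Coatom.

(** An edge has at most two of the eight vertices, so it is a proper face. *)
Lemma edge_face i j : i != j -> exists F,
  [/\ is_face Q F, F <> Q, F (u i) & F (u j)].
Proof.
move=> ij; have uij : u i <> u j by move/u_inj/eqP; rewrite (negPf ij).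
have [F [FE Fi Fj]] := Qnbly (uQ i) (uQ j) uij.
exists F; split=> //; first by case: FE.
move=> FQ.
have [k ki kj] : exists2 k : 'I_8, i != k & j != k.
  have /properP[_ [k _]] : ([set i; j] \proper [set: 'I_8])%SET.
    by rewrite properEcard finset.subsetT cards2 ij cardsT card_ord.
  by rewrite !inE negb_or => /andP[ki kj]; exists k; rewrite eq_sym.
move/eqP: kj; case; apply: u_inj; apply: (edge_vertices FE (uQ i) (uQ j) (uQ k)) => //.
- by rewrite FQ; exact: u_mem.
- by rewrite (inj_eq u_inj).
- by rewrite (inj_eq u_inj).
Qed.

End Neighborly.

(** * Passage from points to incidence codes *)

Lemma inscribed_dual_contradiction (R : realType) (a : 'I_8 -> 'rV[R]_4)
    (b : 'I_8 -> R) (c0 : 'rV[R]_4) (r : R) (W : set 'rV[R]_4) :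
  (forall x i, W x -> dotv (a i) x <= b i) ->
  (forall x, W x -> dotv (x - c0) (x - c0) = r ^+ 2) ->
  (forall x, W x -> #|incident a b x| = 4%N) ->
  (forall x y, W x -> W y -> incident a b x = incident a b y -> x = y) ->
  (forall x (T : {set 'I_8}), W x -> T \subset incident a b x -> #|T| = 3%N ->
    exists y, [/\ W y, y <> x & T \subset incident a b y]) ->
  (forall i j, i != j -> exists2 x, W x & ([set i; j]%SET \subset incident a b x)) ->
  False.
Proof.
move=> W_le W_sph W_card W_inj W_edge W_pair.
have [V [VW VP]] : exists V : {set {set 'I_8}}, (forall x, W x -> incident a b x \in V) /\
    (forall t, t \in V -> exists2 x, W x & incident a b x = t).
  exists [set t | `[< exists2 x, W x & incident a b x = t >]]%SET; split=> [x Wx|t].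
    by rewrite inE; apply/asboolP; exists x.
  by rewrite inE => /asboolP.
(* A point for each code; sets that are no codes get the dummy value 0. *)
have /choice[pt ptP] : forall t, exists x, t \in V -> W x /\ incident a b x = t.
  move=> t; have [/VP[x Wx xt]|_] := boolP (t \in V); first by exists x.
  by exists 0.
have ptW t (tV : t \in V) : W (pt t) by case: (ptP t tV).
have ptE t (tV : t \in V) : incident a b (pt t) = t by case: (ptP t tV).
have pt_neq t t' : t \in V -> t' \in V -> t != t' -> pt t != pt t'.
  by move=> tV t'V; apply: contra_neq => e; rewrite -(ptE t tV) e ptE.
apply: (@no_configuration V).
- by move=> t tV; rewrite -(ptE t tV) W_card //; apply: ptW.
- move=> T T3; rewrite leqNgt; apply/negP => /card_gt2P[t1 [t2 [t3 [[]]]]].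
  rewrite !inE => /andP[t1V T1] /andP[t2V T2] /andP[t3V T3'] [t12 t23 t31].
  have [k kT] : exists k, k \in T by apply/card_gt0P; rewrite T3.
  have /cards2P[i [j [ij TE]]] : #|(T :\ k)%SET| == 2%N.
    by have := cardsD1 k T; rewrite kT T3 add1n => -[<-].
  have {}TE : T = [set i; j; k]%SET by rewrite -TE finset.setUC finset.setD1K.
  rewrite {}TE in T3 T1 T2 T3'.
  have := edge_two W_le W_sph W_card W_inj W_edge (ptW _ t1V) (ptW _ t2V) (ptW _ t3V) T3.
  have n21 : pt t2 != pt t1 by rewrite eq_sym pt_neq.
  have n31 : pt t3 != pt t1 by rewrite pt_neq.
  rewrite !ptE // => /(_ T1 T2 T3' n21 n31)/eqP.
  by rewrite (negPf (pt_neq _ _ t2V t3V t23)).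
- move=> t T tV; rewrite -{1}(ptE t tV) => Tt T3.
  have [y [Wy yt Ty]] := W_edge _ T (ptW t tV) Tt T3.
  exists (incident a b y); split=> //; first exact: VW.
  by apply/eqP => e; apply: yt; apply: W_inj; rewrite ?ptE //; apply: ptW.
- by move=> i j /W_pair[x Wx ijx]; exists (incident a b x) => //; exact: VW.
- move=> i j C ij /fintype.subsetP CV /finset.set0Pn[t0 t0C] Ccl.
  have CVt t : t \in C -> t \in V /\ [set i; j]%SET \subset t.
    by move=> /CV; rewrite inE => /andP[].
  pose L := [seq pt t | t <- enum C].
  have memL x : x \in L -> exists2 t, t \in C & x = pt t.
    by case/mapP => t; rewrite mem_enum; exists t.
  have Lmem t : t \in C -> pt t \in L by move=> tC; rewrite map_f // mem_enum.
  apply/fintype.subsetP => t; rewrite inE => /andP[tV ijt].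
  have /memL[t' t'C e] : pt t \in L.
    apply: (polygon_connected W_le W_sph W_card W_inj W_edge ij (Lmem t0 t0C)).
    - by move=> x /memL[t' /CVt[t'V ijt'] ->]; rewrite ptE //; split=> //; apply: ptW.
    - move=> x m /memL[t' t'C ->]; have [t'V _] := CVt t' t'C; rewrite ptE // => mt' mij.
      have [t'' [t''C t''t' mt'']] := Ccl t' m t'C mt' mij; have [t''V _] := CVt _ t''C.
      by exists (pt t''); rewrite ptE // Lmem // pt_neq.
    - exact: ptW.
    - by rewrite ptE.
  by rewrite -(ptE t tV) e ptE //; case: (CVt t' t'C).
move=> o s ok s_inj oV.
apply: (@obstruction_sound R V (fun x y => dist (pt x) (pt y))
  (fun k x => slack a b k (pt x)) _ _ _ _ _ o s) => //.
- by move=> x y; rewrite distC.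
- by move=> x y xV yV xy; rewrite dist_gt0 pt_neq.
- by move=> k x xV kx; rewrite (slack_gt0 W_le) ?ptE //; apply: ptW.
- move=> p x y z i j k l pV xV yV zV ij kp lp sp sx sy sz kx ky kz lz lx ly.
  apply: (ptolemy_lt W_le W_sph W_card W_inj W_edge (ptW _ pV) (ptW _ xV) (ptW _ yV)
    (ptW _ zV) ij (k := k) (l := l)); rewrite ?ptE //; apply: pt_neq => //.
  + by apply: contraNneq lx => ->.
  + by apply: contraNneq ky => ->.
  + by apply: contraNneq kz => ->.
- move=> p q x y i j k pV qV xV yV ij pq kp kq sp sq sx sy kx ky.
  by apply: (slack_ratio W_le W_sph W_card W_inj W_edge (ptW _ pV) (ptW _ qV) (ptW _ xV)
    (ptW _ yV) ij); rewrite ?ptE // pt_neq.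
Qed.

(** * Translation through the anti-isomorphism *)

Theorem theorem1p3 (R : realType) (d : nat)
    (P : set 'rV[R]_4) (Q : set 'rV[R]_d) :
  polytope P ->
  polytope Q -> has_dim Q 4 -> neighborly Q -> vertices Q #= `I_8 ->
  dual_polytopes P Q ->
  ~ inscribed P.
Proof.
move=> Ppol Qpol Qdim Qnbly /card_set_bijP[f [f_fun f_inj f_surj]].
move=> [phi [[phi_fun phi_inj phi_surj] phi_le]] [c0 [r [_ Psph]]].
have /choice[u uP] : forall i : 'I_8, exists x, vertices Q x /\ f x = i.
  by move=> i; have [x Qx <-] := f_surj i (ltn_ord i); exists x.
have uQ i : vertices Q (u i) by case: (uP i).
have fu i : f (u i) = i by case: (uP i).
have u_inj : injective u by move=> i j /(congr1 f); rewrite !fu => /val_inj.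
have Qu v : vertices Q v -> exists i, v = u i.
  move=> Qv; exists (Ordinal (f_fun v Qv)); apply: f_inj; [exact: mem_set..|].
  by rewrite fu.
have phi_face F : is_face P F -> is_face Q (phi F) by exact: phi_fun.
have phi_eq F G : is_face P F -> is_face P G -> phi F = phi G -> F = G.
  by move=> FP GP; apply: phi_inj; apply: mem_set.
have phi_onto H : is_face Q H -> exists2 F, is_face P F & phi F = H.
  by move=> /phi_surj[F FP <-]; exists F.
have phi0 : phi set0 = Q.
  have [F FP FE] := phi_onto _ (is_face_full Q).
  apply/seteqP; split; first exact: face_sub (phi_face _ (is_face0 P)).
  by rewrite -{1}FE; apply: (phi_le _ _ (is_face0 P) FP).1.
(* The facets of [P] are the faces sent to the vertices of [Q]; their supporting inequalities supply
   [a] and [b]. *)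
have /choice[ab abP] : forall i, exists cb : 'rV[R]_4 * R,
    (forall x, P x -> dotv cb.1 x <= cb.2) /\
    phi (P `&` [set x | dotv cb.1 x = cb.2]) = [set u i].
  move=> i; have [F [c [b [cb FE]]] phiF] := phi_onto _ (uQ i).
  by exists (c, b); rewrite -FE.
pose a i := (ab i).1; pose b i := (ab i).2.
pose facet i := P `&` [set x | dotv (a i) x = b i].
have facet_face i : is_face P (facet i).
  by exists (a i), (b i); split=> //; case: (abP i).
have phi_facet i : phi (facet i) = [set u i] by case: (abP i).
have incE x i : vertices P x -> (i \in incident a b x) = `[< phi [set x] (u i) >].
  move=> Px; have xi : facet i x <-> phi [set x] (u i).
    have := phi_le _ _ Px (facet_face i); rewrite phi_facet => -[h1 h2].
    split=> [Fx|phix]; first by apply: h1 => // y ->.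
    by apply: h2 => // y ->.
  rewrite inE; apply/eqP/asboolP => [e|/xi[]//]; apply/xi; split=> //.
  exact: vertex_mem Px.
have incF x : vertices P x -> incident a b x = face_labels u (phi [set x]).
  by move=> Px; apply/finset.setP => i; rewrite incE // inE.
(* Only the empty face lies properly inside [[set x]], so only [Q] lies properly above [phi
   [set x]]. *)
have coat x : vertices P x -> [/\ is_face Q (phi [set x]), phi [set x] <> Q &
    forall H, is_face Q H -> phi [set x] `<=` H -> H = phi [set x] \/ H = Q].
  move=> Px; split; first exact: phi_face.
    rewrite -phi0 => /(phi_eq _ _ Px (is_face0 P))/seteqP[/(_ x erefl)]; exact.
  move=> H /phi_onto[F FP <-] /(phi_le _ _ FP Px) Fx.
  have [Fn|Fn] := pselect (F x); [left|right].
    by congr (phi _); apply/seteqP; split=> // y ->.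
  rewrite -phi0; congr (phi _); apply/seteqP; split=> // y Fy.
  by apply: Fn; rewrite -(Fx y Fy).
apply: (@inscribed_dual_contradiction R a b c0 r (vertices P)).
- by move=> x i Px; case: (abP i) => ai _; exact: ai (vertex_mem Px).
- by move=> x /Psph.
- move=> x Px; rewrite incF //; have [xF xQ xmax] := coat x Px.
  exact: (coatom_card Qpol Qdim Qnbly).
- move=> x y Px Py; rewrite !incF // => /finset.setP e.
  have sub v w : vertices P v -> vertices P w ->
      (forall i, i \in face_labels u (phi [set v]) -> i \in face_labels u (phi [set w])) ->
      phi [set v] `<=` phi [set w].
    move=> Pv Pw vw; apply: (face_subset Qpol (phi_face _ Pv) (phi_face _ Pw)).
    move=> z /Qu[i ->] zi; apply/asboolP.
    have := vw i; rewrite !finset.in_set; apply; exact/asboolP.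
  have : [set x] = [set y].
    apply: phi_eq => //; apply/seteqP; split; apply: sub => // i; by rewrite e.
  by move=> /seteqP[/(_ x erefl)].
- move=> x T Px; rewrite incF // => Tx T3; have [xF xQ xmax] := coat x Px.
  (* Three of the four vertices of the tetrahedron [phi [set x]] form a face; it corresponds to a
     face of [P] that is larger than [[set x]] and so has a second vertex. *)
  have [H [HQ Hx HT]] :=
    coatom_subface Qpol Qdim Qnbly u_inj uQ Qu xF xQ xmax Tx.
  have [F FP FE] := phi_onto H HQ.
  have Fx : F x by apply: (phi_le _ _ Px FP).2; rewrite ?FE.
  have Fnx : F <> [set x].
    move=> Fxe; have := coatom_card Qpol Qdim Qnbly u_inj uQ Qu xF xQ xmax.
    by rewrite -Fxe FE HT T3.
  have [y [Py Fy yx]] := face_vertex_neq Ppol FP Fx Fnx.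
  exists y; split=> //; rewrite incF //; apply/fintype.subsetP => i iT.
  rewrite inE; apply/asboolP; apply: ((phi_le _ _ Py FP).1 _).
    by move=> z ->.
  by rewrite FE; move: iT; rewrite -HT inE => /asboolP.
(* An edge of [Q] is proper, so the face of [P] corresponding to it is nonempty; any vertex of that
   face lies on both facets. *)
- move=> i j ij; have [F [FQ FnQ Fi Fj]] := edge_face Qnbly u_inj uQ ij.
  have [G GP GE] := phi_onto F FQ.
  have [x0 Gx0] : G !=set0.
    apply/set0P/negP => /eqP G0; apply: FnQ.
    by rewrite -GE G0.
  have [x Px Gx] := face_vertex Ppol GP Gx0.
  have sub : F `<=` phi [set x].
    by rewrite -GE; apply: (phi_le _ _ Px GP).1 => z ->.
  exists x => //; rewrite finset.subUset !finset.sub1set !incE //.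
  by apply/andP; split; apply/asboolP; apply: sub.
Qed.
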